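(* Let $\omega\colon\mathbf Z_+\to(0,+\infty)$ be a weight which is bounded from below, such that $\sum_{n\ge0}1/\omega(k2^n)<+\infty$ for every $k\ge3$, and such that $\mathcal T$ is bounded on $\mathcal X_\omega$. Then there exists a Gaussian probability measure $m$ on $\mathcal X_\omega$ with full support which is $\mathcal T$-invariant and such that $\mathcal T$ is ergodic with respect to $m$. In particular this holds for $\omega=\omega_0$, $\omega_0(n)=(n+1)/\pi$.
   Context: $T\colon\mathbf Z_+\to\mathbf Z_+$ is the modified Collatz map: $T(n)=n/2$ for $n$ even, $T(n)=(3n+1)/2$ for $n$ odd. $\mathcal X_\omega$ is the Hilbert space of holomorphic functions $f(z)=\sum_{n\ge3}c_nz^n$ on the unit disk with $\|f\|_\omega^2=\sum_{n\ge3}|c_n|^2/\omega(n)<\infty$. $\mathcal T\sum_{n\ge3}c_nz^n=\sum_{j\ge3,\,T(j)\ge3}c_jz^{T(j)}$. $\mathcal T$ is bounded on $\mathcal X_\omega$ iff the sequences $\omega(6m)/\omega(3m)$, $\omega(6m+2)/\omega(3m+1)$, $(\omega(6m+4)+\omega(2m+1))/\omega(3m+2)$ ($m\ge1$) are bounded; this holds for $\omega_0$. A Borel probability measure $m$ on a complex Hilbert space $H$ is Gaussian if for every $x\in H$ the map $y\mapsto\langle y,x\rangle$ has complex symmetric Gaussian distribution (real and imaginary parts independent centered Gaussians with equal variance); it has full support if $m(U)>0$ for every nonempty open $U$; $\mathcal T$ is $m$-invariant if $m(\mathcal T^{-1}B)=m(B)$ for every Borel $B$, and ergodic if moreover $\mathcal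 T^{-1}B=B$ implies $m(B)\in\{0,1\}$. *)

(* Defs.v *)
(* MathComp + MathComp-Analysis (R : realType), complex numbers R[i]
   from mathcomp-real-closed. *)
From HB Require Import structures.
From mathcomp Require Import all_boot all_order all_algebra.
From mathcomp Require Import all_classical all_reals all_analysis.
From mathcomp Require Import complex.
Import Order.TTheory GRing.Theory Num.Theory.

Set Implicit Arguments.
Unset Strict Implicit.
Unset Printing Implicit Defensive.

Local Open Scope classical_set_scope.
Local Open Scope ring_scope.

(** The modified Collatz map T(n) = n/2 (n even), (3n+1)/2 (n odd). *)
Definition collatz (n : nat) : nat :=
  if odd n then ((3 * n + 1) %/ 2)%N else (n %/ 2)%N.

Section Xomega.
Variables (R : realType) (w : nat -> R).

(** squared modulus of a complex number *)
Definition cabs2 (z : R[i]) : R := complex.Re z ^+ 2 + complex.Im z ^+ 2.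

(** ||f||_w^2 = sum_{n>=3} |c_n|^2 / w(n)  (in the extended reals) *)
Definition normw2 (c : nat -> R[i]) : \bar R :=
  (\sum_(3 <= n <oo) (cabs2 (c n) / w n)%:E)%E.

(** c is the coefficient sequence of an element f(z) = sum_{n>=3} c_n z^n of
    X_w: no coefficients below index 3, the power series defines a holomorphic
    function on the unit disc (absolute convergence for every radius r < 1),
    and ||f||_w < +oo. *)
Definition in_Xw (c : nat -> R[i]) : Prop :=
  [/\ forall n, (n < 3)%N -> c n = 0,
      forall r : R, 0 <= r < 1 ->
        (\sum_(0 <= n <oo) (Num.sqrt (cabs2 (c n)) * r ^+ n)%:E < +oo)%E
    & (normw2 c < +oo)%E].

Record Xw := XW { coef : nat -> R[i]; coefP : in_Xw coef }.

Lemma in_Xw0 : in_Xw (fun _ => 0).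
Proof.
split.
- by [].
- move=> r _; rewrite eseries0 ?ltry // => i _ _.
  by rewrite /cabs2 /= expr0n /= addr0 sqrtr0 mul0r.
- by rewrite /normw2 eseries0 ?ltry // => i _ _; rewrite /cabs2 /= expr0n /= addr0 mul0r.
Qed.

HB.instance Definition _ := gen_eqMixin Xw.
HB.instance Definition _ := gen_choiceMixin Xw.
HB.instance Definition _ := isPointed.Build Xw (XW in_Xw0).

(** open sets of X_w for the norm topology *)
Definition openXw (U : set Xw) : Prop :=
  forall x, U x -> exists2 e : R, 0 < e &
    forall y : Xw, (normw2 (fun n => (coef y n - coef x n)%R) < e%:E)%E -> U y.

(** X_w with its Borel sigma-algebra (generated by the open sets) *)
Definition XwB := g_sigma_algebraType openXw.

(** real and imaginary parts of <y, x> = sum_{n>=3} y_n conj(x_n) / w(n) *)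
Definition ipRe (y x : Xw) : R :=
  \big[+%R/0]_(3 <= n <oo) (complex.Re (coef y n * (coef x n)^*) / w n).
Definition ipIm (y x : Xw) : R :=
  \big[+%R/0]_(3 <= n <oo) (complex.Im (coef y n * (coef x n)^*) / w n).

(** the operator cT : sum c_j z^j |-> sum_{j>=3, T(j)>=3} c_j z^(T j),
    on coefficient sequences (the preimages of k under T are <= 2k) *)
Definition Tseq (c : nat -> R[i]) (k : nat) : R[i] :=
  if (3 <= k)%N then \sum_(3 <= j < (2 * k).+1 | collatz j == k) c j else 0.

(** cT^{-1} B *)
Definition Tpre (B : set Xw) : set Xw :=
  [set x | exists2 y, B y & coef y = Tseq (coef x)].

(** centered real Gaussian of standard deviation s >= 0 (s = 0: Dirac at 0) *)
Definition gauss (s : R) : set R -> \bar R :=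
  if s == 0 then @dirac _ R (0 : R) R else normal_prob 0 s.

(** m is Gaussian: for every x, y |-> <y,x> is complex symmetric Gaussian,
    i.e. its real and imaginary parts are independent centered Gaussians with
    the same variance s^2 *)
Definition gaussian_measure (m : probability XwB R) : Prop :=
  forall x : Xw, exists2 s : R, 0 <= s &
    forall A B : set R, measurable A -> measurable B ->
      m [set y : XwB | A (ipRe y x) /\ B (ipIm y x)] = (gauss s A * gauss s B)%E.

Definition full_support (m : probability XwB R) : Prop :=
  forall U : set XwB, openXw U -> U !=set0 -> (0 < m U)%E.

Definition T_invariant (m : probability XwB R) : Prop :=
  forall B : set XwB, measurable B -> m (Tpre B) = m B.

Definition T_ergodic (m : probability XwB R) : Prop :=
  T_invariant m /\
  forall B : set XwB, measurable B -> Tpre B = B -> m B = 0%E \/ m B = 1%E.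

(** cT is bounded on X_w *)
Definition T_bounded : Prop :=
  exists C : R, forall x : Xw,
    in_Xw (Tseq (coef x)) /\ (normw2 (Tseq (coef x)) <= C%:E * normw2 (coef x))%E.

Definition conclusion313 : Prop :=
  exists m : probability XwB R,
    [/\ gaussian_measure m, full_support m, T_invariant m & T_ergodic m].

End Xomega.

Definition omega0 {R : realType} (n : nat) : R := (n%:R + 1) / pi.

(* Main.v *)
(* For odd i put nxt i = 3 i + 1, so that T (nxt i) = T i, and extend nxt to
   all i > 0 by nxt (2 i) = 2 nxt i.  The vectors f_i = e_i - e_(nxt i) satisfy
   T f_(2 i) = f_i, and T f_i = 0 for odd i, and they span a dense subspace,
   because e_i differs from the average of e_(nxt i), ..., e_(nxt^K i) by a
   combination of the f_j.
   Let G_i be independent standard complex Gaussian variables.  Summability of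
   1/w along k, 2 k, 4 k, ... allows weights sg i > 0 with sg (2 i) = sg i for
   which Y = sum_i sg i * G_i f_i converges almost surely.  Then T Y is the same
   series with G_i replaced by G_(2 i): on the law of Y, T acts as a one-sided
   shift of independent variables, so it preserves that law and is ergodic.
   The law is Gaussian as a limit of Gaussian sums.  It has full support since
   the f_i are total and, independently, a long head of the series is close to
   any prescribed combination and the tail is small with positive probability. *)
Require Import Defs.
From HB Require Import structures.
From mathcomp Require Import all_boot all_order all_algebra.
From mathcomp Require Import all_classical all_reals all_analysis.
From mathcomp Require Import complex.
From mathcomp Require Import measurable_realfun zify ring lra.
Import Order.TTheory GRing.Theory Num.Theory.
Import numFieldNormedType.Exports.
Set Implicit Arguments.
Unset Strict Implicit.
Unset Printing Implicit Defensive.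
Local Open Scope classical_set_scope.
Local Open Scope ring_scope.

(** * Infinite sequences of fair coins *)

(** A real Gaussian variable is a measurable function of a sequence of fair coins, so one space of
    0-1 sequences indexed by [nat * bool * nat] (variable, real or imaginary part, coin) carries all
    the randomness. A probability on it is determined by its values on cylinders: independence means
    disjoint sets of coordinates, and the shift is a reindexing along an injection, which preserves
    fairness. That the real and imaginary parts of an inner product with Y remain independent with
    equal variances comes from the rotation invariance of the standard Gaussian on the plane, itself
    derived from shears. The two conditions on the weight work at opposite ends. The lower bound on
    [w] bounds the norms of all e_n, which makes averages of many of them small. Summability
    controls the f_i along one orbit of doubling, where the weights [sg] have to be constant;
    damping is possible only from one odd part to the next. Boundedness of the operator makes the
    set of convergence of Y stable under the shift. *)

Lemma measurable_preimage d d' (T1 : measurableType d) (T2 : measurableType d')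
    (f : T1 -> T2) (F : set T2) :
  measurable_fun setT f -> measurable F -> measurable (f @^-1` F).
Proof. by move=> mf mF; rewrite -[X in measurable X]setTI; exact: mf. Qed.

Section image.
Context d d' (T1 : measurableType d) (T2 : measurableType d') (R : realType).

Definition image_measure (m : {measure set T1 -> \bar R}) (f : T1 -> T2)
  (mf : measurable_fun setT f) : {measure set T2 -> \bar R}.
Proof. refine (pushforward m f : {measure set T2 -> \bar R}); exact: mf. Defined.

Lemma image_measureE m f mf A : @image_measure m f mf A = m (f @^-1` A).
Proof. by []. Qed.

Lemma ge0_integral_image m f mf (g : T2 -> \bar R) :
  measurable_fun setT g -> (forall y, 0 <= g y)%E ->
  (\int[@image_measure m f mf]_y g y = \int[m]_x g (f x))%E.
Proof.
move=> mg g0; have := @ge0_integral_pushforward _ _ _ _ _ _ mf m setT g measurableT mg.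
by rewrite preimage_setT; apply => y _.
Qed.

Definition law (P : probability T1 R) (f : T1 -> T2)
  (mf : measurable_fun setT f) : probability T2 R :=
  distribution P (mfun_Sub (mem_set mf)).

Lemma ge0_integral_law P f mf (g : T2 -> \bar R) :
  measurable_fun setT g -> (forall y, 0 <= g y)%E ->
  (\int[@law P f mf]_y g y = \int[P]_x g (f x))%E.
Proof. exact: ge0_integral_image. Qed.

Lemma lawE P f mf A : @law P f mf A = P (f @^-1` A).
Proof. by []. Qed.

End image.

Section cylinders.
Context {I : eqType}.

(** The list may repeat or contradict itself; the cylinders, the empty set included, are then closed
    under intersection by mere concatenation. *)
Definition cyl (s : seq (I * bool)) : set (I -> bool) :=
  [set u | all (fun p => u p.1 == p.2) s].

Definition coinT := g_sigma_algebraType (range cyl).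

Lemma cyl_cat s t : cyl (s ++ t) = cyl s `&` cyl t.
Proof.
by apply/seteqP; split => u; rewrite /cyl/= all_cat => /andP.
Qed.

Lemma cyl_nil : cyl [::] = setT.
Proof. by apply/seteqP; split. Qed.

Lemma measurable_cyl s : measurable (cyl s : set coinT).
Proof. by apply: sub_sigma_algebra; exists s. Qed.

Lemma range_cylI : setI_closed (range cyl).
Proof. by move=> _ _ [s _ <-] [t _ <-]; exists (s ++ t); rewrite ?cyl_cat. Qed.

Lemma cyl_cons_in i b s : i \in unzip1 s ->
  cyl ((i, b) :: s) = cyl s \/ cyl ((i, b) :: s) = set0.
Proof.
move=> /mapP[[j b'] js /= ->]; have [<-|bb'] := eqVneq b' b.
- left; apply/seteqP; split => u; rewrite /cyl/=; first by case/andP.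
  by move=> us; rewrite us andbT; exact: (allP us _ js).
- right; rewrite -subset0 => u; rewrite /cyl/= => /andP[/eqP ub] /allP us.
  by have := us _ js; rewrite /= ub => /eqP e; rewrite e eqxx in bb'.
Qed.

Lemma measurable_coin i : measurable_fun setT (fun u : coinT => u i).
Proof.
move=> _ /= B _; rewrite setTI.
have h b : measurable ([set u : coinT | u i = b]).
  rewrite (_ : [set _ | _] = cyl [:: (i, b)]); first exact: measurable_cyl.
  by apply/seteqP; split => u; rewrite /cyl/= andbT => /eqP.
rewrite (_ : _ @^-1` _ = \bigcup_(b in B) [set u : coinT | u i = b]).
  by apply: fin_bigcup_measurable => //; exact: finite_finset.
by apply/seteqP; split => u /=; [move=> ?; exists (u i)|move=> [b Bb ->]].
Qed.

Lemma measurable_to_coin d (T : measurableType d) (f : T -> I -> bool) :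
  (forall i, measurable_fun setT (fun x => f x i)) ->
  measurable_fun setT (f : T -> coinT).
Proof.
move=> mf; apply: (@measurability _ _ T coinT setT f (range cyl)) => //.
move=> _ [_ [s _ <-] <-]; rewrite setTI.
elim: s => [|[i b] s ih]; first by rewrite cyl_nil preimage_setT.
rewrite -cat1s cyl_cat preimage_setI; apply: measurableI => //.
rewrite (_ : _ @^-1` _ = [set x | f x i = b]).
  have -> : [set x | f x i = b] = setT `&` (fun x => f x i) @^-1` [set b].
    by rewrite setTI.
  exact: mf.
by apply/seteqP; split => u; rewrite /cyl/= andbT => /eqP.
Qed.

End cylinders.
Arguments coinT : clear implicits.

Section fair.
Context {R : realType}.
Local Open Scope ereal_scope.

(** For a probability this says that the coordinates are independent fair bits: each fresh
    constraint halves the measure. No product measure has to be built to state it. *)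
Definition fair (I : eqType) (mu : set (coinT I) -> \bar R) :=
  forall s i b, i \notin unzip1 s ->
    mu (cyl ((i, b) :: s)) = (2^-1)%:E * mu (cyl s).

Lemma fair_cyl_cat (I : eqType) (mu : probability (coinT I) R) s t : fair mu ->
  (forall i, i \in unzip1 s -> i \notin unzip1 t) ->
  mu (cyl (s ++ t)) = mu (cyl s) * mu (cyl t).
Proof.
move=> fmu; elim: s => [|[i b] s ih] st.
  by rewrite cyl_nil probability_setT mul1e.
have {}ih : mu (cyl (s ++ t)) = mu (cyl s) * mu (cyl t).
  by apply: ih => j js; apply: st; rewrite inE js orbT.
have [is_|is_] := boolP (i \in unzip1 s); last first.
  rewrite cat_cons !fmu// ?ih ?muleA//.
  rewrite /unzip1 map_cat mem_cat negb_or is_/=.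
  by apply: st; rewrite inE eqxx.
rewrite cat_cons -cat1s -(cat1s _ s) cyl_cat (cyl_cat s) setIA -cyl_cat cat1s.
have [->|->] := cyl_cons_in b is_; first by rewrite -cyl_cat.
by rewrite set0I !measure0 mul0e.
Qed.

Lemma fair_unique (I : eqType) (mu nu : probability (coinT I) R) :
  fair mu -> fair nu -> forall A, measurable A -> mu A = nu A.
Proof.
move=> fmu fnu A mA.
have h s : mu (cyl s) = nu (cyl s).
  elim: s => [|[i b] s ih]; first by rewrite cyl_nil !probability_setT.
  have [is_|is_] := boolP (i \in unzip1 s); last by rewrite fmu// fnu// ih.
  by have [->|->] := cyl_cons_in b is_; rewrite ?measure0.
apply: (@measure_unique _ R (coinT I) (range cyl) (fun=> setT)) => //.
- exact: range_cylI.
- by move=> _; exists [::]; rewrite ?cyl_nil.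
- by rewrite bigcup_const//; exists 0%N.
- by move=> _ [s _ <-]; exact: h.
- by move=> _; rewrite -ge0_fin_numE// fin_num_measure.
Qed.

End fair.

Section independence.
Context {R : realType} {I : eqType} (mu : probability (coinT I) R).
Hypothesis fmu : fair mu.
Local Open Scope ereal_scope.

(** Forgets the coordinates outside [D]. An event depends on the coordinates in [D] alone exactly
    when it equals its preimage under this map. *)
Definition mask (D : pred I) (u : I -> bool) : I -> bool :=
  fun i => D i && u i.

Lemma measurable_mask D : measurable_fun setT (mask D : coinT I -> coinT I).
Proof.
apply: measurable_to_coin => i; rewrite /mask; case: (D i) => /=.
  exact: measurable_coin.
exact: measurable_cst.
Qed.

(** Masked coordinates read [false], so a constraint outside [D] is either vacuous or impossible. *)
Lemma mask_cyl D s : mask D @^-1` cyl s = set0 \/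
  exists2 t, {subset unzip1 t <= D} & mask D @^-1` cyl s = cyl t.
Proof.
elim: s => [|[i b] s ih].
  by right; exists [::] => //; rewrite !cyl_nil.
rewrite -cat1s cyl_cat preimage_setI.
have [->|[t tD ->]] := ih; first by left; rewrite setI0.
have [iD|iD] := boolP (i \in D).
  right; exists ((i, b) :: t).
    by move=> j; rewrite inE => /orP[/eqP ->//|]; exact: tD.
  rewrite -[_ :: t]cat1s cyl_cat; congr (_ `&` _).
  by apply/seteqP; split => u; rewrite /cyl/= /mask; move: iD; rewrite unfold_in => ->.
case: b; [left|right].
  rewrite -subset0 => u [] /=; rewrite /cyl/= /mask.
  by move: iD; rewrite unfold_in => /negbTE ->.
exists t => //; apply/seteqP; split => u; first by case.
by move=> tu; split => //; rewrite /cyl/= /mask; move: iD; rewrite unfold_in => /negbTE ->.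
Qed.

(* Uniqueness of finite measures on the pi-system of cylinders, once in each
   argument. *)
Lemma fair_mask_indep D (E F : set (coinT I)) : measurable E -> measurable F ->
  mu ((mask D @^-1` E) `&` (mask (predC D) @^-1` F)) =
  mu (mask D @^-1` E) * mu (mask (predC D) @^-1` F).
Proof.
have mD D' (A : set (coinT I)) : measurable A -> measurable (mask D' @^-1` A : set (coinT I)).
  by move=> mA; rewrite -[X in measurable X]setTI; exact: measurable_mask.
have pilam D' (B : set (coinT I)) : measurable B ->
    (forall s, mu ((mask D' @^-1` cyl s) `&` B) = mu (mask D' @^-1` cyl s) * mu B) ->
    forall A : set (coinT I), measurable A ->
      mu ((mask D' @^-1` A) `&` B) = mu (mask D' @^-1` A) * mu B.
  move=> mB h A mA.
  pose k := fine (mu B).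
  have kE : mu B = k%:E by rewrite fineK// fin_num_measure.
  have k0 : (0 <= k)%R by rewrite fine_ge0.
  pose m1 := image_measure (mrestr mu mB) (measurable_mask D').
  pose m2 : {measure set (coinT I) -> \bar R} :=
    mscale (NngNum k0) (image_measure mu (measurable_mask D')).
  have m1E X : m1 X = mu ((mask D' @^-1` X) `&` B) by [].
  have m2E X : m2 X = mu (mask D' @^-1` X) * mu B by rewrite kE muleC.
  rewrite -m1E -m2E.
  apply: (@measure_unique _ R (coinT I) (range cyl) (fun=> setT)) => //.
  - exact: range_cylI.
  - by move=> _; exists [::]; rewrite ?cyl_nil.
  - by rewrite bigcup_const//; exists 0%N.
  - by move=> _ [s _ <-]; rewrite m1E m2E.
  - move=> _; rewrite m1E -ge0_fin_numE//; apply: fin_num_measure.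
    by apply: measurableI => //; exact: mD.
move=> mE mF; apply: (pilam D _ (mD (predC D) F mF)) => // s.
rewrite setIC [RHS]muleC; apply: (pilam (predC D) _ (mD D _ (measurable_cyl s))) => //.
move=> t; have [->|[s' s'D ->]] := mask_cyl D s.
  by rewrite setI0 measure0 mule0.
have [->|[t' t'D ->]] := mask_cyl (predC D) t.
  by rewrite set0I measure0 mul0e.
rewrite -cyl_cat fair_cyl_cat// => i it; apply/negP => /s'D.
by have := t'D _ it; rewrite !unfold_in /= => /negP.
Qed.

(** Dependence on a set of coordinates is expressed pointwise, which is easy to check for events
    built from finitely many variables and replaces generated sub-sigma-algebras. *)
Lemma fair_indep (D : pred I) (E F : set (coinT I)) :
  measurable E -> measurable F ->
  (forall u v : I -> bool, {in D, u =1 v} -> E u -> E v) ->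
  (forall u v : I -> bool, {in predC D, u =1 v} -> F u -> F v) ->
  mu (E `&` F) = mu E * mu F.
Proof.
move=> mE mF ED FD; have := fair_mask_indep D mE mF.
have -> : mask D @^-1` E = E.
  by apply/seteqP; split => u /=; apply: ED => i iD; rewrite /mask (iD : D i).
suff -> : mask (predC D) @^-1` F = F by [].
by apply/seteqP; split => u /=; apply: FD => i iD; rewrite /mask (iD : predC D i).
Qed.

End independence.

Section rays.
Context {R : realType}.

Lemma measurable_fun_ray d (T : measurableType d) (f : T -> R) :
  (forall t, measurable [set x | t < f x]) -> measurable_fun setT f.
Proof.
move=> mf; apply: (measurability _ (RGenOInfty.measurableE R)) => //.
move=> _ [_ [t ->] <-]; rewrite setTI.
rewrite (_ : _ @^-1` _ = [set x | t < f x])//.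
by apply/seteqP; split => x /=; rewrite in_itv/= andbT.
Qed.

Lemma probability_ray_unique (mu nu : probability (measurableTypeR R) R) :
  (forall t : R, mu `]-oo, t]%classic = nu `]-oo, t]%classic) ->
  forall A, measurable A -> mu A = nu A.
Proof.
move=> h A mA.
have h' (t : R) : mu `]t, +oo[%classic = nu `]t, +oo[%classic.
  have -> : `]t, +oo[%classic = ~` `]-oo, t]%classic :> set R by rewrite setCitvl.
  by rewrite !probability_setC// h.
apply: (@measure_unique _ R (measurableTypeR R) (@RGenOInfty.G R)
  (fun n => `]- n%:R, +oo[%classic)) => //.
- exact: RGenOInfty.measurableE.
- move=> _ _ [x ->] [y ->]; exists (Num.max x y).
  by apply/seteqP; split => z /=; rewrite !in_itv/= !andbT gt_max => /andP.
- by move=> n; exists (- n%:R).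
- apply/seteqP; split => // x _; exists (Num.truncn (- x)).+1 => //=.
  by rewrite in_itv/= andbT ltrNl truncnS_gt.
- by move=> _ [t ->]; exact: h'.
- by move=> k; rewrite -ge0_fin_numE// fin_num_measure.
Qed.

End rays.

(** * The uniform law and quantile functions *)

Section unit_interval.
Context {R : realType}.

Definition unif : set (measurableTypeR R) -> \bar R :=
  mrestr lebesgue_measure (measurable_itv `[0%R, 1%R[).
HB.instance Definition _ := Measure.on unif.

Lemma unifE A : unif A = lebesgue_measure (A `&` `[0%R, 1%R[).
Proof. by []. Qed.

Let unifT : unif setT = 1%E.
Proof. by rewrite unifE setTI lebesgue_measure_itv/= lte01 sube0. Qed.
HB.instance Definition _ := Measure_isProbability.Build _ _ _ unif unifT.

Lemma unif_oo A : measurable A -> unif A = lebesgue_measure (A `&` `]0%R, 1%R[).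
Proof.
move=> mA; rewrite unifE; apply/eqP; rewrite eq_le; apply/andP; split; last first.
  apply: le_measure; rewrite ?inE; [exact: measurableI|exact: measurableI|].
  by apply: setIS; apply: subset_itvr; rewrite bnd_simp.
rewrite -[leRHS]adde0 -(@lebesgue_measure_set1 _ (0 : R)).
apply: (le_trans _ (measureU2 _ _ _)) => //; last exact: measurableI.
apply: le_measure; rewrite ?inE; [exact: measurableI| |].
  by apply: measurableU => //; exact: measurableI.
move=> x [Ax]; rewrite /= in_itv/= le_eqVlt => /andP[/orP[/eqP <-|x0] x1].
  by right.
by left; split => //; rewrite in_itv/= x0.
Qed.

(** With F the distribution function of [mu], take Q u = inf {t | u <= F t}. Then Q u <= t if and
    only if u <= F t, so the event Q <= t has uniform measure F t, and rays determine a law. *)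
Lemma quantile (mu : probability (measurableTypeR R) R) :
  exists2 Q : measurableTypeR R -> measurableTypeR R, measurable_fun setT Q &
    forall A, measurable A -> unif (Q @^-1` A) = mu A.
Proof.
pose idT : measurableTypeR R -> R := idfun.
have mid : measurable_fun setT idT by exact: measurable_id.
pose X : {RV mu >-> R} := mfun_Sub (mem_set mid).
have cdfE t : cdf X t = mu `]-oo, t]%classic by [].
pose F (t : R) := fine (mu `]-oo, t]%classic).
have FE (t : R) : mu `]-oo, t]%classic = (F t)%:E by rewrite fineK// fin_num_measure.
have F0 t : 0 <= F t by rewrite fine_ge0.
have F1 t : F t <= 1 by rewrite -lee_fin -FE probability_le1.
have Fnd s t : s <= t -> F s <= F t.
  move=> st; rewrite -lee_fin -!FE le_measure ?inE//; exact: subset_itvl.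
pose S u := [set t | u <= F t].
have Sne u : u < 1 -> S u !=set0.
  move=> u1; have := cvg_cdfy1 X => /fine_cvgP[_].
  move=> /cvgr_ge /(_ u u1) [M [_ hM]]; exists (M + 1).
  by rewrite /S/=; have := hM (M + 1); apply; rewrite ltrDl.
have Slb u : 0 < u -> has_lbound (S u).
  move=> u0; have := cvg_cdfNy0 X => /fine_cvgP[_].
  move=> /cvgr_lt /(_ u u0) [M [_ hM]]; exists (M - 1) => t St.
  rewrite leNgt; apply/negP => tM.
  have /= := hM (M - 1); rewrite gtrDl ltrN10 => /(_ isT).
  rewrite cdfE -/(F _) ltNge => /negP; apply.
  by rewrite (le_trans St)// Fnd// ltW.
(* The infimum is attained because F is right continuous. *)
have Sclosed u t : 0 < u -> u < 1 -> inf (S u) <= t -> u <= F t.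
  move=> u0 u1 ut.
  have hF t' : t < t' -> u <= F t'.
    move=> tt'; have [s Ss st'] := inf_lt (Sne u u1) (le_lt_trans ut tt').
    by apply: (le_trans Ss); exact/Fnd/ltW.
  have /fine_cvgP[_ Fc] : cdf X x @[x --> t^'+] --> (F t)%:E.
    by rewrite -FE -cdfE; exact: cdf_right_continuous.
  apply: (@closed_cvg _ _ _ _ _ (fun x : R => u <= x) (@closed_ge _ u) _ _ Fc).
  by near=> z; apply: hF; near: z; exact: nbhs_right_gt.
pose Q u := if (0 < u) && (u < 1) then inf (S u) else 0.
have Qle u t : 0 < u -> u < 1 -> (Q u <= t) = (u <= F t).
  move=> u0 u1; rewrite /Q u0 u1/=; apply/idP/idP; first exact: Sclosed.
  by move=> uF; apply: ge_inf => //; exact: Slb.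
(* The second piece of the decomposition comes from the default value 0 of [Q] outside ]0, 1[, which
   exceeds t only for t < 0. *)
have mQ : measurable_fun setT (Q : measurableTypeR R -> measurableTypeR R).
  apply: measurable_fun_ray => t.
  rewrite (_ : [set _ | _] = (`]0%R, 1%R[ `&` `]F t, +oo[%classic) `|`
    (if t < 0 then ~` `]0%R, 1%R[%classic else set0)); last first.
    apply/seteqP; split => u /=; rewrite !in_itv/= andbT.
    - have [/andP[u0 u1]|u01] := boolP ((0 < u) && (u < 1)).
        by rewrite ltNge Qle// -ltNge; left.
      by rewrite /Q (negbTE u01) => ->; right => /=; rewrite in_itv/=; exact/negP.
    - case=> [[/andP[u0 u1] Ftu]|]; first by rewrite ltNge Qle// -ltNge.
      by case: ifP => //= t0; rewrite in_itv/= /Q => /negP/negbTE ->.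
  apply: measurableU; first exact: measurableI.
  by case: ifP => // _; exact: measurableC.
exists Q => // A mA; rewrite -(lawE unif mQ).
apply: probability_ray_unique mA => t.
rewrite FE; change (unif (Q @^-1` `]-oo, t]%classic) = (F t)%:E).
rewrite unif_oo; last first.
  by rewrite -[X in measurable X]setTI; exact: mQ.
have [F1t|F1t] := ltP (F t) 1; last first.
  have -> : F t = 1 by apply/le_anti; rewrite F1.
  rewrite (_ : _ `&` _ = `]0%R, 1%R[%classic); last first.
    apply/seteqP; split => u /=; first by case.
    rewrite !in_itv/= => /andP[u0 u1]; rewrite u0 u1 Qle//; split => //.
    by rewrite (le_trans (ltW u1)).
  by rewrite lebesgue_measure_itv/= lte01 sube0.
transitivity (lebesgue_measure (`]0%R, F t]%classic : set R)).
  congr (lebesgue_measure _); apply/seteqP; split => u /=; rewrite !in_itv/=.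
    by move=> [+ /andP[u0 u1]]; rewrite Qle// u0.
  by move=> /andP[u0 uF]; rewrite u0 Qle ?uF ?(le_lt_trans uF).
rewrite lebesgue_measure_itv/= lte_fin; case: ltP => [_|Ft0]; first by rewrite sube0.
by congr EFin; apply/eqP; rewrite eq_le F0 Ft0.
Unshelve. all: by end_near.
Qed.


End unit_interval.

(** * Binary digits and the fair coin measure *)

Section digits.
Context {R : realType}.

Definition dig (k : nat) (x : R) : bool := odd (Num.truncn (2 ^+ k.+1 * x)).

Lemma truncn_div (x : R) d : (0 < d)%N -> 0 <= x ->
  Num.truncn (x / d%:R) = (Num.truncn x %/ d)%N.
Proof.
move=> d0 x0; apply: truncn_def.
have /andP[h1 h2] := truncn_itv x0.
have d0' : 0 < d%:R :> R by rewrite ltr0n.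
rewrite ler_pdivlMr// ltr_pdivrMr// -!natrM; apply/andP; split.
  by rewrite (le_trans _ h1)// ler_nat leq_divM.
by rewrite (lt_le_trans h2)// ler_nat ltn_ceil.
Qed.

Lemma measurable_truncn : measurable_fun setT (Num.truncn : R -> nat).
Proof.
move=> _ B _; rewrite setTI.
rewrite (_ : _ @^-1` B = \bigcup_(n in B) [set x : R | Num.truncn x = n]); last first.
  by apply/seteqP; split => x /=; [move=> ?; exists (Num.truncn x)|move=> [n Bn ->]].
apply: bigcup_measurable => n _; case: n => [|n].
  rewrite (_ : [set _ | _] = `]-oo, 1%R[%classic)//.
  apply/seteqP; split => x /=; rewrite in_itv/=.
    by move/truncn0Pn; rewrite -ltNge.
  by rewrite ltNge => /truncn0Pn.
rewrite (_ : [set _ | _] = `[n.+1%:R, n.+2%:R[%classic)//.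
apply/seteqP; split => x /=; rewrite in_itv/=; last exact: truncn_def.
move=> xn; have x0 : 0 <= x.
  by rewrite leNgt; apply/negP => x0; move: xn (truncn_gt0 x); rewrite leNgt => ->; rewrite (lt_trans x0).
by have := truncn_itv x0; rewrite xn.
Qed.

Lemma measurable_dig k : measurable_fun setT (dig k).
Proof.
apply: (@measurableT_comp _ _ _ _ _ _ odd) => //.
apply: (measurableT_comp measurable_truncn).
by apply: measurable_funM => //; exact: measurable_cst.
Qed.

(** The added bit lands on a zero digit, so there is no carry into the more significant digits. *)
Lemma dig_shift_lt k p (x : R) : (k < p)%N -> 0 <= x -> ~~ dig p x ->
  dig k (x + (2 ^+ p.+1)^-1) = dig k x.
Proof.
move=> kp x0 px; rewrite /dig.
have h y : 0 <= y -> Num.truncn (2 ^+ k.+1 * y) =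
    (Num.truncn ((2 : R) ^+ p.+1 * y) %/ 2 ^ (p - k))%N.
  move=> y0; rewrite -truncn_div ?expn_gt0// ?mulr_ge0 ?exprn_ge0//.
  congr Num.truncn; rewrite natrX mulrAC; congr (_ * _).
  have -> : p.+1 = (k.+1 + (p - k))%N by lia.
  by rewrite exprD mulfK// expf_neq0.
rewrite !h ?addr_ge0 ?invr_ge0 ?exprn_ge0// mulrDr mulfV ?expf_neq0//.
rewrite addrC truncnD ?nat_num1//; last by rewrite nnegrE mulr_ge0 ?exprn_ge0.
rewrite truncn1; move: px; rewrite /dig.
set n := Num.truncn _ => nodd.
have -> : (p - k = (p - k).-1.+1)%N by lia.
rewrite expnS !divnMA.
by have -> : ((1 + n) %/ 2 = n %/ 2)%N by lia.
Qed.

(** Seen from a less significant digit, the shift adds an even integer. *)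
Lemma dig_shift_gt k p (x : R) : (p < k)%N -> 0 <= x ->
  dig k (x + (2 ^+ p.+1)^-1) = dig k x.
Proof.
move=> pk x0; rewrite /dig mulrDr.
have -> : 2 ^+ k.+1 * (2 ^+ p.+1)^-1 = (2 ^ (k - p))%:R :> R.
  have -> : k.+1 = ((k - p) + p.+1)%N by lia.
  rewrite exprD mulfK ?expf_neq0// natrX; congr (_ ^+ _); lia.
rewrite addrC truncnD ?natr_nat//; last by rewrite nnegrE mulr_ge0 ?exprn_ge0.
rewrite natrK oddD oddX.
by rewrite orbF; have -> : (k - p == 0)%N = false by lia.
Qed.

Lemma dig_shift_eq p (x : R) : 0 <= x ->
  dig p (x + (2 ^+ p.+1)^-1) = ~~ dig p x.
Proof.
move=> x0; rewrite /dig mulrDr mulfV ?expf_neq0//.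
rewrite addrC truncnD ?nat_num1//; last by rewrite nnegrE mulr_ge0 ?exprn_ge0.
by rewrite truncn1 oddD.
Qed.

Lemma dig_sum n (x : R) : 0 <= x < 1 ->
  \sum_(k < n) (dig k x)%:R / 2 ^+ k.+1 =
  (Num.truncn (2 ^+ n * x))%:R / 2 ^+ n :> R.
Proof.
move=> /andP[x0 x1]; elim: n => [|n ih].
  rewrite big_ord0 expr0 mul1r divr1; apply/esym/eqP; rewrite pnatr_eq0.
  by apply/eqP/truncn0Pn; rewrite -ltNge.
rewrite big_ord_recr/= ih.
have -> : Num.truncn (2 ^+ n * x) = (Num.truncn ((2:R) ^+ n.+1 * x) %/ 2)%N.
  rewrite -truncn_div// ?mulr_ge0 ?exprn_ge0//; congr Num.truncn.
  by rewrite exprS; field.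
rewrite /dig; set m := Num.truncn _.
have mE : m%:R = (m %/ 2)%:R * 2 + (odd m)%:R :> R.
  by rewrite -natrM -natrD -modn2 -divn_eq.
by rewrite mE exprS; field; rewrite expf_neq0.
Qed.

End digits.

Section coin_measure.
Context {R : realType}.

Lemma measurable_shift (c : R) :
  measurable_fun setT (fun x : measurableTypeR R => x + c : measurableTypeR R).
Proof. by apply: measurable_funD => //; exact: measurable_cst. Qed.

Lemma lebesgue_measure_shift (c : R) (A : set R) : measurable A ->
  lebesgue_measure ((fun x => x + c) @^-1` A) = lebesgue_measure A.
Proof.
move=> mA; rewrite -(image_measureE lebesgue_measure (measurable_shift c)).
apply/esym/lebesgue_measure_unique => //= _ [[a b]] _ <-.
rewrite /pushforward (_ : _ @^-1` _ = `]a - c, b - c]%classic).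
  by rewrite !lebesgue_measure_itv/= !lte_fin ltrD2r; case: ifP => // _; rewrite -!EFinB; congr EFin; ring.
by apply/seteqP; split => x /=; rewrite !in_itv/= ltrBlDr lerBrDr.
Qed.

Definition digits (I : countType) (x : measurableTypeR R) : coinT I :=
  fun i => dig (pickle i) x.

Arguments digits : clear implicits.

Lemma measurable_digits I : measurable_fun setT (digits I).
Proof. by apply: measurable_to_coin => i; exact: measurable_dig. Qed.

Definition coin_measure (I : countType) : probability (coinT I) R :=
  law unif (@measurable_digits I).

Lemma digits_flip (I : countType) (s : seq (I * bool)) (i : I) (x : R) :
  i \notin unzip1 s -> 0 <= x -> ~~ dig (pickle i) x ->
  cyl s (digits I (x + (2 ^+ (pickle i).+1)^-1)) <-> cyl s (digits I x).
Proof.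
move=> is_ x0 nx; rewrite /cyl/=; suff -> : forall t, {subset t <= s} ->
  all (fun q => digits I (x + (2 ^+ (pickle i).+1)^-1) q.1 == q.2) t =
  all (fun q => digits I x q.1 == q.2) t by [].
move=> t ts; apply: eq_in_all => -[j b] /ts js /=; congr (_ == _).
rewrite /digits; have [jp|jp|jp] := ltngtP (pickle j) (pickle i).
- exact: dig_shift_lt.
- exact: dig_shift_gt.
- exfalso; move/negP: is_; apply; rewrite -(pcan_inj pickleK jp).
  by apply/mapP; exists (j, b).
Qed.

(** Translation by 2^-(p+1) carries the points with digit p equal to 0 onto those with digit p equal
    to 1 and leaves the other digits alone. Lebesgue measure is translation invariant, so each half
    gets half of the cylinder. *)
Lemma coin_measure_fair (I : countType) : fair (coin_measure I).
Proof.
move=> s i b is_; set p := pickle i; set c : R := (2 ^+ p.+1)^-1.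
have c0 : 0 < c by rewrite invr_gt0 exprn_gt0.
pose E b' := digits I @^-1` cyl ((i, b') :: s) `&` `[0%R, 1%R[%classic.
have mdig t : measurable (digits I @^-1` cyl t : set (measurableTypeR R)).
  by rewrite -[X in measurable X]setTI; apply: measurable_digits => //; exact: measurable_cyl.
have mE b' : measurable (E b') by exact: measurableI.
have EE b' x : E b' x <-> [/\ dig p x = b', cyl s (digits I x) & 0 <= x < 1].
  rewrite /E /cyl /setI /= in_itv/= -[digits I x i]/(dig p x); split; last by move=> [-> -> ->]; rewrite eqxx.
  by move=> [/andP[/eqP]].
have flip : E false = (fun x => x + c) @^-1` E true.
  apply/seteqP; split => x /=.
    move=> /EE[px sx /andP[x0 x1]]; apply/EE; split.
    - by rewrite dig_shift_eq// px.
    - by apply/(digits_flip is_) => //; rewrite px.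
    (* The translate stays below 1: the integer formed by the first p + 1 digits is even and less
       than 2^(p+1), hence at most 2^(p+1) - 2. *)
    - rewrite addr_ge0 ?(ltW c0)//=.
      have x2 : 0 <= 2 ^+ p.+1 * x by rewrite mulr_ge0// exprn_ge0.
      have /andP[_ h] := truncn_itv x2.
      have h2 : (Num.truncn (2 ^+ p.+1 * x) < 2 ^ p.+1)%N.
        by rewrite truncn_lt_nat// natrX gtr_pMr ?exprn_gt0// ltr0n.
      have h3 : (Num.truncn (2 ^+ p.+1 * x) != (2 ^ p.+1).-1)%N.
        apply/eqP => e; move: px; rewrite /dig e => /negbT.
        by rewrite -oddS prednK ?expn_gt0// oddX.
      have h4 : ((Num.truncn (2 ^+ p.+1 * x)).+1 < 2 ^ p.+1)%N by lia.
      have h5 : (Num.truncn (2 ^+ p.+1 * x)).+2%:R <= (2 ^+ p.+1 : R).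
        by move: h4; rewrite -(ler_nat R) natrX.
      rewrite -(ltr_pM2l (exprn_gt0 p.+1 (ltr0Sn R 1))) mulrDr mulfV ?expf_neq0//.
      rewrite mulr1; apply: lt_le_trans h5.
      by rewrite -[X in _ < X%:R]addn1 natrD ltrD2r.
  move=> /EE[px sx /andP[x0 x1]].
  have cx : 0 <= x.
    have : (0 < Num.truncn (2 ^+ p.+1 * (x + c)))%N.
      by rewrite lt0n; apply/eqP => e; move: px; rewrite /dig e.
    by rewrite truncn_gt0 mulrDr mulfV ?expf_neq0// lerDr pmulr_rge0 ?exprn_gt0.
  have npx : ~~ dig p x by rewrite -dig_shift_eq// px.
  apply/EE; split; first exact/negbTE.
  - exact/(digits_flip is_ cx npx).
  - by rewrite cx/= (le_lt_trans _ x1)// lerDl ltW.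
have Efl : lebesgue_measure (E false) = lebesgue_measure (E true).
  by rewrite flip; apply: lebesgue_measure_shift; exact: mE.
have cE t : coin_measure I (cyl t) = lebesgue_measure (digits I @^-1` cyl t `&` `[0%R, 1%R[%classic).
  by [].
have sumE : coin_measure I (cyl s) = (lebesgue_measure (E false) + lebesgue_measure (E true))%E.
  rewrite -measureU//.
    rewrite cE; congr (lebesgue_measure _); apply/seteqP; split => x.
      rewrite /setI /= in_itv/= => -[sx x01].
      by case e : (dig p x); [right|left]; apply/EE.
    by move=> [|] /EE[_ sx x01]; split => //=; rewrite in_itv.
  by rewrite -subset0 => x [/EE[px _ _] /EE[]]; rewrite px.
have fE b' : lebesgue_measure (E b') \is a fin_num.
  by have := fin_num_measure (coin_measure I) (cyl ((i, b') :: s)) (measurable_cyl _).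
rewrite sumE cE -/(E b) -(fineK (fE false)) -(fineK (fE true)).
have -> : lebesgue_measure (E b) = (fine (lebesgue_measure (E true)))%:E.
  by case: b; rewrite ?fineK// Efl.
by rewrite Efl -EFinD -EFinM; congr EFin; field.
Qed.

End coin_measure.
Arguments digits {R} I x.
Arguments coin_measure {R} I.

(** * Sampling a law on the line from fair coins *)

Section from_coins.
Context {R : realType}.
Local Open Scope ereal_scope.

Lemma measurable_reindex (I J : eqType) (tau : J -> I) :
  measurable_fun setT (fun u : coinT I => (u \o tau) : coinT J).
Proof. by apply: measurable_to_coin => j; exact: measurable_coin. Qed.

(** Injectivity keeps a fresh constraint fresh. *)
Lemma fair_reindex (I J : eqType) (tau : J -> I) (mu : probability (coinT I) R) :
  injective tau -> fair mu -> fair (law mu (measurable_reindex tau)).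
Proof.
move=> tauI fmu s j b js.
have E t : (fun u : I -> bool => u \o tau) @^-1` cyl t =
    cyl [seq (tau p.1, p.2) | p <- t].
  by apply/seteqP; split => u; rewrite /cyl/= all_map.
have L t : law mu (measurable_reindex tau) (cyl t) =
    mu (cyl [seq (tau p.1, p.2) | p <- t]) by rewrite -E.
rewrite 2!L /= fmu// /unzip1 -map_comp (_ : _ \o _ = tau \o fst)//.
by rewrite map_comp mem_map.
Qed.

Definition binexp (u : coinT nat) : R :=
  fine (\sum_(0 <= k <oo) ((u k)%:R / 2 ^+ k.+1)%:E).

Lemma measurable_binexp : measurable_fun setT (binexp : coinT nat -> R).
Proof.
apply: measurableT_comp => //; apply: ge0_emeasurable_sum => // k _.
apply/measurable_EFinP; apply: measurable_funM => //.
have : measurable_fun setT ((fun b : bool => b%:R : R) \o (fun u : coinT nat => u k)).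
  apply: measurableT_comp => //; exact: measurable_coin.
exact.
Qed.

Lemma binexp_digits (x : R) : (0 <= x < 1)%R -> binexp (digits nat x) = x.
Proof.
move=> x01; rewrite /binexp.
suff -> : \sum_(0 <= k <oo) ((digits nat x k)%:R / 2 ^+ k.+1)%:E = x%:E by [].
apply/cvg_lim => //.
rewrite (_ : (fun n => _) = EFin \o (fun n => (Num.truncn (2 ^+ n * x))%:R / 2 ^+ n)%R).
  apply: cvg_EFin; first exact: nearW.
  have [x0 x1] := andP x01.
  apply: (@squeeze_cvgr _ _ _ _ (fun n => x - (2 ^+ n)^-1)%R (cst x)).
  - apply: nearW => n /=.
    have /andP[h1 h2] : ((Num.truncn (2 ^+ n * x))%:R <= 2 ^+ n * x < (Num.truncn (2 ^+ n * x)).+1%:R)%R.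
      by apply: truncn_itv; rewrite mulr_ge0 ?exprn_ge0.
    rewrite ler_pdivrMr ?exprn_gt0// [(x * _)%R]mulrC h1 andbT.
    rewrite ler_pdivlMr ?exprn_gt0// mulrBl mulVf ?expf_neq0// lerBlDr mulrC.
    by rewrite natr1 ltW.
  - rewrite -[X in _ --> X]subr0; apply: cvgB; first exact: cvg_cst.
    under eq_fun do rewrite -exprVn.
    by apply: cvg_expr; rewrite gtr0_norm ?invf_lt1 ?ltr1n.
  - exact: cvg_cst.
apply/funext => n /=; rewrite -dig_sum// big_mkord -sumEFin.
by apply: eq_bigr.
Qed.

(** The sampler reads the coins as a binary expansion and applies the quantile function. As the fair
    law is unique, it may be tested on the digits of a uniform number, which the expansion gives
    back. *)
Lemma coins_to_probability (nu : probability (measurableTypeR R) R) :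
  exists2 q : coinT nat -> measurableTypeR R, measurable_fun setT q &
    forall mu : probability (coinT nat) R, fair mu ->
      forall A, measurable A -> mu (q @^-1` A) = nu A.
Proof.
have [Q mQ QE] := quantile nu.
have mq : measurable_fun setT (Q \o binexp : coinT nat -> measurableTypeR R).
  by apply: measurableT_comp => //; exact: measurable_binexp.
exists (Q \o binexp) => // mu fmu A mA.
have mB : measurable ((Q \o binexp) @^-1` A).
  by rewrite -[X in measurable X]setTI; exact: mq.
rewrite (fair_unique fmu (@coin_measure_fair R nat) mB) -QE//.
change (unif (digits nat @^-1` ((Q \o binexp) @^-1` A)) = unif (Q @^-1` A)).
rewrite !unifE; congr (lebesgue_measure _).
apply/seteqP; split => x /=; rewrite in_itv/= => -[] + x01;
  by rewrite binexp_digits.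
Qed.

End from_coins.

(** * Gaussian laws on the plane *)

Section plane.
Context {R : realType}.
Local Open Scope ereal_scope.
Local Notation RR := (measurableTypeR R).
Local Notation leb := (@lebesgue_measure R).
Local Notation leb2 := (leb \x leb).

Definition vshear (t : R) (z : RR * RR) : RR * RR := (z.1, (z.2 + t * z.1)%R).

Lemma measurable_vshear t : measurable_fun setT (vshear t).
Proof.
apply: measurable_fun_pair; first exact: measurable_fst.
apply: measurable_funD; first exact: measurable_snd.
by apply: measurable_funM.
Qed.

(** On each vertical line a shear is a translation. *)
Lemma leb2_vshear t (E : set (RR * RR)) : measurable E ->
  leb2 (vshear t @^-1` E) = leb2 E.
Proof.
move=> mE; rewrite -(image_measureE _ (measurable_vshear t)).
apply/esym/product_measure_unique => // A B mA mB.
rewrite image_measureE /= /product_measure1.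
transitivity (\int[leb]_x ((\1_A x)%:E * leb B)).
  apply: eq_integral => x _; rewrite /= indicE; have [xA|xA] := boolP (x \in A).
    rewrite mul1e -(@lebesgue_measure_shift _ (t * x)%R B mB); congr (leb _).
    apply/seteqP; split => y; rewrite /xsection /vshear/= inE/=.
      by case.
    by move=> ?; split => //; rewrite inE in xA.
  rewrite mul0e (_ : xsection _ _ = set0) ?measure0//.
  rewrite -subset0 => y; rewrite /xsection/= inE => -[/= + _].
  by move: xA; rewrite notin_setE.
rewrite ge0_integralZr//.
  by rewrite integral_indic// setIT.
exact/measurable_EFinP/measurable_indic.
Qed.

Definition swap (z : RR * RR) : RR * RR := (z.2, z.1).

Lemma measurable_swap : measurable_fun setT swap.
Proof.
by apply: measurable_fun_pair; [exact: measurable_snd|exact: measurable_fst].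
Qed.

Lemma leb2_swap (E : set (RR * RR)) : measurable E ->
  leb2 (swap @^-1` E) = leb2 E.
Proof.
move=> mE; rewrite -(image_measureE leb2 measurable_swap).
apply/esym/product_measure_unique => // A B mA mB.
rewrite image_measureE (_ : _ @^-1` _ = B `*` A).
  by rewrite muleC; exact: product_measure1E.
by apply/seteqP; split => -[x y] [].
Qed.

Definition rot (c s : R) (z : RR * RR) : RR * RR :=
  ((c * z.1 - s * z.2)%R, (s * z.1 + c * z.2)%R).

Lemma measurable_rot c s : measurable_fun setT (rot c s).
Proof.
have m1 (a : R) : measurable_fun setT (fun z : RR * RR => (a * z.1)%R : RR).
  by apply: measurable_funM.
have m2 (a : R) : measurable_fun setT (fun z : RR * RR => (a * z.2)%R : RR).
  by apply: measurable_funM.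
apply: measurable_fun_pair; first by apply: measurable_funB; [exact: m1|exact: m2].
by apply: measurable_funD; [exact: m1|exact: m2].
Qed.

(* A rotation is a product of three shears. *)
Lemma leb2_rot c s (E : set (RR * RR)) : (c ^+ 2 + s ^+ 2 = 1)%R -> (c != -1)%R ->
  measurable E -> leb2 (rot c s @^-1` E) = leb2 E.
Proof.
(* [t] is the tangent of half the angle, which the half turn c = -1 lacks; [h] below is the
   horizontal shear by [- t]. *)
move=> cs c1 mE; pose t := (s / (1 + c))%R.
have c1' : (1 + c != 0)%R by rewrite addrC addr_eq0.
pose h := swap \o vshear (- t) \o swap : RR * RR -> RR * RR.
have mh : measurable_fun setT h.
  apply: measurableT_comp; last exact: measurable_swap.
  by apply: measurableT_comp; [exact: measurable_swap|exact: measurable_vshear].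
have hE F : measurable F -> leb2 (h @^-1` F) = leb2 F.
  move=> mF; rewrite /h !comp_preimage leb2_swap; last first.
    by apply: measurable_preimage; [exact: measurable_vshear|apply: measurable_preimage => //; exact: measurable_swap].
  rewrite leb2_vshear ?leb2_swap//.
  by apply: measurable_preimage => //; exact: measurable_swap.
have -> : rot c s = h \o vshear s \o h.
  have s2 : (s ^+ 2 = (1 - c) * (1 + c))%R by move: cs; lra.
  have st : (s * t = 1 - c)%R by rewrite /t mulrA -expr2 s2 mulfK.
  have tc : (t * (1 + c) = s)%R by rewrite /t divfK.
  have e (x y : R) : (c * x - s * y = x + - t * y + - t * (y + s * (x + - t * y)))%R
      /\ (s * x + c * y = y + s * (x + - t * y))%R.
    have e1 : (x * (s * t - (1 - c)) = 0)%R by rewrite st subrr mulr0.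
    have e2 : (y * t * (s * t - (1 - c)) = 0)%R by rewrite st subrr mulr0.
    have e3 : (y * (t * (1 + c) - s) = 0)%R by rewrite tc subrr mulr0.
    have e4 : (y * (s * t - (1 - c)) = 0)%R by rewrite st subrr mulr0.
    by split; [move: e1 e2 e3|move: e4]; lra.
  by apply/funext => -[x y]; congr pair; have [] := e x y.
have mhE : measurable (h @^-1` E) by exact: measurable_preimage.
rewrite !comp_preimage hE ?leb2_vshear ?hE//.
by apply: measurable_preimage => //; exact: measurable_vshear.
Qed.

End plane.

Section gaussian.
Context {R : realType}.
Local Open Scope ereal_scope.
Local Notation RR := (measurableTypeR R).
Local Notation leb := (@lebesgue_measure R).
Local Notation leb2 := (leb \x leb).

Lemma ge0_integral_normal_prob (m s : R) (f : RR -> \bar R) :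
  measurable_fun setT f -> (forall x, 0 <= f x) ->
  \int[normal_prob m s]_x f x = \int[leb]_x (f x * (normal_pdf m s x)%:E).
Proof.
move=> mf f0; have dom := normal_prob_dominates m s.
rewrite -(Radon_Nikodym_SigmaFinite.change_of_variables dom)//.
have iRN := Radon_Nikodym_SigmaFinite.f_integrable dom.
have mRN := measurable_int _ iRN.
have mpdf : measurable_fun setT (fun x : RR => (normal_pdf m s x)%:E).
  by apply/measurable_EFinP; exact: measurable_normal_pdf.
apply: ae_eq_integral => //; try exact: emeasurable_funM.
apply: ae_eqe_mul2l; apply: integral_ae_eq => //.
by move=> A _ mA; rewrite -Radon_Nikodym_SigmaFinite.f_integral.
Qed.

Definition gam : probability RR R := normal_prob (0 : R) (1 : R).
Definition gam2 : probability (RR * RR)%type R := gam \x gam.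

Lemma normal_pdf01 (x : R) : normal_pdf 0 1 x = (normal_peak 1 * expR (- (x ^+ 2 / 2)))%R.
Proof.
by rewrite normal_pdfE ?oner_neq0// /normal_fun subr0 expr1n mulNr.
Qed.

Let mpdf : measurable_fun setT (fun x : RR => (normal_pdf (0 : R) 1 x)%:E).
Proof. by apply/measurable_EFinP; exact: measurable_normal_pdf. Qed.

Lemma gam2E (E : set (RR * RR)) : measurable E ->
  gam2 E = \int[leb2]_z ((\1_E z)%:E * (normal_pdf 0 1 z.1 * normal_pdf 0 1 z.2)%:E).
Proof.
move=> mE; have m1 : measurable_fun setT (fun z => (\1_E z)%:E : \bar R).
  exact/measurable_EFinP/measurable_indic.
have m2 : measurable_fun setT (fun z : RR * RR =>
    (\1_E z)%:E * (normal_pdf 0 1 z.1 * normal_pdf 0 1 z.2)%:E).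
  apply: emeasurable_funM => //; apply/measurable_EFinP/measurable_funM.
    by apply: (measurableT_comp (measurable_normal_pdf 0 1)); exact: measurable_fst.
  by apply: (measurableT_comp (measurable_normal_pdf 0 1)); exact: measurable_snd.
have mxs (x : R) : measurable_fun setT (fun y : RR => (\1_E (x, y))%:E : \bar R).
  by apply: (measurableT_comp m1); exact: pair1_measurable.
transitivity (\int[gam2]_z (\1_E z)%:E); first by rewrite integral_indic// setIT.
rewrite [RHS]fubini_tonelli1//; last first.
  by move=> z; rewrite mule_ge0// lee_fin mulr_ge0// normal_pdf_ge0.
rewrite /gam2 fubini_tonelli1//.
rewrite ge0_integral_normal_prob; last 2 first.
- exact: measurable_fun_fubini_tonelli_F.
- by move=> x; apply: integral_ge0.
apply: eq_integral => x _; rewrite /fubini_F/= ge0_integral_normal_prob//.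
rewrite -ge0_integralZr//; last 3 first.
- exact: emeasurable_funM.
- by move=> y _; rewrite mule_ge0// lee_fin// normal_pdf_ge0.
- by rewrite lee_fin normal_pdf_ge0.
by apply: eq_integral => y _; rewrite -muleA -EFinM (mulrC (normal_pdf _ _ y)).
Qed.

(** The density depends only on the distance to the origin, and rotations preserve Lebesgue
    measure. *)
Lemma gam2_rot c s (E : set (RR * RR)) : (c ^+ 2 + s ^+ 2 = 1)%R -> measurable E ->
  gam2 (rot c s @^-1` E) = gam2 E.
Proof.
have main c' s' (F : set (RR * RR)) : (c' ^+ 2 + s' ^+ 2 = 1)%R -> (c' != -1)%R ->
    measurable F -> gam2 (rot c' s' @^-1` F) = gam2 F.
  move=> cs c1 mF; have mr := @measurable_rot R c' s'.
  have mrF : measurable (rot c' s' @^-1` F) by exact: measurable_preimage.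
  pose f (z : RR * RR) := (\1_F z)%:E * (normal_pdf 0 1 z.1 * normal_pdf 0 1 z.2)%:E.
  have m2 : measurable_fun setT f.
    apply: emeasurable_funM; first exact/measurable_EFinP/measurable_indic.
    apply/measurable_EFinP/measurable_funM.
      by apply: (measurableT_comp (measurable_normal_pdf 0 1)); exact: measurable_fst.
    by apply: (measurableT_comp (measurable_normal_pdf 0 1)); exact: measurable_snd.
  have f0 z : 0 <= f z by rewrite mule_ge0// lee_fin mulr_ge0// normal_pdf_ge0.
  rewrite !gam2E//.
  transitivity (\int[leb2]_z (f \o rot c' s') z).
    apply: eq_integral => z _; rewrite /f/=; congr (_ * _%:E).
    rewrite !normal_pdf01 !mulrA ![(_ * normal_peak 1)%R]mulrC !mulrA -!mulrA -!expRD.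
    congr (_ * (_ * expR _))%R; case: z => x y; rewrite /rot/=.
    transitivity (- ((c' ^+ 2 + s' ^+ 2) * (x ^+ 2 + y ^+ 2) / 2) : R)%R; last by field.
    by rewrite cs; field.
  rewrite -(ge0_integral_image leb2 mr m2 f0).
  by apply: eq_measure_integral => A mA _; exact: leb2_rot.
move=> cs mE; have [c1|c1] := eqVneq c (-1)%R; last exact: main.
have s0 : s = 0%R.
  by apply/eqP; rewrite -sqrf_eq0; apply/eqP; move: cs; rewrite c1; lra.
(* The half turn, out of reach of the shears, is the square of a quarter turn. *)
have -> : rot c s = rot 0 1 \o rot 0 1.
  by apply/funext => -[x y]; rewrite /rot c1 s0/=; congr pair; ring.
have e01 : ((0 : R) ^+ 2 + 1 ^+ 2 = 1)%R by ring.
have n01 : (0 != -1 :> R)%R by rewrite eq_sym oppr_eq0 oner_neq0.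
rewrite comp_preimage !main//.
by apply: measurable_preimage => //; exact: measurable_rot.
Qed.

Lemma gam_sqr : \int[gam]_x (x ^+ 2)%:E < +oo.
Proof.
rewrite ge0_integral_normal_prob; last 2 first.
- by apply/measurable_EFinP; exact: measurable_funX.
- by move=> x; rewrite lee_fin sqr_ge0.
(* Comparison with the Gaussian density of variance 2: for y = x^2/4, the bound y exp(-y) <= 1 gives
   x^2 exp(-x^2/2) <= 4 exp(-x^2/4). *)
pose s := Num.sqrt 2 : R.
have s0 : (s != 0)%R by rewrite gt_eqF// sqrtr_gt0.
pose K := (4 * normal_peak 1 / normal_peak s)%R.
have K0 : (0 <= K)%R by rewrite !mulr_ge0 ?invr_ge0 ?normal_peak_ge0.
apply: (@le_lt_trans _ _ (\int[leb]_x (K%:E * (normal_pdf 0 s x)%:E))).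
  apply: ge0_le_integral => //.
  - by move=> x _; rewrite mule_ge0// lee_fin ?sqr_ge0// normal_pdf_ge0.
  - by apply: emeasurable_funM => //; apply/measurable_EFinP; exact: measurable_funX.
  - apply: measurable_funeM; apply/measurable_EFinP; exact: measurable_normal_pdf.
  move=> x _; rewrite -!EFinM lee_fin normal_pdf01 normal_pdfE//.
  rewrite (_ : K * _ = normal_peak 1 * (4 * normal_fun 0 s x))%R; last first.
    by rewrite /K; field; rewrite gt_eqF// normal_peak_gt0.
  rewrite mulrCA; apply: ler_wpM2l; first exact: normal_peak_ge0.
  rewrite /normal_fun subr0 /s sqr_sqrtr//.
  set y := (x ^+ 2 / 4)%R.
  have -> : (- x ^+ 2 / (2 *+ 2) = - y)%R by rewrite /y -mulr_natr; field.
  have -> : (- (x ^+ 2 / 2) = - y + - y)%R by rewrite /y; field.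
  have -> : (x ^+ 2 = 4 * y)%R by rewrite /y; field.
  rewrite expRD -mulrA ler_pM2l// mulrA ler_piMl ?expR_ge0//.
  rewrite expRN ler_pdivrMr ?expR_gt0// mul1r (le_trans _ (expR_ge1Dx y))//.
  by rewrite lerDr.
rewrite ge0_integralZl//; last 2 first.
- by apply/measurable_EFinP; exact: measurable_normal_pdf.
- by move=> x _; rewrite lee_fin normal_pdf_ge0.
by rewrite integral_normal_pdf mule1 ltry.
Qed.

Lemma gam_itv_gt0 (a b : R) : (a < b)%R -> 0 < gam `]a, b[%classic.
Proof.
move=> ab; pose M := (`|a| + `|b|)%R.
pose e := (normal_peak 1 * expR (- (M ^+ 2 / 2)) : R)%R.
have e0 : (0 < e)%R by rewrite mulr_gt0 ?expR_gt0// normal_peak_gt0// oner_neq0.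
apply: (@lt_le_trans _ _ (\int[leb]_(x in `]a, b[%classic) e%:E)).
  rewrite integral_cst//= lebesgue_measure_itv/= lte_fin ab -EFinB -EFinM lte_fin.
  by rewrite mulr_gt0// subr_gt0.
rewrite /gam /= /normal_prob; apply: ge0_le_integral => //.
- by move=> x _; rewrite lee_fin ltW.
- exact: measurable_funTS.
move=> x; rewrite /= in_itv/= => /andP[ax xb].
rewrite lee_fin normal_pdf01 ler_wpM2l ?normal_peak_ge0// ler_expR lerN2.
rewrite ler_pM2r ?invr_gt0// -[leLHS]real_normK ?num_real// lerXn2r ?nnegrE//.
  by rewrite addr_ge0.
rewrite ler_norml /M; have := ler_norm a; have := ler_norm b.
have := ler_norm (- a); have := ler_norm (- b); rewrite !normrN.
by move: (normr_ge0 a) (normr_ge0 b); lra.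
Qed.

End gaussian.

Section gaussian_sums.
Context {R : realType}.
Local Open Scope ereal_scope.
Local Notation RR := (measurableTypeR R).
Local Notation leb := (@lebesgue_measure R).
Local Notation gam := (@gam R).
Local Notation gam2 := (@gam2 R).

Lemma measurable_mul (s : R) : measurable_fun setT (fun x : RR => (s * x)%R : RR).
Proof. by apply: measurable_funM. Qed.

(** The same law as [gauss], but as an image under scaling it needs no separate case at s = 0. *)
Definition gaus (s : R) : probability RR R := law gam (measurable_mul s).

Lemma gausE s A : gaus s A = gam ((fun x => s * x)%R @^-1` A).
Proof. by []. Qed.

Lemma lebesgue_measure_scale (s : R) (A : set R) : (0 < s)%R -> measurable A ->
  leb ((fun x => s * x)%R @^-1` A) = (s^-1)%:E * leb A.
Proof.
move=> s0 mA.
pose m : {measure set RR -> \bar R} := mscale (NngNum (ltW s0)) (image_measure leb (measurable_mul s)).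
have mE X : m X = s%:E * leb ((fun x => s * x)%R @^-1` X) by [].
have -> : leb A = m A.
  apply: lebesgue_measure_unique => // _ [[a b]] _ <-.
  rewrite mE (_ : _ @^-1` _ = `](a / s)%R, (b / s)%R]%classic :> set R).
    rewrite !lebesgue_measure_itv/= !lte_fin ltr_pM2r ?invr_gt0//.
    case: ifP => _; last by rewrite mule0.
    by rewrite -!EFinB -EFinM; congr EFin; field; rewrite gt_eqF.
  by apply/seteqP; split => x /=; rewrite !in_itv/= ltr_pdivrMr// ler_pdivlMr// ![(x * s)%R]mulrC.
by rewrite mE muleA -EFinM mulVf ?gt_eqF// mul1e.
Qed.

Lemma gauss_gaus (s : R) (A : set R) : (0 <= s)%R -> measurable A ->
  gauss s A = gaus s A.
Proof.
rewrite le_eqVlt => /orP[/eqP <- mA|s0 mA].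
  rewrite /gauss eqxx gausE /dirac/= indicE; have [xA|xA] := boolP (0%R \in A).
    rewrite (_ : _ @^-1` _ = setT) ?probability_setT//.
    by apply/seteqP; split => // x _; rewrite /= mul0r; rewrite inE in xA.
  rewrite (_ : _ @^-1` _ = set0) ?measure0//.
  by rewrite -subset0 => x; rewrite /= mul0r; move: xA; rewrite notin_setE.
have sn0 : (s != 0)%R by rewrite gt_eqF.
rewrite /gauss (negbTE sn0) gausE /normal_prob /=.
have mpdf t : measurable_fun setT (fun x : RR => (normal_pdf (0 : R) t x)%:E).
  by apply/measurable_EFinP; exact: measurable_normal_pdf.
have mi (B : set R) : measurable B -> measurable_fun setT (fun x : RR => (\1_B x)%:E : \bar R).
  by move=> mB; exact/measurable_EFinP/measurable_indic.
have mA' : measurable ((fun x : RR => s * x)%R @^-1` A).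
  by apply: measurable_preimage => //; exact: measurable_mul.
have setE (B : set R) t : measurable B -> \int[leb]_(x in B) (normal_pdf 0 t x)%:E =
    \int[leb]_x ((\1_B x)%:E * (normal_pdf 0 t x)%:E).
  move=> mB; rewrite integral_mkcond; apply: eq_integral => x _.
  by rewrite patchE indicE; case: (x \in B); rewrite ?mul1e ?mul0e.
rewrite /normal_prob !setE//.
pose g (y : RR) := (\1_A y)%:E * (normal_pdf 0 1 (s^-1 * y)%R)%:E.
have mg : measurable_fun setT g.
  apply: emeasurable_funM; first exact: mi.
  by apply: (measurableT_comp (mpdf 1%R)); exact: measurable_mul.
have g0 y : 0 <= g y by rewrite mule_ge0// lee_fin// normal_pdf_ge0.
transitivity (\int[leb]_x g (s * x)%R); last first.
  by apply: eq_integral => x _; rewrite /g mulKf.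
rewrite -(ge0_integral_image leb (measurable_mul s) mg g0).
have sV0 : (0 <= s^-1)%R by rewrite invr_ge0 ltW.
transitivity (\int[mscale (NngNum sV0) leb]_x g x); last first.
  apply: eq_measure_integral => B mB _.
  by apply/esym/lebesgue_measure_scale.
rewrite ge0_integral_mscale// -ge0_integralZl//=.
apply: eq_integral => x _; rewrite /g muleCA; congr (_ * _); rewrite -EFinM; congr EFin.
rewrite normal_pdf01 normal_pdfE// mulrA; congr (_ * expR _)%R; last first.
  by rewrite subr0 -mulr_natr; field.
rewrite /normal_peak expr1n mul1r -mulrnAr sqrtrM ?sqr_ge0// sqrtr_sqr gtr0_norm//.
by rewrite invfM.
Qed.

Lemma gam2_rect (A B : set RR) : measurable A -> measurable B ->
  gam2 (A `*` B) = gam A * gam B.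
Proof. exact: product_measure1E. Qed.

(** A rotation turns the direction (s, t) into the first axis. *)
Lemma gam_lincomb (s t : R) (A : set RR) : measurable A ->
  gam2 [set z | A (s * z.1 + t * z.2)%R] = gaus (Num.sqrt (s ^+ 2 + t ^+ 2)) A.
Proof.
move=> mA; set r := Num.sqrt _; have r0 : (0 <= r)%R by exact: sqrtr_ge0.
have st0 : (0 <= s ^+ 2 + t ^+ 2)%R by rewrite addr_ge0 ?sqr_ge0.
have r2 : (r ^+ 2 = s ^+ 2 + t ^+ 2)%R by rewrite sqr_sqrtr.
have mrA : measurable ((fun x => r * x)%R @^-1` A : set RR).
  by apply: measurable_preimage => //; exact: measurable_mul.
have fstE : gam2 [set z | A (r * z.1)%R] = gaus r A.
  rewrite (_ : [set _ | _] = ((fun x => r * x)%R @^-1` A) `*` setT).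
    by rewrite gam2_rect// probability_setT mule1.
  by apply/seteqP; split => // z [].
have [r00|rn0] := eqVneq r 0%R.
  have [-> ->] : s = 0%R /\ t = 0%R.
    move/eqP: r2; rewrite r00 expr0n/= eq_sym paddr_eq0 ?sqr_ge0// !sqrf_eq0.
    by move=> /andP[/eqP -> /eqP ->].
  by rewrite -fstE r00; congr (gam2 _); apply/seteqP; split => z /=; rewrite !mul0r addr0.
rewrite -fstE -(@gam2_rot _ (s / r) (- t / r) [set z | A (r * z.1)%R]).
- have e (x y : R) : (r * (s / r * x - - t / r * y) = s * x + t * y)%R by field.
  by congr (gam2 _); apply/seteqP; split => z; rewrite /preimage/rot/= e.
- by rewrite !exprMn sqrrN -mulrDl exprVn -r2 mulfV// expf_neq0.
- apply: (measurable_preimage (f := fun z : RR * RR => (r * z.1)%R : RR)) => //.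
  by apply: (measurableT_comp (measurable_mul r)); exact: measurable_fst.
Qed.

End gaussian_sums.

Section gaussian_add.
Context {R : realType}.
Local Open Scope ereal_scope.
Local Notation RR := (measurableTypeR R).
Local Notation gam := (@gam R).
Local Notation gam2 := (@gam2 R).

Definition gaus2 (s : R) : probability (RR * RR)%type R := gaus s \x gaus s.

(** The linear part is multiplication by the complex number a - ib, that is, a rotation followed by
    scaling by the modulus; after the rotation the two constraints concern different coordinates. *)
Lemma gam2_complex_mul (a b x y : R) (A B : set RR) : measurable A -> measurable B ->
  gam2 [set z | A (x + (a * z.1 + b * z.2))%R /\ B (y + (a * z.2 - b * z.1))%R] =
  gam [set u | A (x + Num.sqrt (a ^+ 2 + b ^+ 2) * u)%R] *
  gam [set v | B (y + Num.sqrt (a ^+ 2 + b ^+ 2) * v)%R].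
Proof.
move=> mA mB; set t := Num.sqrt _.
have ab0 : (0 <= a ^+ 2 + b ^+ 2)%R by rewrite addr_ge0 ?sqr_ge0.
have t2 : (t ^+ 2 = a ^+ 2 + b ^+ 2)%R by rewrite sqr_sqrtr.
have mt (C : set RR) (w : R) : measurable C -> measurable ([set u | C (w + t * u)%R] : set RR).
  move=> mC; apply: (measurable_preimage (f := fun u : RR => (w + t * u)%R : RR)) => //.
  by apply: measurable_funD => //; exact: measurable_mul.
rewrite -gam2_rect; [|exact: mt|exact: mt].
have [t0|tn0] := eqVneq t 0%R.
  have [-> ->] : a = 0%R /\ b = 0%R.
    move/eqP: t2; rewrite t0 expr0n/= eq_sym paddr_eq0 ?sqr_ge0// !sqrf_eq0.
    by move=> /andP[/eqP -> /eqP ->].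
  by congr (gam2 _); apply/seteqP; split => z /=; rewrite t0 !mul0r subr0 !addr0.
rewrite -[RHS](@gam2_rot _ (a / t) (- b / t)); last 2 first.
- by rewrite !exprMn sqrrN -mulrDl exprVn -t2 mulfV// expf_neq0.
- by apply: measurableX; exact: mt.
congr (gam2 _); rewrite /rot/=.
have e1 (u v : R) : (t * (a / t * u - - b / t * v) = a * u + b * v)%R by field.
have e2 (u v : R) : (t * (- b / t * u + a / t * v) = a * v - b * u)%R by field.
by apply/seteqP; split => z /=; rewrite e1 e2.
Qed.

(** Adding (a - ib)(U + iV), with (U, V) independent of (X, Y), preserves the form of the joint law
    and adds the variances. This is the induction step for finite complex Gaussian sums. *)
Lemma gaussian_add d (T : measurableType d) (P : probability T R)
    (X Y U V : T -> RR) (s a b : R) :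
  measurable_fun setT X -> measurable_fun setT Y ->
  measurable_fun setT U -> measurable_fun setT V ->
  (forall A B, measurable A -> measurable B ->
    P [set w | A (X w) /\ B (Y w)] = gaus s A * gaus s B) ->
  (forall E F, measurable E -> measurable F ->
    P [set w | E (X w, Y w) /\ F (U w, V w)] =
    P [set w | E (X w, Y w)] * gam2 F) ->
  forall A B, measurable A -> measurable B ->
    P [set w | A (X w + (a * U w + b * V w))%R /\ B (Y w + (a * V w - b * U w))%R] =
    gaus (Num.sqrt (s ^+ 2 + (a ^+ 2 + b ^+ 2))) A *
    gaus (Num.sqrt (s ^+ 2 + (a ^+ 2 + b ^+ 2))) B.
Proof.
move=> mX mY mU mV hXY hind A B mA mB.
pose Z w : (RR * RR) * (RR * RR) := ((X w, Y w), (U w, V w)).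
have mXY : measurable_fun setT (fun w => (X w, Y w)) by exact: measurable_fun_pair.
have mZ : measurable_fun setT Z.
  by apply: measurable_fun_pair => //; exact: measurable_fun_pair.
have XYE (E : set (RR * RR)) : measurable E -> P [set w | E (X w, Y w)] = gaus2 s E.
  move=> mE; symmetry.
  apply: (@product_measure_unique _ _ _ _ _ (gaus s) (gaus s) (law P mXY)) => //.
have ZE W : measurable W -> law P mZ W = (gaus2 s \x gam2) W.
  move=> mW; symmetry.
  apply: (@product_measure_unique _ _ _ _ _ (gaus2 s) gam2 (law P mZ)) => // E F mE mF.
  by have := hind E F mE mF; rewrite XYE.
pose W := [set p : (RR * RR) * (RR * RR) |
  A (p.1.1 + (a * p.2.1 + b * p.2.2))%R /\ B (p.1.2 + (a * p.2.2 - b * p.2.1))%R].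
have m11 : measurable_fun setT (fun p : (RR * RR) * (RR * RR) => p.1.1).
  exact: (measurableT_comp measurable_fst measurable_fst).
have m12 : measurable_fun setT (fun p : (RR * RR) * (RR * RR) => p.1.2).
  exact: (measurableT_comp measurable_snd measurable_fst).
have m21 : measurable_fun setT (fun p : (RR * RR) * (RR * RR) => p.2.1).
  exact: (measurableT_comp measurable_fst measurable_snd).
have m22 : measurable_fun setT (fun p : (RR * RR) * (RR * RR) => p.2.2).
  exact: (measurableT_comp measurable_snd measurable_snd).
have mW : measurable W.
  apply: (@measurableI _ _ [set p : (RR * RR) * (RR * RR) | A (p.1.1 + (a * p.2.1 + b * p.2.2))%R]
    [set p : (RR * RR) * (RR * RR) | B (p.1.2 + (a * p.2.2 - b * p.2.1))%R]).
    apply: (measurable_preimage (f := fun p : (RR * RR) * (RR * RR) =>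
      (p.1.1 + (a * p.2.1 + b * p.2.2))%R : RR)) => //.
    by apply: measurable_funD => //; apply: measurable_funD;
      [exact: (measurableT_comp (measurable_mul a))|exact: (measurableT_comp (measurable_mul b))].
  apply: (measurable_preimage (f := fun p : (RR * RR) * (RR * RR) =>
      (p.1.2 + (a * p.2.2 - b * p.2.1))%R : RR)) => //.
  by apply: measurable_funD => //; apply: measurable_funB;
    [exact: (measurableT_comp (measurable_mul a))|exact: (measurableT_comp (measurable_mul b))].
transitivity ((gaus2 s \x gam2) W); first by rewrite -ZE.
set t := Num.sqrt (a ^+ 2 + b ^+ 2); set r := Num.sqrt (s ^+ 2 + _).
have t2 : (t ^+ 2 = a ^+ 2 + b ^+ 2)%R by rewrite sqr_sqrtr// addr_ge0 ?sqr_ge0.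
(* Given X = x, this is the probability that the first coordinate lands in [C]. By
   [gam2_complex_mul] the conditional probability of the whole event is a product of two such
   factors, so Fubini splits the integral. *)
pose k (C : set RR) (x : RR) := gam [set u | C (x + t * u)%R].
have mk2 (C : set RR) : measurable C -> measurable [set z : RR * RR | C (z.1 + t * z.2)%R].
  move=> mC; apply: (measurable_preimage (f := fun z : RR * RR => (z.1 + t * z.2)%R : RR)) => //.
  by apply: measurable_funD; [exact: measurable_fst|
    exact: (measurableT_comp (measurable_mul t) measurable_snd)].
have kx (C : set RR) x : k C x = gam (xsection [set z : RR * RR | C (z.1 + t * z.2)%R] x).
  by congr (gam _); apply/seteqP; split => u; rewrite /xsection/= inE.
have mk (C : set RR) : measurable C -> measurable_fun setT (k C).
  move=> mC; rewrite (_ : k C = gam \o xsection [set z : RR * RR | C (z.1 + t * z.2)%R]).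
    by apply: measurable_fun_xsection; exact: mk2.
  by apply/funext => x; exact: kx.
have k0 C x : 0 <= k C x by [].
have kI (C : set RR) : measurable C -> \int[gaus s]_x k C x = gaus r C.
  move=> mC; rewrite ge0_integral_law//; last exact: mk.
  transitivity (gam2 [set z : RR * RR | C (s * z.1 + t * z.2)%R]); last first.
    by rewrite gam_lincomb// t2.
  transitivity (\int[gam]_x gam (xsection [set z : RR * RR | C (s * z.1 + t * z.2)%R] x)); last by [].
  apply: eq_integral => x _; congr (gam _); by apply/seteqP; split => u; rewrite /xsection/= inE.
transitivity (\int[gaus2 s]_z (k A z.1 * k B z.2)).
  transitivity (\int[gaus2 s]_z gam2 (xsection W z)); first by [].
  apply: eq_integral => -[x y] _.
  transitivity (gam2 [set z | A (x + (a * z.1 + b * z.2))%R /\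
    B (y + (a * z.2 - b * z.1))%R]); last exact: gam2_complex_mul.
  congr (gam2 _).
  by apply/seteqP; split => u; rewrite /xsection/= inE.
rewrite fubini_tonelli1//; last 2 first.
- by apply: emeasurable_funM; [exact: (measurableT_comp (mk A mA) measurable_fst)|
    exact: (measurableT_comp (mk B mB) measurable_snd)].
- by move=> z; rewrite mule_ge0.
rewrite -!kI// -ge0_integralZr//; last 2 first.
- exact: mk.
- by apply: integral_ge0.
apply: eq_integral => x _; rewrite /fubini_F/= ge0_integralZl//.
exact: mk.
Qed.

End gaussian_add.

(** * An independent Gaussian family and its shift *)

Section gaussian_family.
Context {R : realType}.
Local Open Scope ereal_scope.
Local Notation RR := (measurableTypeR R).
Local Notation gam := (@gam R).
Local Notation gam2 := (@gam2 R).
Local Notation I := (nat * bool * nat)%type.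
Local Notation Om := (coinT I).

Definition Pr : probability Om R := coin_measure I.

Lemma Pr_fair : fair Pr. Proof. exact: coin_measure_fair. Qed.

Definition gcoin : coinT nat -> RR := s2val (cid2 (coins_to_probability gam)).

Lemma measurable_gcoin : measurable_fun setT gcoin.
Proof. exact: (s2valP (cid2 (coins_to_probability gam))). Qed.

Lemma gcoinE (mu : probability (coinT nat) R) A : fair mu -> measurable A ->
  mu (gcoin @^-1` A) = gam A.
Proof. by move=> fmu; exact: (s2valP' (cid2 (coins_to_probability gam)) mu fmu). Qed.

(** The real ([c = false]) or imaginary ([c = true]) part of G_(p+1); coordinate (p, c, k) is the
    k-th coin spent on it. The variables start at index 1 and [p] at 0. *)
Definition xi (p : nat) (c : bool) (w : Om) : RR := gcoin (fun k => w (p, c, k)).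

Lemma measurable_xi p c : measurable_fun setT (xi p c).
Proof.
apply: (measurableT_comp measurable_gcoin).
exact: (measurable_reindex (fun k => (p, c, k) : I)).
Qed.

Lemma xi_law p c A : measurable A -> Pr (xi p c @^-1` A) = gam A.
Proof.
pose tau k : I := (p, c, k); have tauI : injective tau by move=> k l [].
exact: (gcoinE (fair_reindex tauI Pr_fair)).
Qed.

Lemma xi_dep p c (u v : Om) : (forall k, u (p, c, k) = v (p, c, k)) ->
  xi p c u = xi p c v.
Proof. by move=> uv; congr gcoin; apply/funext => k. Qed.

Lemma xi_pair_law p (F : set (RR * RR)) : measurable F ->
  Pr [set w | F (xi p false w, xi p true w)] = gam2 F.
Proof.
have mp : measurable_fun setT (fun w => (xi p false w, xi p true w)).
  by apply: measurable_fun_pair; exact: measurable_xi.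
move=> mF; symmetry.
apply: (@product_measure_unique _ _ _ _ _ gam gam (law Pr mp)) => // A B mA mB.
transitivity (Pr (xi p false @^-1` A `&` xi p true @^-1` B)); first by [].
rewrite (fair_indep Pr_fair (D := [pred i : I | ~~ i.1.2])) ?xi_law//.
- by apply: measurable_preimage => //; exact: measurable_xi.
- by apply: measurable_preimage => //; exact: measurable_xi.
- move=> u v uv /=; rewrite (@xi_dep _ _ u v)// => k; exact: uv.
- move=> u v uv /=; rewrite (@xi_dep _ _ u v)// => k; exact: uv.
Qed.

Section sums.
Variables (a b : nat -> R).

(** With [isum], the real and imaginary parts of the sum of (a_i - i b_i) G_(i+1). The sign of b
    suits inner products, which conjugate their second argument. *)
Definition rsum N (w : Om) : RR :=
  (\sum_(i < N) (a i * xi i false w + b i * xi i true w))%R.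
Definition isum N (w : Om) : RR :=
  (\sum_(i < N) (a i * xi i true w - b i * xi i false w))%R.
Definition vsum N : R := (\sum_(i < N) (a i ^+ 2 + b i ^+ 2))%R.

Lemma vsum_ge0 N : (0 <= vsum N)%R.
Proof. by apply: sumr_ge0 => i _; rewrite addr_ge0 ?sqr_ge0. Qed.

Lemma measurable_rsum N : measurable_fun setT (rsum N).
Proof.
apply: measurable_sum => i; apply: measurable_funD;
  exact: (measurableT_comp (measurable_mul _) (measurable_xi _ _)).
Qed.

Lemma measurable_isum N : measurable_fun setT (isum N).
Proof.
apply: measurable_sum => i; apply: measurable_funB;
  exact: (measurableT_comp (measurable_mul _) (measurable_xi _ _)).
Qed.

Lemma sum_law N A B : measurable A -> measurable B ->
  Pr [set w | A (rsum N w) /\ B (isum N w)] =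
  gaus (Num.sqrt (vsum N)) A * gaus (Num.sqrt (vsum N)) B.
Proof.
elim: N A B => [|N ih] A B mA mB.
  have g0 (C : set RR) : gaus 0 C = (\1_C 0%R)%:E.
    rewrite gausE indicE; have [C0|C0] := boolP (0%R \in C).
      rewrite (_ : _ @^-1` _ = setT) ?probability_setT//.
      by apply/seteqP; split => // x _; rewrite /= mul0r; rewrite inE in C0.
    rewrite (_ : _ @^-1` _ = set0) ?measure0//.
    by rewrite -subset0 => x; rewrite /= mul0r; move: C0; rewrite notin_setE.
  rewrite /vsum big_ord0 sqrtr0 !g0 -EFinM !indicE.
  have -> : [set w | A (rsum 0 w) /\ B (isum 0 w)] = [set _ | A 0%R /\ B 0%R].
    by apply/seteqP; split => w /=; rewrite /rsum /isum !big_ord0.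
  have [A0|A0] := boolP (0%R \in A); have [B0|B0] := boolP (0%R \in B).
  - rewrite (_ : [set _ | _] = setT) ?probability_setT ?mul1r//.
    by apply/seteqP; split => // w _ /=; rewrite !inE in A0 B0.
  - rewrite mulr0 (_ : [set _ | _] = set0) ?measure0//.
    by rewrite -subset0 => w [_ B0']; move: B0; rewrite notin_setE.
  - rewrite mul0r (_ : [set _ | _] = set0) ?measure0//.
    by rewrite -subset0 => w [A0' _]; move: A0; rewrite notin_setE.
  - rewrite mul0r (_ : [set _ | _] = set0) ?measure0//.
    by rewrite -subset0 => w [A0' _]; move: A0; rewrite notin_setE.
have := @gaussian_add _ _ _ Pr (rsum N) (isum N) (xi N false) (xi N true)
  (Num.sqrt (vsum N)) (a N) (b N) (measurable_rsum N) (measurable_isum N)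
  (measurable_xi N false) (measurable_xi N true) ih _ A B mA mB.
rewrite sqr_sqrtr ?vsum_ge0// {3 4}/vsum big_ord_recr/= => <-.
  by congr (Pr _); apply/seteqP; split => w /=; rewrite {1 2}/rsum {1 2}/isum !big_ord_recr.
move=> E F mE mF; rewrite -(xi_pair_law N)//.
have mri : measurable_fun setT (fun w => (rsum N w, isum N w)).
  by apply: measurable_fun_pair; [exact: measurable_rsum|exact: measurable_isum].
have mp : measurable_fun setT (fun w => (xi N false w, xi N true w)).
  by apply: measurable_fun_pair; exact: measurable_xi.
apply: (fair_indep Pr_fair (D := [pred i : I | (i.1.1 < N)%N])).
- exact: (measurable_preimage mri).
- exact: (measurable_preimage mp).
- move=> u v uv /=.
  have e (i : 'I_N) c : xi i c u = xi i c v by apply: xi_dep => k; apply: uv => /=; rewrite inE /=.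
  have -> : rsum N u = rsum N v by apply: eq_bigr => i _; rewrite !e.
  by have -> : isum N u = isum N v by apply: eq_bigr => i _; rewrite !e.
- move=> u v uv /=; rewrite !(@xi_dep _ _ u v)// => k; apply: uv;
  by rewrite inE/= ltnn.
Qed.

Lemma rsum_law N A : measurable A -> Pr (rsum N @^-1` A) = gaus (Num.sqrt (vsum N)) A.
Proof.
move=> mA; have := sum_law N mA (@measurableT _ RR).
rewrite probability_setT mule1 => <-.
by congr (Pr _); apply/seteqP; split => w /=; [|case].
Qed.

Lemma rsum_sqr N : \int[Pr]_w (rsum N w ^+ 2)%:E =
  (vsum N)%:E * \int[gam]_x (x ^+ 2)%:E.
Proof.
have m2 : measurable_fun setT (fun x : RR => (x ^+ 2)%:E).
  by apply/measurable_EFinP; exact: measurable_funX.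
have p2 (x : R) : 0 <= (x ^+ 2)%:E by rewrite lee_fin sqr_ge0.
rewrite -(ge0_integral_law Pr (measurable_rsum N) m2 p2).
transitivity (\int[gaus (Num.sqrt (vsum N))]_x (x ^+ 2)%:E).
  by apply: eq_measure_integral => A mA _; exact: rsum_law.
rewrite (ge0_integral_law gam _ m2 p2) -ge0_integralZl ?lee_fin ?vsum_ge0//.
by apply: eq_integral => x _; rewrite exprMn sqr_sqrtr ?vsum_ge0// EFinM.
Qed.

End sums.

Lemma isumE a b N : isum a b N = rsum (fun i => - b i)%R a N.
Proof. by apply/funext => w; apply: eq_bigr => i _; rewrite mulNr addrC. Qed.

Lemma isum_sqr a b N : \int[Pr]_w (isum a b N w ^+ 2)%:E =
  (vsum a b N)%:E * \int[gam]_x (x ^+ 2)%:E.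
Proof.
rewrite isumE rsum_sqr; congr (_%:E * _).
by apply: eq_bigr => i _; rewrite sqrrN addrC.
Qed.

End gaussian_family.

Section shift.
Context {R : realType}.
Local Open Scope ereal_scope.
Local Notation I := (nat * bool * nat)%type.
Local Notation Om := (coinT I).
Local Notation Pr := (@Pr R).

(** As [p] stands for the index p + 1, doubling the index sends [p] to 2 p + 1. *)
Definition dbl (i : I) : I := (i.1.1.*2.+1, i.1.2, i.2).

Lemma dbl_inj : injective dbl.
Proof. by move=> [[p c] k] [[p' c'] k'] [] /double_inj -> -> ->. Qed.

Definition shift (w : Om) : Om := w \o dbl.

Lemma measurable_shift_coin : measurable_fun setT shift.
Proof. exact: measurable_reindex. Qed.

Lemma xi_shift p c (w : Om) : xi (R := R) p c (shift w) = xi p.*2.+1 c w.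
Proof. by []. Qed.

Lemma shift_law A : measurable A -> Pr (shift @^-1` A) = Pr A.
Proof. exact: (fair_unique (fair_reindex dbl_inj (@Pr_fair R)) (@Pr_fair R)). Qed.

(** The map p to 2 p + 1 is strictly above the identity, at 0 included, so every coordinate escapes
    to infinity. *)
Lemma iter_shift n (w : Om) i : (n <= (iter n dbl i).1.1)%N.
Proof. by elim: n => //= n ih; lia. Qed.

Lemma iter_shiftE n (w : Om) : iter n shift w = w \o iter n dbl.
Proof.
elim: n w => // n ih w; rewrite iterSr ih; apply/funext => i.
by rewrite /shift /= -iterS.
Qed.

Lemma measurable_iter_shift n : measurable_fun setT (iter n shift).
Proof.
by elim: n => [|n ih]; [exact: measurable_id|exact: (measurableT_comp measurable_shift_coin)].
Qed.

Lemma iter_shift_law n A : measurable A -> Pr (iter n shift @^-1` A) = Pr A.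
Proof.
elim: n A => // n ih A mA.
have mS : measurable (shift @^-1` A).
  by apply: measurable_preimage => //; exact: measurable_shift_coin.
by rewrite -(shift_law mA) -(ih _ mS).
Qed.

(* A cylinder only constrains finitely many coordinates, and high iterates of
   the shift do not look at them, so an almost invariant event is independent
   of every event, in particular of itself. *)
Lemma shift_ergodic (G A : set Om) : measurable G -> Pr G = 1 -> measurable A ->
  (forall w, G w -> G (shift w)) ->
  (forall w, G w -> A w <-> A (shift w)) ->
  Pr A = 0 \/ Pr A = 1.
Proof.
move=> mG PG mA GS AS.
have fP X : measurable X -> Pr X \is a fin_num by exact: fin_num_measure.
have GI X : measurable X -> Pr (G `&` X) = Pr X.
  move=> mX; apply/eqP; rewrite eq_le; apply/andP; split.
    by apply: le_measure; rewrite ?inE//; exact: measurableI.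
  have PGC : Pr (~` G) = 0 by rewrite probability_setC// PG subee.
  rewrite -[leRHS]adde0 -PGC; apply: (le_trans _ (measureU2 _ _ _)); last 2 first.
  - exact: measurableI.
  - exact: measurableC.
  apply: le_measure; rewrite ?inE//.
    by apply: measurableU; [exact: measurableI|exact: measurableC].
  by move=> w Xw; have [Gw|Gw] := pselect (G w); [left|right].
have Ain n w : G w -> A w <-> A (iter n shift w).
  elim: n w => // n ih w Gw; rewrite iterSr.
  by have := ih _ (GS _ Gw); have := AS _ Gw; tauto.
have cylE s : Pr (A `&` cyl s) = Pr A * Pr (cyl s).
  have [n nE] : exists n, n = (\max_(p <- s) p.1.1.1).+1 by exists (\max_(p <- s) p.1.1.1).+1.
  have mSA : measurable (iter n shift @^-1` A).
    by apply: measurable_preimage => //; exact: measurable_iter_shift.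
  rewrite -GI; last by apply: measurableI => //; exact: measurable_cyl.
  transitivity (Pr (G `&` (iter n shift @^-1` A `&` cyl s))).
    congr (Pr _); apply/seteqP; split => w [Gw [/= Aw sw]]; split => //; split => //=.
    exact: (proj1 (Ain n w Gw) Aw).
    exact: (proj2 (Ain n w Gw) Aw).
  rewrite GI; last by apply: measurableI => //; exact: measurable_cyl.
  rewrite (fair_indep (@Pr_fair R) (D := [pred i : I | (n <= i.1.1)%N])) ?iter_shift_law//.
  - exact: measurable_cyl.
  - move=> u v uv /=; rewrite (_ : iter n shift u = iter n shift v)//.
    rewrite !iter_shiftE; apply/funext => i; apply: uv.
    by rewrite inE; exact: iter_shift.
  - move=> u v uv; rewrite /cyl/= => /allP us; apply/allP => p ps.
    rewrite -uv ?us// inE /= -ltnNge nE ltnS.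
    by rewrite (big_rem p)//= leq_maxl.
have indep C : measurable C -> Pr (A `&` C) = Pr A * Pr C.
  move=> mC; pose a := fine (Pr A).
  have aE : Pr A = a%:E by rewrite fineK// fP.
  have a0 : (0 <= a)%R by rewrite fine_ge0.
  pose m1 : {measure set Om -> \bar R} := mrestr Pr mA.
  pose m2 : {measure set Om -> \bar R} := mscale (NngNum a0) Pr.
  have m1E X : m1 X = Pr (A `&` X) by rewrite setIC.
  have m2E X : m2 X = Pr A * Pr X by rewrite aE.
  rewrite -m1E -m2E.
  apply: (@measure_unique _ R Om (range cyl) (fun=> setT)) => //.
  - exact: range_cylI.
  - by move=> _; exists [::]; rewrite ?cyl_nil.
  - by rewrite bigcup_const//; exists 0%N.
  - by move=> _ [s _ <-]; rewrite m1E m2E cylE.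
  - by move=> _; rewrite m1E -ge0_fin_numE// setIT fP.
have := indep A mA; rewrite setIid -(fineK (fP A mA)) -EFinM => -[] /eqP.
rewrite -subr_eq0 -{1}[fine _]mulr1 -mulrBr mulf_eq0 subr_eq0 => /orP[/eqP ->|/eqP <-].
  by left.
by right.
Qed.

End shift.

(** * Equality of joint laws in the limit *)

Section limit_laws.
Context {R : realType}.
Local Open Scope ereal_scope.
Local Notation RR := (measurableTypeR R).

Lemma finite_measure_ray_unique (m1 m2 : {measure set RR -> \bar R}) :
  m1 setT < +oo ->
  (forall x : R, m1 `]-oo, x[%classic = m2 `]-oo, x[%classic) ->
  forall A, measurable A -> m1 A = m2 A.
Proof.
move=> m1T h A mA.
apply: (@measure_unique _ R RR (@RGenInftyO.G R) (fun n => `]-oo, n%:R[%classic)) => //.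
- exact: RGenInftyO.measurableE.
- move=> _ _ [x ->] [y ->]; exists (Num.min x y).
  by apply/seteqP; split => z /=; rewrite !in_itv/= lt_min => /andP.
- by move=> n; exists n%:R.
- apply/seteqP; split => // x _; exists (Num.truncn x).+1 => //=.
  by rewrite in_itv/= truncnS_gt.
- by move=> _ [x ->]; exact: h.
- move=> k; apply: le_lt_trans m1T; apply: le_measure; rewrite ?inE//.
Qed.

(** Continuous functions with values in [0, 1] that converge to the indicator of ]-oo, 0[ at every
    point, 0 included; this is why the rays below are open. *)
Definition ramp (k : nat) : R -> R :=
  (cst 0 \max (cst 1 \min (fun t => - k%:R * t)))%R.

Lemma ramp_ge0 k t : (0 <= ramp k t)%R. Proof. by rewrite /ramp/= le_max lexx. Qed.

Lemma ramp_le1 k t : (ramp k t <= 1)%R.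
Proof. by rewrite /ramp/= ge_max ler01 ge_min lexx. Qed.

Lemma continuous_ramp k : continuous (ramp k).
Proof.
move=> t; apply: continuous_max; first exact: cvg_cst.
apply: continuous_min; first exact: cvg_cst.
by apply: cvgM; [exact: cvg_cst|exact: cvg_id].
Qed.

Lemma measurable_ramp k : measurable_fun setT (ramp k : RR -> RR).
Proof. by apply: continuous_measurable_fun; exact: continuous_ramp. Qed.

Lemma cvg_ramp t : ramp k t @[k --> \oo] --> (\1_(`]-oo, 0%R[%classic : set R) t : R).
Proof.
rewrite indicE; have [t0|t0] := ltP t 0%R.
  rewrite mem_set ?in_itv//=; apply: cvg_near_cst; near=> k.
  have kt : (1 <= - k%:R * t)%R.
    rewrite mulNr -mulrN -ler_pdivrMr ?oppr_gt0//; near: k; exact: nbhs_infty_ger.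
  by rewrite /ramp/= (min_idPl kt) (max_idPr ler01).
rewrite memNset; last by rewrite /= in_itv/= ltNge t0.
apply: cvg_near_cst; near=> k.
have kt : (- k%:R * t <= 0)%R by rewrite mulNr oppr_le0 mulr_ge0.
by rewrite /ramp/= (min_idPr (le_trans kt ler01)) (max_idPl kt).
Unshelve. all: by end_near. Qed.

Lemma bounded_cvg_integral d (T : measurableType d) (P : probability T R)
    (h : nat -> T -> R) (g : T -> R) :
  (forall n, measurable_fun setT (h n)) ->
  (forall n x, (0 <= h n x <= 1)%R) ->
  (forall x, h n x @[n --> \oo] --> g x) ->
  \int[P]_x (h n x)%:E @[n --> \oo] --> \int[P]_x (g x)%:E.
Proof.
move=> mh h01 hg; apply: (dominated_cvg _ _ _ (g := cst 1)) => //.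
- by move=> n; exact/measurable_EFinP.
- by move=> x _; apply: cvg_EFin; [exact: nearW|exact: hg].
- exact: finite_measure_integrable_cst.
- by move=> n x _; rewrite lee_fin ger0_norm; have /andP[] := h01 n x.
Qed.

Section pairs.
Variables (d1 d2 : measure_display) (T1 : measurableType d1) (T2 : measurableType d2)
  (P1 : probability T1 R) (P2 : probability T2 R).

Lemma pair_law_integral (X Y : T1 -> RR) (X' Y' : T2 -> RR) :
  measurable_fun setT X -> measurable_fun setT Y ->
  measurable_fun setT X' -> measurable_fun setT Y' ->
  (forall A B, measurable A -> measurable B ->
    P1 [set w | A (X w) /\ B (Y w)] = P2 [set w | A (X' w) /\ B (Y' w)]) ->
  forall f : RR * RR -> \bar R, measurable_fun setT f -> (forall z, 0 <= f z) ->
  \int[P1]_w f (X w, Y w) = \int[P2]_w f (X' w, Y' w).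
Proof.
move=> mX mY mX' mY' h f mf f0.
have m1 : measurable_fun setT (fun w => (X w, Y w)) by exact: measurable_fun_pair.
have m2 : measurable_fun setT (fun w => (X' w, Y' w)) by exact: measurable_fun_pair.
rewrite -(ge0_integral_law P1 m1 mf f0) -(ge0_integral_law P2 m2 mf f0).
apply: eq_measure_integral => E mE _.
apply: (@measure_unique _ R (RR * RR)%type
  [set A `*` B | A in measurable & B in measurable] (fun=> setT)) => //.
- exact: measurable_prod_measurableType.
- move=> _ _ [A mA [B mB <-]] [C mC [D mD <-]].
  exists (A `&` C); first exact: measurableI.
  by exists (B `&` D); [exact: measurableI|rewrite setXI].
- by move=> _; exists setT => //; exists setT => //; rewrite setXTT.
- by rewrite bigcup_const//; exists 0%N.
- by move=> _ [A mA [B mB <-]]; exact: h.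
- by move=> _; rewrite -ge0_fin_numE// fin_num_measure.
Qed.

(** Two sequences with equal joint laws and pointwise limits have limits with equal joint laws:
    integrals of products of ramps pass to the limit by dominated convergence, and a second limit
    recovers quadrants. One sequence will be an explicit Gaussian model on the plane. *)
Lemma pair_law_lim (X Y : nat -> T1 -> RR) (X' Y' : nat -> T2 -> RR)
    (U V : T1 -> RR) (U' V' : T2 -> RR) :
  (forall n, measurable_fun setT (X n)) -> (forall n, measurable_fun setT (Y n)) ->
  (forall n, measurable_fun setT (X' n)) -> (forall n, measurable_fun setT (Y' n)) ->
  (forall n A B, measurable A -> measurable B ->
    P1 [set w | A (X n w) /\ B (Y n w)] = P2 [set w | A (X' n w) /\ B (Y' n w)]) ->
  (forall w, X n w @[n --> \oo] --> (U w : R)) ->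
  (forall w, Y n w @[n --> \oo] --> (V w : R)) ->
  (forall w, X' n w @[n --> \oo] --> (U' w : R)) ->
  (forall w, Y' n w @[n --> \oo] --> (V' w : R)) ->
  forall A B, measurable A -> measurable B ->
    P1 [set w | A (U w) /\ B (V w)] = P2 [set w | A (U' w) /\ B (V' w)].
Proof.
move=> mX mY mX' mY' h cX cY cX' cY'.
have mlim d (T : measurableType d) (Z : nat -> T -> RR) (W : T -> RR) :
    (forall n, measurable_fun setT (Z n)) ->
    (forall w, Z n w @[n --> \oo] --> (W w : R)) -> measurable_fun setT W.
  by move=> mZ cZ; apply: (@measurable_fun_cvg _ _ R _ Z W) => // w _; exact: cZ.
have mU := mlim _ _ _ _ mX cX; have mV := mlim _ _ _ _ mY cY.
have mU' := mlim _ _ _ _ mX' cX'; have mV' := mlim _ _ _ _ mY' cY'.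
pose f k l (x y : R) (z : RR * RR) : R := (ramp k (z.1 - x) * ramp l (z.2 - y))%R.
have mramp k (x : R) : measurable_fun setT (fun z : RR => ramp k (z - x)%R : RR).
  apply: (measurableT_comp (measurable_ramp k)).
  by apply: measurable_funB => //; exact: measurable_cst.
have mf k l x y : measurable_fun setT (f k l x y).
  apply: measurable_funM.
    exact: (measurableT_comp (mramp k x) measurable_fst).
  exact: (measurableT_comp (mramp l y) measurable_snd).
have f01 k l x y z : (0 <= f k l x y z <= 1)%R.
  by rewrite /f mulr_ge0 ?ramp_ge0//= mulr_ile1 ?ramp_ge0 ?ramp_le1.
have cf k l x y (a b : nat -> R) (a' b' : R) : a n @[n --> \oo] --> a' ->
    b n @[n --> \oo] --> b' -> f k l x y (a n, b n) @[n --> \oo] --> f k l x y (a', b').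
  move=> ca cb; apply: cvgM.
    apply: (continuous_cvg _ (@continuous_ramp k _)); apply: cvgB => //; exact: cvg_cst.
  apply: (continuous_cvg _ (@continuous_ramp l _)); apply: cvgB => //; exact: cvg_cst.
have If k l x y : \int[P1]_w (f k l x y (U w, V w))%:E = \int[P2]_w (f k l x y (U' w, V' w))%:E.
  have c1 : \int[P1]_w (f k l x y (X n w, Y n w))%:E @[n --> \oo] -->
      \int[P1]_w (f k l x y (U w, V w))%:E.
    apply: bounded_cvg_integral => // [n|w]; last exact: cf.
    by apply: (measurableT_comp (mf k l x y)); exact: measurable_fun_pair.
  have c2 : \int[P2]_w (f k l x y (X' n w, Y' n w))%:E @[n --> \oo] -->
      \int[P2]_w (f k l x y (U' w, V' w))%:E.
    apply: bounded_cvg_integral => // [n|w]; last exact: cf.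
    by apply: (measurableT_comp (mf k l x y)); exact: measurable_fun_pair.
  suff e : (fun n => \int[P1]_w (f k l x y (X n w, Y n w))%:E) =
      (fun n => \int[P2]_w (f k l x y (X' n w, Y' n w))%:E).
    by rewrite e in c1; exact: (cvg_unique _ c1 c2).
  apply/funext => n.
  apply: (@pair_law_integral _ _ _ _ _ _ _ _ (h n) (EFin \o f k l x y)) => //.
    by apply/measurable_EFinP.
  by move=> z; rewrite lee_fin; have /andP[] := f01 k l x y z.
have ray x y : P1 [set w | `]-oo, x[%classic (U w) /\ `]-oo, y[%classic (V w)] =
    P2 [set w | `]-oo, x[%classic (U' w) /\ `]-oo, y[%classic (V' w)].
  have lim d (T : measurableType d) (P : probability T R) (u v : T -> RR) :
      measurable_fun setT u -> measurable_fun setT v ->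
      \int[P]_w (f k k x y (u w, v w))%:E @[k --> \oo] -->
      P [set w | `]-oo, x[%classic (u w) /\ `]-oo, y[%classic (v w)].
    move=> mu mv; pose E := [set w | `]-oo, x[%classic (u w) /\ `]-oo, y[%classic (v w)].
    have mE : measurable E.
      by apply: (@measurableI _ _ (u @^-1` `]-oo, x[%classic) (v @^-1` `]-oo, y[%classic));
        exact: measurable_preimage.
    rewrite -/E -[P E](_ : \int[P]_w (\1_E w)%:E = _); last first.
      by rewrite integral_indic// setIT.
    apply: bounded_cvg_integral => // [k|w].
      by apply: (measurableT_comp (mf k k x y)); exact: measurable_fun_pair.
    have -> : \1_E w = (\1_(`]-oo, 0%R[%classic : set R) (u w - x) *
        \1_(`]-oo, 0%R[%classic : set R) (v w - y))%R :> R.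
      rewrite !indicE -natrM mulnb; congr (nat_of_bool _)%:R.
      apply/idP/andP; rewrite !inE /E /= !in_itv/= !subr_lt0; first by move=> [].
      by move=> [].
    by apply: cvgM; exact: cvg_ramp.
  have c1 := lim _ _ P1 U V mU mV; have c2 := lim _ _ P2 U' V' mU' mV'.
  suff e : (fun k => \int[P1]_w (f k k x y (U w, V w))%:E) =
      (fun k => \int[P2]_w (f k k x y (U' w, V' w))%:E).
    by rewrite e in c1; exact: (cvg_unique _ c1 c2).
  by apply/funext => k; exact: If.
(* Rays determine a finite measure on the line, so they are traded for Borel sets in one coordinate
   while the other is frozen. *)
have step (y : R) A : measurable A ->
    P1 [set w | A (U w) /\ `]-oo, y[%classic (V w)] =
    P2 [set w | A (U' w) /\ `]-oo, y[%classic (V' w)].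
  move=> mA; have mVy : measurable (V @^-1` `]-oo, y[%classic) by exact: measurable_preimage.
  have mVy' : measurable (V' @^-1` `]-oo, y[%classic) by exact: measurable_preimage.
  apply: (@finite_measure_ray_unique (image_measure (mrestr P1 mVy) mU)
    (image_measure (mrestr P2 mVy') mU') _ _ A mA); last by move=> x; exact: ray.
  apply: le_lt_trans (ltry 1); apply: (probability_le1 P1).
  by apply: measurableI => //; exact: measurable_preimage.
move=> A B mA mB.
have mUA : measurable (U @^-1` A) by exact: measurable_preimage.
have mUA' : measurable (U' @^-1` A) by exact: measurable_preimage.
have e1 C : P1 [set w | A (U w) /\ C (V w)] = image_measure (mrestr P1 mUA) mV C.
  by rewrite image_measureE; congr (P1 _); exact: setIC.
have e2 C : P2 [set w | A (U' w) /\ C (V' w)] = image_measure (mrestr P2 mUA') mV' C.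
  by rewrite image_measureE; congr (P2 _); exact: setIC.
rewrite e1 e2; apply: finite_measure_ray_unique mB => [|y].
  rewrite -e1; apply: le_lt_trans (ltry 1); apply: (probability_le1 P1).
  by apply: measurableI => //; exact: measurable_preimage.
by rewrite -e1 -e2; exact: step.
Qed.

End pairs.
End limit_laws.

(** * The Collatz map and weighted norms *)

Section collatz_basis.

(** Closed form of the recursion: for i = 2^a m with m odd, this is 2^a (3 m + 1). *)
Definition nxt (i : nat) : nat := (3 * i + 2 ^ logn 2 i)%N.

Lemma nxt_gt i : (0 < i)%N -> (i < nxt i)%N.
Proof. by move=> i0; rewrite /nxt; have := expn_gt0 2 (logn 2 i); lia. Qed.

Lemma nxt_double i : (0 < i)%N -> nxt (2 * i) = (2 * nxt i)%N.
Proof.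
move=> i0; rewrite /nxt lognM// (@logn_prime 2 2)//= add1n expnS; lia.
Qed.

Lemma nxt_odd i : odd i -> nxt i = (3 * i + 1)%N.
Proof. by move=> oi; rewrite /nxt lognE/= dvdn2 oi andbF. Qed.

Lemma odd_nxt i : (0 < i)%N -> odd (nxt i) = false.
Proof.
move=> i0; have [oi|ei] := boolP (odd i); first by rewrite nxt_odd// oddD oddM oi.
have -> : i = (2 * i./2)%N by move: (odd_double_half i); rewrite (negbTE ei); lia.
rewrite nxt_double; last by have := odd_double_half i; rewrite (negbTE ei); lia.
by rewrite oddM.
Qed.

Lemma odd_part_decomp i : (0 < i)%N ->
  exists b, i = (2 ^ logn 2 i * b.*2.+1)%N.
Proof.
move=> i0; have [b o e] := pfactor_coprime (isT : prime 2) i0.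
exists b./2; rewrite {1}e mulnC; congr (_ * _)%N.
by move: o; rewrite coprime2n => o; rewrite -[LHS]odd_double_half o.
Qed.

Context {R : realType}.

(** The preimages of k are 2 k and, when k = 3 q + 2, the odd number (2 k - 1) / 3 = 2 q + 1. *)
Lemma Tseq_val (c : nat -> R[i]) k : (3 <= k)%N ->
  Tseq c k = c (2 * k)%N + (if (k %% 3 == 2)%N then c (2 * (k %/ 3)).+1 else 0).
Proof.
move=> k3; rewrite /Tseq k3.
have c2k : collatz (2 * k) == k by rewrite /collatz; case: ifPn; lia.
have m1 : (2 * k)%N \in index_iota 3 (2 * k).+1 by rewrite mem_index_iota; lia.
rewrite big_mkcond (bigD1_seq (2 * k)%N)/= ?iota_uniq ?m1//.
rewrite c2k; congr (_ + _); case: ifPn => k32.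
  have cm : collatz (2 * (k %/ 3)).+1 == k by rewrite /collatz; case: ifPn; lia.
  have m2 : (2 * (k %/ 3)).+1 \in index_iota 3 (2 * k).+1 by rewrite mem_index_iota; lia.
  rewrite big_mkcond (bigD1_seq (2 * (k %/ 3)).+1)/= ?iota_uniq ?m2//.
  rewrite cm (_ : (_ != _) = true) ?big1_seq ?addr0//; last by apply/eqP; lia.
  move=> j /andP[j0]; rewrite mem_index_iota => /andP[j1 j2].
  case: ifPn => // j3; case: ifPn => // /eqP cj.
  by move: cj j0 j1 j2 j3; rewrite /collatz; case: ifPn; lia.
apply: big1_seq => j /andP[j0]; rewrite mem_index_iota => /andP[j1 j2].
case: ifPn => // /eqP cj.
by move: cj j0 j1 j2; rewrite /collatz; case: ifPn; lia.
Qed.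

End collatz_basis.

Section basis_sums.
Context {R : realType}.
Variable (sg : nat -> R).
Hypothesis sg2 : forall i, sg (2 * i)%N = sg i.

Definition fcoef (i n : nat) : R := (n == i)%:R - (n == nxt i)%:R.

Lemma fcoef_gt i n : (0 < i)%N -> (n < i)%N -> fcoef i n = 0.
Proof.
move=> i0 ni; rewrite /fcoef; have := nxt_gt i0.
have [e|_] := eqVneq n i; first by move: ni; rewrite e ltnn.
by have [e|_] := eqVneq n (nxt i); [move: ni; rewrite e; lia|rewrite subr0].
Qed.

Lemma fcoef_sqr i n : (0 < i)%N ->
  fcoef i n ^+ 2 = (n == i)%:R + (n == nxt i)%:R.
Proof.
move=> i0; rewrite /fcoef; have ni := nxt_gt i0.
have [e1|_] := eqVneq n i; have [e2|_] := eqVneq n (nxt i).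
- by move: ni; rewrite -e2 e1 ltnn.
- by rewrite subr0 expr1n addr0.
- by rewrite sub0r sqrrN expr1n add0r.
- by rewrite subr0 expr0n addr0.
Qed.

(** The n-th coefficient of the whole series of sg_i g_i f_i: it is a finite sum because f_i starts
    at index i. *)
Definition basis_sum (g : nat -> R) (n : nat) : R :=
  \sum_(i < n) sg i.+1 * fcoef i.+1 n * g i.+1.

Lemma sum_parity (h : nat -> R) k :
  \sum_(i < 2 * k) h i = \sum_(i < k) h (2 * i)%N + \sum_(i < k) h (2 * i).+1.
Proof.
elim: k => [|k ih]; first by rewrite !big_ord0 addr0.
have -> : (2 * k.+1 = (2 * k).+2)%N by lia.
by rewrite !big_ord_recr/= ih; ring.
Qed.

Lemma basis_sum_recr g n : basis_sum g n.+1 =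
  sg n.+1 * g n.+1 - \sum_(i < n) sg i.+1 * (n.+1 == nxt i.+1)%:R * g i.+1.
Proof.
rewrite /basis_sum big_ord_recr/= addrC; congr (_ + _).
  rewrite /fcoef eqxx; have := @nxt_gt n.+1 isT.
  by have [<-|_] := eqVneq n.+1 (nxt n.+1); [rewrite ltnn|rewrite subr0 mulr1].
rewrite -sumrN; apply: eq_bigr => i _.
rewrite /fcoef; have [e|_] := eqVneq n.+1 i.+1.
  by have := ltn_ord i; move: e => [e]; rewrite {2}e ltnn.
by rewrite sub0r mulrN mulNr.
Qed.

(* This is T f_(2 i) = f_i and T f_i = 0 for odd i, read on the k-th
   coefficient. *)
Lemma basis_sum_collatz g k : (3 <= k)%N ->
  basis_sum g (2 * k)%N +
    (if (k %% 3 == 2)%N then basis_sum g (2 * (k %/ 3)).+1 else 0) =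
  basis_sum (fun i => g (2 * i)%N) k.
Proof.
case: k => // k k3; have -> : (2 * k.+1 = (2 * k).+2)%N by lia.
rewrite (basis_sum_recr _ (2 * k).+1) [RHS]basis_sum_recr.
have -> : (2 * k).+2 = (2 * k.+1)%N by lia.
rewrite sg2 -!addrA; congr (_ + _).
rewrite big_ord_recr/= (_ : ((2 * k.+1)%N == nxt (2 * k).+1) = false); last first.
  by apply/eqP; rewrite nxt_odd; [lia|rewrite /= oddM].
rewrite mulr0 mul0r addr0.
(* The even indices reproduce the right-hand side. Among the odd ones only the i with 3 i + 1 = 2 (k
   + 1) can contribute, and it cancels against the second preimage. *)
rewrite (sum_parity (fun i => sg i.+1 * ((2 * k.+1)%N == nxt i.+1)%:R * g i.+1)).
rewrite opprD -addrA addrCA.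
have -> : \sum_(i < k) sg (2 * i).+2 * ((2 * k.+1)%N == nxt (2 * i).+2)%:R * g (2 * i).+2 =
    \sum_(i < k) sg i.+1 * (k.+1 == nxt i.+1)%:R * g (2 * i.+1)%N.
  apply: eq_bigr => i _; have -> : (2 * i).+2 = (2 * i.+1)%N by lia.
  by rewrite sg2 nxt_double// eqn_pmul2l.
rewrite -[RHS]addr0; congr (_ + _).
case: ifPn => k32.
  have m0 : (k.+1 %/ 3 < k)%N by lia.
  have -> : basis_sum g (2 * (k.+1 %/ 3)).+1 = sg (2 * (k.+1 %/ 3)).+1 * g (2 * (k.+1 %/ 3)).+1.
    (* An odd coefficient receives nothing from earlier vectors, since [nxt] takes even values. *)
    rewrite basis_sum_recr big1 ?subr0// => i _.
    rewrite (_ : (_ == _) = false) ?mulr0 ?mul0r//; apply/eqP => e.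
    by have := @odd_nxt i.+1 isT; rewrite -e /= oddM.
  rewrite (bigD1 (Ordinal m0))//= big1 => [|i /eqP ni].
    rewrite (_ : (2 * k.+1 == nxt _)%N = true) ?mulr1 ?addr0 ?addNr//.
    by apply/eqP; rewrite nxt_odd; [lia|rewrite /= oddM].
  rewrite (_ : (2 * k.+1 == nxt _)%N = false) ?mulr0 ?mul0r//.
  apply/eqP; rewrite nxt_odd; last by rewrite /= oddM.
  by move=> e; apply: ni; apply/val_inj => /=; lia.
rewrite addr0 big1 ?oppr0// => i _.
rewrite (_ : (_ == _) = false) ?mulr0 ?mul0r//; apply/eqP.
by rewrite nxt_odd; [lia|rewrite /= oddM].
Qed.

End basis_sums.

(** * Choice of the weights of the series *)

Section nonneg_series.
Context {R : realType}.
Local Open Scope ereal_scope.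
Implicit Types (u : nat -> \bar R).

Lemma nneseries_pick (m : nat) u : 0 <= u m ->
  \sum_(0 <= i <oo) (if i == m then u i else 0) = u m.
Proof.
move=> u0; rewrite (nneseriesD1 (n := m))//; last first.
  by move=> k _; case: eqP => // ->.
rewrite eqxx eseries0 ?adde0// => i _ /=.
by move=> /negbTE ->.
Qed.

Lemma eseries_from (N : nat) u :
  \sum_(N <= n <oo) u n = \sum_(0 <= n <oo) (if (n < N)%N then 0 else u n).
Proof.
rewrite eseries_cond eseries_mkcond; apply: eq_eseriesr => i _ /=.
by rewrite ltnNge; case: (N <= i)%N.
Qed.

Lemma nneseries_term u m : (forall i, 0 <= u i) -> u m <= \sum_(0 <= i <oo) u i.
Proof.
move=> u0; apply: le_trans (nneseries_lim_ge m.+1 _) => //.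
by rewrite big_nat_recr//= leeDr// sume_ge0.
Qed.

(** Every positive integer has the form 2^a (2 b + 1), so each term on the left occurs on the
    right. *)
Lemma nneseries_odd_part u : (forall i, 0 <= u i) ->
  \sum_(0 <= i <oo) u i.+1 <=
  \sum_(0 <= b <oo) \sum_(0 <= a <oo) u (2 ^ a * b.*2.+1)%N.
Proof.
move=> u0.
pose t i b a := if i == (2 ^ a * b.*2.+1).-1 then u i.+1 else 0.
have t0 i b a : 0 <= t i b a by rewrite /t; case: eqP.
have -> : \sum_(0 <= b <oo) \sum_(0 <= a <oo) u (2 ^ a * b.*2.+1)%N =
    \sum_(0 <= i <oo) \sum_(0 <= b <oo) \sum_(0 <= a <oo) t i b a.
  rewrite [RHS]nneseries_interchange; last first.
    by move=> i b; apply: nneseries_ge0 => a _ _; exact: t0.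
  apply: eq_eseriesr => b _; rewrite [RHS]nneseries_interchange//.
  apply: eq_eseriesr => a _; rewrite (nneseries_pick _ (u := fun i => u i.+1))//.
  by rewrite prednK// muln_gt0 expn_gt0.
apply: lee_nneseries => // i _.
have [b bE] := @odd_part_decomp i.+1 isT.
apply: le_trans (nneseries_term b _); last first.
  by move=> j; apply: nneseries_ge0 => a _ _; exact: t0.
apply: le_trans (nneseries_term (logn 2 i.+1) _) => //.
by rewrite /t -bE eqxx.
Qed.

End nonneg_series.

Section weights.
Context {R : realType}.
Variable rho : nat -> R.
Hypothesis rho0 : forall n, (0 <= rho n)%R.
Local Open Scope ereal_scope.

(** Lets e_0, e_1, e_2 weigh nothing, so that f_1 = e_1 - e_4 and f_2 = e_2 - e_8 can be treated
    like the other vectors although the space begins at index 3. *)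
Definition tail3 (n : nat) : R := if (n < 3)%N then 0%R else rho n.

Lemma tail3_ge0 n : (0 <= tail3 n)%R. Proof. by rewrite /tail3; case: ifP. Qed.

(** The squared norm of f_i, whose two basis vectors are orthogonal. *)
Definition bnorm (i : nat) : R := (tail3 i + tail3 (nxt i))%R.

Lemma bnorm_ge0 i : (0 <= bnorm i)%R. Proof. by rewrite addr_ge0 ?tail3_ge0. Qed.

Lemma bnormE i : (0 < i)%N ->
  \sum_(0 <= n <oo) (tail3 n * fcoef i n ^+ 2)%:E = (bnorm i)%:E.
Proof.
move=> i0; under eq_eseriesr do rewrite fcoef_sqr// mulrDr EFinD.
rewrite nneseriesD; last 2 first.
- by move=> n _ _; rewrite lee_fin mulr_ge0 ?tail3_ge0.
- by move=> n _ _; rewrite lee_fin mulr_ge0 ?tail3_ge0.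
have pick m : \sum_(0 <= n <oo) (tail3 n * (n == m)%:R)%:E = (tail3 m)%:E.
  rewrite -[RHS](nneseries_pick _ (u := EFin \o tail3)); last by rewrite lee_fin tail3_ge0.
  by apply: eq_eseriesr => n _; case: eqP => _; rewrite ?mulr1 ?mulr0.
by rewrite !pick -EFinD.
Qed.

Lemma coef_norm_le (a : nat -> R) :
  \sum_(0 <= n <oo) (tail3 n * \sum_(i < n) (a i.+1 * fcoef i.+1 n) ^+ 2)%:E <=
  \sum_(0 <= i <oo) (a i.+1 ^+ 2 * bnorm i.+1)%:E.
Proof.
pose t i n := (tail3 n * (a i.+1 * fcoef i.+1 n) ^+ 2)%:E.
have t0 i n : 0 <= t i n by rewrite lee_fin mulr_ge0 ?tail3_ge0 ?sqr_ge0.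
apply: (@le_trans _ _ (\sum_(0 <= n <oo) \sum_(0 <= i <oo) t i n)).
  apply: lee_nneseries => [n _ _|n _].
    by rewrite lee_fin mulr_ge0 ?tail3_ge0// sumr_ge0// => i _; rewrite sqr_ge0.
  rewrite mulr_sumr -sumEFin.
  by have := @nneseries_lim_ge R (t ^~ n) xpredT 0 n (fun i _ _ => t0 i n); rewrite big_mkord.
rewrite nneseries_interchange//; apply: lee_nneseries => [i _ _|i _].
  by apply: nneseries_ge0 => n _ _; exact: t0.
rewrite /t; under eq_eseriesr do rewrite exprMn mulrCA EFinM.
rewrite nneseriesZl; last by move=> n _; rewrite lee_fin mulr_ge0 ?tail3_ge0 ?sqr_ge0.
by rewrite bnormE// -EFinM.
Qed.

Hypothesis rho_sum : forall k, (3 <= k)%N ->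
  \sum_(0 <= n <oo) (rho (k * 2 ^ n)%N)%:E < +oo.

Lemma tail3_sum k : (3 <= k)%N -> \sum_(0 <= a <oo) (tail3 (2 ^ a * k)%N)%:E < +oo.
Proof.
move=> k3; apply: le_lt_trans (rho_sum k3); apply: lee_nneseries => a _.
  by rewrite lee_fin tail3_ge0.
rewrite lee_fin mulnC /tail3; by case: ifP.
Qed.

Lemma bnorm_sum b : \sum_(0 <= a <oo) (bnorm (2 ^ a * b.*2.+1))%:E < +oo.
Proof.
have nxtE a : nxt (2 ^ a * b.*2.+1) = (2 ^ a * (3 * b.*2.+1 + 1))%N.
  elim: a => [|a ih]; first by rewrite !mul1n nxt_odd//= odd_double.
  by rewrite expnS -!mulnA nxt_double ?ih// muln_gt0 expn_gt0.
under eq_eseriesr do rewrite /bnorm nxtE EFinD.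
rewrite nneseriesD; last 2 first.
- by move=> n _ _; rewrite lee_fin tail3_ge0.
- by move=> n _ _; rewrite lee_fin tail3_ge0.
apply: lte_add_pinfty; last by apply: tail3_sum; lia.
(* The orbit 1, 2, 4, ... of b = 0 starts below 3; after two terms it is the orbit of 4. *)
case: b {nxtE} => [|b]; last by apply: tail3_sum; lia.
rewrite (nneseries_split _ 2); last by move=> k _; rewrite lee_fin tail3_ge0.
apply: lte_add_pinfty; first by rewrite sumEFin ltry.
rewrite add0n -nneseries_addn; last by move=> k; rewrite lee_fin tail3_ge0.
have := @tail3_sum 4 isT; congr (_ < _); apply: eq_eseriesr => i _.
by rewrite expnD muln1.
Qed.

Definition odd_index (i : nat) : nat := (i %/ 2 ^ logn 2 i)./2.

Lemma odd_index_double i : odd_index (2 * i) = odd_index i.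
Proof.
case: i => // i; rewrite /odd_index lognM// (@logn_prime 2 2)//= add1n expnS.
by rewrite divnMl.
Qed.

Lemma odd_index_pow a b : odd_index (2 ^ a * b.*2.+1) = b.
Proof.
elim: a => [|a ih]; last by rewrite expnS -mulnA odd_index_double.
rewrite mul1n /odd_index (_ : logn 2 b.*2.+1 = 0%N); first by rewrite divn1 /= uphalf_double.
by apply/eqP; rewrite -leqn0 leqNgt logn_gt0 mem_primes dvdn2 /= odd_double.
Qed.

(** The weight depends only on the odd part 2 b + 1. If S b is the sum of the squared norms along
    that orbit, the squared weight 2^-(b+1) / (1 + S b) makes the orbit contribute at most
    2^-(b+1). *)
Lemma sigma_exists : exists sg : nat -> R,
  [/\ forall i, (0 < sg i)%R, forall i, sg (2 * i)%N = sg i &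
      \sum_(0 <= i <oo) (sg i.+1 ^+ 2 * bnorm i.+1)%:E < +oo].
Proof.
pose S b := fine (\sum_(0 <= a <oo) (bnorm (2 ^ a * b.*2.+1))%:E).
have sum0 b : 0 <= \sum_(0 <= a <oo) (bnorm (2 ^ a * b.*2.+1))%:E.
  by apply: nneseries_ge0 => n _ _; rewrite lee_fin bnorm_ge0.
have S0 b : (0 <= S b)%R by rewrite fine_ge0.
have SE b : \sum_(0 <= a <oo) (bnorm (2 ^ a * b.*2.+1))%:E = (S b)%:E.
  by rewrite fineK// ge0_fin_numE// bnorm_sum.
pose v b : R := ((2 ^+ b.+1)^-1 / (1 + S b))%R.
have v0 b : (0 < v b)%R by rewrite divr_gt0 ?invr_gt0 ?exprn_gt0// ltr_wpDr.
exists (fun i => Num.sqrt (v (odd_index i))); split.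
- by move=> i; rewrite sqrtr_gt0.
- by move=> i; rewrite odd_index_double.
apply: le_lt_trans (nneseries_odd_part (u := fun i => (Num.sqrt (v (odd_index i)) ^+ 2 * bnorm i)%:E) _) _.
  by move=> i; rewrite lee_fin mulr_ge0 ?sqr_ge0 ?bnorm_ge0.
apply: (@le_lt_trans _ _ (\sum_(0 <= b <oo) ((1 / (2 ^ (b + 1))%:R)%R%:E))).
  apply: lee_nneseries => [b _ _|b _].
    by apply: nneseries_ge0 => n _ _; rewrite lee_fin mulr_ge0 ?sqr_ge0 ?bnorm_ge0.
  under eq_eseriesr do rewrite odd_index_pow sqr_sqrtr ?ltW// EFinM.
  rewrite nneseriesZl; last by move=> n _; rewrite lee_fin bnorm_ge0.
  rewrite SE -EFinM lee_fin /v addn1 natrX div1r -mulrA ler_piMr ?invr_ge0 ?exprn_ge0//.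
  by rewrite mulrC ler_pdivrMr ?mul1r ?lerDr// ltr_wpDr.
have /cvg_lim := @cvg_geometric_eseries_half R 1 0.
by rewrite /eseries/= => ->//; rewrite ltry.
Qed.

End weights.

(** * Weighted norms and totality of the vectors *)

Section complex_modulus.
Context {R : realType}.
Implicit Types z : R[i].

Lemma cabs2_ge0 z : 0 <= cabs2 z.
Proof. by rewrite addr_ge0 ?sqr_ge0. Qed.

Lemma cabs20 : cabs2 (0 : R[i]) = 0.
Proof. by rewrite /cabs2/= expr0n addr0. Qed.

Lemma cabs2M z z' : cabs2 (z * z') = cabs2 z * cabs2 z'.
Proof. by case: z z' => [a b] [a' b']; rewrite /cabs2/=; ring. Qed.

Lemma cabs2D z z' : cabs2 (z + z') <= 2 * cabs2 z + 2 * cabs2 z'.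
Proof.
case: z z' => [a b] [a' b']; rewrite /cabs2/=.
by have := sqr_ge0 (a - a'); have := sqr_ge0 (b - b'); lra.
Qed.

Lemma cabs2N z : cabs2 (- z) = cabs2 z.
Proof. by case: z => a b; rewrite /cabs2/= !sqrrN. Qed.

Lemma cabs2_real (x : R) : cabs2 (x%:C)%C = x ^+ 2.
Proof. by rewrite /cabs2/= expr0n addr0. Qed.

End complex_modulus.

Section weighted_norm.
Context {R : realType}.
Variable rho : nat -> R.
Hypothesis rho0 : forall n, 0 <= rho n.
Local Notation w3 := (@tail3 R rho).
Local Notation bnorm := (bnorm rho).
Implicit Types (c d : nat -> R[i]).

Definition wnorm c : \bar R := (\sum_(0 <= n <oo) (w3 n * cabs2 (c n))%:E)%E.

Lemma wterm_ge0 c n : 0 <= w3 n * cabs2 (c n).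
Proof. by rewrite mulr_ge0 ?tail3_ge0 ?cabs2_ge0. Qed.

Lemma wnorm_ge0 c : (0 <= wnorm c)%E.
Proof. by apply: nneseries_ge0 => n _ _; rewrite lee_fin mulr_ge0 ?tail3_ge0 ?cabs2_ge0. Qed.

Lemma eq_wnorm c d : (forall n, (3 <= n)%N -> c n = d n) -> wnorm c = wnorm d.
Proof.
move=> cd; apply: eq_eseriesr => n _; rewrite /tail3.
by case: ltnP => n3; [rewrite !mul0r|rewrite cd].
Qed.

Lemma wnormD c d :
  (wnorm (fun n => (c n + d n)%R) <= 2%:E * wnorm c + 2%:E * wnorm d)%E.
Proof.
rewrite -!nneseriesZl; [|by move=> n _; rewrite lee_fin mulr_ge0 ?tail3_ge0 ?cabs2_ge0..].
rewrite -nneseriesD; [|by move=> n _ _; rewrite -EFinM lee_fin mulr_ge0 ?wterm_ge0..].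
apply: lee_nneseries => [n _ _|n _]; first by rewrite lee_fin mulr_ge0 ?tail3_ge0 ?cabs2_ge0.
rewrite -!EFinM -EFinD lee_fin mulrCA [2 * (_ * cabs2 (d n))]mulrCA -mulrDr.
by rewrite ler_wpM2l ?tail3_ge0// cabs2D.
Qed.

Lemma wnormN c : wnorm (fun n => (- c n)%R) = wnorm c.
Proof. by apply: eq_eseriesr => n _; rewrite cabs2N. Qed.

Lemma wnorm_sub_lt c d e (r s t : R) :
  (wnorm (fun n => (c n - d n)%R) < r%:E)%E -> (wnorm (fun n => (d n - e n)%R) < s%:E)%E ->
  2 * r + 2 * s <= t -> (wnorm (fun n => (c n - e n)%R) < t%:E)%E.
Proof.
move=> cd de rst; rewrite (@eq_wnorm _ (fun n => (c n - d n) + (d n - e n))); last first.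
  by move=> n _; rewrite addrA subrK.
apply: le_lt_trans (wnormD _ _) _.
apply: (@lt_le_trans _ _ (2%:E * r%:E + 2%:E * s%:E)%E); last by rewrite -!EFinM -EFinD lee_fin.
by apply: lteD; rewrite lte_pmul2l// fin_numE.
Qed.

Lemma wnorm_basis (al : R[i]) p :
  wnorm (fun n => al * (fcoef p.+1 n)%:C%C) = (cabs2 al * bnorm p.+1)%:E.
Proof.
rewrite /wnorm; under eq_eseriesr do rewrite cabs2M cabs2_real mulrCA EFinM.
rewrite nneseriesZl; last by move=> n _; rewrite lee_fin mulr_ge0 ?tail3_ge0 ?sqr_ge0.
by rewrite bnormE.
Qed.

(** Rational coefficients keep the combinations countable, as the Borel measurability of the random
    vector requires. *)
Definition ratc (q : rat * rat) : R[i] := (ratr q.1 +i* ratr q.2)%C.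

Definition comb (s : seq (nat * (rat * rat))) (n : nat) : R[i] :=
  if (n < 3)%N then 0 else \sum_(e <- s) ratc e.2 * (fcoef e.1.+1 n)%:C%C.

Lemma comb_nil n : comb [::] n = 0.
Proof. by rewrite /comb big_nil; case: ifP. Qed.

Lemma comb_cat s t n : comb (s ++ t) n = comb s n + comb t n.
Proof. by rewrite /comb big_cat; case: ifP => //; rewrite addr0. Qed.

Definition approx c := forall e : R, 0 < e ->
  exists s, (wnorm (fun n => (c n - comb s n)%R) < e%:E)%E.

Lemma eq_approx c d : (forall n, (3 <= n)%N -> c n = d n) -> approx c -> approx d.
Proof.
move=> cd ac e e0; have [s hs] := ac e e0; exists s.
by rewrite -(@eq_wnorm (fun n => (c n - comb s n)%R))// => n n3; rewrite cd.
Qed.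

Lemma approx0 : approx (fun=> 0).
Proof.
move=> e e0; exists [::]; rewrite /wnorm eseries0 ?lte_fin// => n _ _.
by rewrite comb_nil subr0 cabs20 mulr0.
Qed.

Lemma approxD c d : approx c -> approx d -> approx (fun n => c n + d n).
Proof.
move=> ac ad e e0; have e4 : 0 < e / 4 by rewrite divr_gt0.
have [s hs] := ac _ e4; have [t ht] := ad _ e4; exists (s ++ t).
rewrite (@eq_wnorm _ (fun n => (c n - comb s n) + (d n - comb t n))); last first.
  by move=> n _; rewrite comb_cat opprD addrACA.
apply: le_lt_trans (wnormD _ _) _.
apply: (@lt_le_trans _ _ (2%:E * (e / 4)%:E + 2%:E * (e / 4)%:E)%E).
  by apply: lteD; rewrite lte_pmul2l// fin_numE.
by rewrite -!EFinM -EFinD lee_fin; lra.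
Qed.

Lemma approx_lim c : (forall e : R, 0 < e -> exists2 d, approx d &
  (wnorm (fun n => (c n - d n)%R) < e%:E)%E) -> approx c.
Proof.
move=> h e e0; have e4 : 0 < e / 4 by rewrite divr_gt0.
have [d ad cd] := h _ e4; have [s hs] := ad _ e4; exists s.
by apply: wnorm_sub_lt cd hs _; lra.
Qed.

Lemma ratc_dense (al : R[i]) (e : R) : 0 < e -> exists q, cabs2 (al - ratc q) < e.
Proof.
move=> e0; pose r := Num.sqrt (e / 2).
have r0 : 0 < r by rewrite sqrtr_gt0 divr_gt0.
have near (x : R) : exists q : rat, (x - ratr q) ^+ 2 < e / 2.
  have [q] := @rat_in_itvoo R (x - r) (x + r) (ltac:(by lra)).
  rewrite in_itv/= => /andP[h1 h2]; exists q.
  rewrite -(@sqr_sqrtr _ (e / 2)) ?divr_ge0 ?ltW// -/r.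
  by rewrite -[ltLHS]real_normK ?num_real// ltrXn2r ?nnegrE// ?(ltW r0)// ltr_norml; lra.
case: al => a b; have [p hp] := near a; have [q hq] := near b.
by exists (p, q); rewrite /cabs2/=; lra.
Qed.

Lemma approx_basis (al : R[i]) p : approx (fun n => al * (fcoef p.+1 n)%:C%C).
Proof.
move=> e e0; pose B := bnorm p.+1; have B0 : 0 <= B by exact: bnorm_ge0.
have [q hq] := @ratc_dense al (e / (B + 1)) (ltac:(by rewrite divr_gt0// ltr_wpDl)).
exists [:: (p, q)].
rewrite (@eq_wnorm _ (fun n => (al - ratc q) * (fcoef p.+1 n)%:C%C)); last first.
  by move=> n n3; rewrite /comb ltnNge n3/= big_seq1 mulrBl.
rewrite wnorm_basis lte_fin -/B.
rewrite (@le_lt_trans _ _ (e / (B + 1) * B))//; first by rewrite ler_wpM2r// ltW.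
rewrite mulrAC ltr_pdivrMr ?ltr_wpDl// ltr_pM2l//; lra.
Qed.

Lemma approx_sum (K : nat) (F : nat -> nat -> R[i]) :
  (forall k, approx (F k)) -> approx (fun n => \sum_(k < K) F k n).
Proof.
move=> aF; elim: K => [|K ih].
  by apply: eq_approx approx0 => n _; rewrite big_ord0.
apply: eq_approx (approxD ih (aF K)) => n _.
by rewrite big_ord_recr.
Qed.

Variable D : R.
Hypothesis rhoD : forall n, (3 <= n)%N -> rho n <= D.

(* The average of e_(nxt i), ..., e_(nxt^K i) is small because its K terms are
   pairwise orthogonal. *)
Lemma approx_delta (al : R[i]) i : (0 < i)%N ->
  approx (fun n => al * ((n == i)%:R : R)%:C%C).
Proof.
move=> i0; apply: approx_lim => e e0.
pose it k := iter k nxt i.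
have it0 k : (0 < it k)%N by elim: k => //= k ih; apply: ltn_trans (nxt_gt _).
have itS k : (it k < it k.+1)%N by exact: nxt_gt.
have it_inj k l : it k = it l -> k = l.
  move=> kl; apply/eqP; rewrite eqn_leq.
  have mono a b : (a < b)%N -> (it a < it b)%N.
    by elim: b => // b ih; rewrite ltnS leq_eqVlt => /orP[/eqP -> //|/ih h]; exact: ltn_trans (itS b).
  by apply/andP; split; rewrite leqNgt; apply/negP => /mono; rewrite kl ltnn.
have D0 : 0 <= D by apply: le_trans (rhoD (leqnn 3)).
pose K := (Num.truncn (cabs2 al * D / e)).+1.
have K0 : 0 < K%:R :> R by rewrite ltr0n.
have KE : cabs2 al * D / K%:R < e.
  rewrite ltr_pdivrMr// [ltRHS]mulrC -ltr_pdivrMr//; exact: truncnS_gt.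
(* Summation by parts: the sum over k < K of (K - k)/K times e_(it k) - e_(it (k+1)) is e_i minus
   the average of e_(it 1), ..., e_(it K). *)
pose F k n : R[i] := al * ((K - k)%:R / K%:R : R)%:C%C * (fcoef (it k) n)%:C%C.
exists (fun n => \sum_(k < K) F k n).
  apply: (@approx_sum K F) => k; rewrite /F -(prednK (it0 k)); exact: approx_basis.
have tele n : al * ((n == i)%:R : R)%:C%C - \sum_(k < K) F k n =
    al * (K%:R^-1 * \sum_(k < K) (n == it k.+1)%:R : R)%:C%C.
  rewrite /F; under eq_bigr do rewrite -mulrA -rmorphM/=.
  rewrite -mulr_sumr -rmorph_sum/= -mulrBr -rmorphB/=; congr (_ * (_)%:C%C).
  have h m : (m <= K)%N -> \sum_(k < m) (K - k)%:R / K%:R * fcoef (it k) n =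
      (n == i)%:R - (K - m)%:R / K%:R * (n == it m)%:R - K%:R^-1 * \sum_(k < m) (n == it k.+1)%:R :> R.
    elim: m => [|m ih] mK.
      by rewrite !big_ord0 subn0 -[it 0%N]/i; field; rewrite gt_eqF.
    rewrite !big_ord_recr/= ih ?(ltnW mK)// /fcoef -[nxt (it m)]/(it m.+1).
    have -> : (K - m)%:R = (K - m.+1)%:R + 1 :> R.
      by rewrite natr1; congr (_%:R); lia.
    by field; rewrite gt_eqF.
  by rewrite h// subnn mul0r mul0r subr0; ring.
rewrite (@eq_wnorm _ (fun n => al * (K%:R^-1 * \sum_(k < K) (n == it k.+1)%:R : R)%:C%C)); last first.
  by move=> n _; exact: tele.
apply: le_lt_trans _ (_ : ((cabs2 al * D / K%:R)%:E < e%:E)%E); last by rewrite lte_fin.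
(* At most one of these indicators is nonzero: the orthogonality of the terms. *)
have sq n : (\sum_(k < K) (n == it k.+1)%:R : R) ^+ 2 = \sum_(k < K) (n == it k.+1)%:R.
  have [/existsP[k0 /eqP nk]|no] := boolP [exists k : 'I_K, n == it k.+1].
    rewrite (bigD1 k0)//= big1 ?nk ?eqxx ?addr0 ?expr1n// => k kk0.
    rewrite (_ : (_ == _) = false)//; apply/eqP => e0'; have [e1] := it_inj k0.+1 k.+1 e0'.
    by move/eqP: kk0; apply; exact/val_inj.
  rewrite big1 ?expr0n// => k _; rewrite (_ : (_ == _) = false)//.
  by apply/negbTE; apply: contra no => h; apply/existsP; exists k.
pose C := cabs2 al * D / K%:R ^+ 2.
have C0 : 0 <= C by rewrite !mulr_ge0 ?cabs2_ge0 ?invr_ge0 ?exprn_ge0.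
apply: (@le_trans _ _ (\sum_(0 <= n <oo) \sum_(k < K) (if n == it k.+1 then C%:E else 0)))%E.
  apply: lee_nneseries => [n _ _|n _]; first by rewrite lee_fin mulr_ge0 ?tail3_ge0 ?cabs2_ge0.
  rewrite cabs2M cabs2_real exprMn sq.
  have -> : (\sum_(k < K) (if n == it k.+1 then C%:E else 0) = (C * \sum_(k < K) (n == it k.+1)%:R)%:E)%E.
    rewrite mulr_sumr -sumEFin; apply: eq_bigr => k _.
    by case: eqP; rewrite ?mulr1 ?mulr0.
  have tD : w3 n <= D by rewrite /tail3; case: ltnP => // /rhoD.
  rewrite lee_fin /C [leLHS](_ : _ = w3 n * (cabs2 al / K%:R ^+ 2 * \sum_(k < K) (n == it k.+1)%:R)); last first.
    by rewrite exprVn; ring.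
  rewrite [leRHS](_ : _ = D * (cabs2 al / K%:R ^+ 2 * \sum_(k < K) (n == it k.+1)%:R)); last by ring.
  by rewrite ler_wpM2r// !mulr_ge0 ?cabs2_ge0 ?invr_ge0 ?exprn_ge0 ?sumr_ge0.
rewrite nneseries_sum; last by move=> k n _; case: ifP.
under eq_bigr do rewrite (@nneseries_pick _ _ (fun=> C%:E)) ?lee_fin//.
rewrite sumEFin sumr_const card_ord lee_fin /C -mulr_natr.
by rewrite le_eqVlt; apply/orP; left; apply/eqP; field; rewrite gt_eqF.
Qed.

Lemma approx_all c : (wnorm c < +oo)%E -> approx c.
Proof.
move=> cfin; apply: approx_lim => e e0.
have := nneseries_tail_cvg cfin (fun n _ => ltac:(by rewrite lee_fin mulr_ge0 ?tail3_ge0 ?cabs2_ge0)).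
move=> /fine_cvgP[[N1 _ h1]] /cvgr_lt /(_ e e0) [N2 _ h2].
pose N := maxn N1 N2.
(* The value at k = 0 is set to 0 because [approx_delta] starts at index 1; the norm ignores that
   coefficient. *)
pose F (k n : nat) : R[i] := if (0 < k)%N then c k * ((n == k)%:R : R)%:C%C else 0.
exists (fun n => \sum_(k < N) F k n).
  apply: (@approx_sum N F).
  by case=> [|k]; [exact: approx0|exact: approx_delta].
have /= := h2 N (leq_maxr _ _); rewrite -lte_fin fineK; last exact: h1 (leq_maxl _ _).
apply: le_lt_trans; rewrite [leRHS]eseries_from.
apply: lee_nneseries => [n _ _|n _]; first by rewrite lee_fin mulr_ge0 ?tail3_ge0 ?cabs2_ge0.
case: ltnP => nN.
  rewrite /F; case: n nN => [|n] nN; first by rewrite /tail3/= mul0r.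
  rewrite (bigD1 (Ordinal nN))//= eqxx mulr1 big1 ?addr0 ?subrr ?cabs20 ?mulr0//.
  move=> k /eqP kn; case: ifP => // _; rewrite (_ : (_ == _) = false) ?mulr0//.
  by apply/eqP => nk; apply: kn; apply/val_inj.
rewrite big1 ?subr0// => k _; rewrite /F; case: ifP => // _.
rewrite (_ : (_ == _) = false) ?mulr0//; apply/eqP => nk.
by move: nN; rewrite nk leqNgt ltn_ord.
Qed.

End weighted_norm.

(** * Holomorphy on the disk *)

Section holomorphy.
Context {R : realType}.
Local Open Scope ereal_scope.
Implicit Types c : nat -> R[i].

Lemma arith_geo_lty (q : R) : (0 <= q < 1)%R ->
  \sum_(0 <= n <oo) (n.+1%:R * q ^+ n)%:E < +oo.
Proof.
move=> /andP[q0 q1].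
have q1' : (0 < 1 - q)%R by rewrite subr_gt0.
have E N : (\sum_(n < N) n.+1%:R * q ^+ n = (1 - N.+1%:R * q ^+ N + N%:R * q ^+ N.+1) / (1 - q) ^+ 2)%R.
  elim: N => [|N ih]; first by rewrite big_ord0 expr0 mulr1 mul0r addr0 subrr mul0r.
  rewrite big_ord_recr/= ih -!natr1 !exprS.
  by field; rewrite gt_eqF.
apply: (@le_lt_trans _ _ ((1 - q) ^- 2)%:E); last exact: ltry.
apply: lime_le.
  by apply: is_cvg_nneseries => n _ _; rewrite lee_fin mulr_ge0 ?exprn_ge0.
apply: nearW => N; rewrite big_mkord sumEFin lee_fin E.
rewrite ler_pdivrMr ?exprn_gt0// mulVf ?gt_eqF ?exprn_gt0//.
have : (N%:R * q ^+ N.+1 <= N%:R * q ^+ N)%R.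
  by rewrite exprS mulrCA ler_piMl ?(ltW q1)// mulr_ge0 ?exprn_ge0.
have := exprn_ge0 N q0; rewrite -natr1; lra.
Qed.

(** The Bergman weight. It is 1/[omega0] up to the factor pi, so boundedness of the operator for
    [omega0] also serves arbitrary [w]. *)
Definition hw (n : nat) : R := (n.+1%:R^-1)%R.

Lemma hw_ge0 n : (0 <= hw n)%R. Proof. by rewrite invr_ge0. Qed.

(** Termwise, |c_n| r^n <= |c_n|^2 / (n + 1) + (n + 1) r^(2n), and both series converge. *)
Lemma wnorm_holomorphic c : (forall n, (n < 3)%N -> c n = 0%R) ->
  wnorm hw c < +oo ->
  forall r : R, (0 <= r < 1)%R ->
    \sum_(0 <= n <oo) (Num.sqrt (cabs2 (c n)) * r ^+ n)%:E < +oo.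
Proof.
move=> c3 cfin r /andP[r0 r1].
have q01 : (0 <= r ^+ 2 < 1)%R by rewrite exprn_ge0//= exprn_ilt1.
apply: (@le_lt_trans _ _ (wnorm hw c +
    \sum_(0 <= n <oo) (n.+1%:R * (r ^+ 2) ^+ n)%:E)); last first.
  by apply: lte_add_pinfty => //; exact: arith_geo_lty.
rewrite /wnorm -nneseriesD; last 2 first.
- by move=> n _ _; rewrite lee_fin mulr_ge0 ?cabs2_ge0// tail3_ge0//; exact: hw_ge0.
- by move=> n _ _; rewrite lee_fin mulr_ge0 ?exprn_ge0.
apply: lee_nneseries => [n _ _|n _].
  by rewrite lee_fin mulr_ge0 ?sqrtr_ge0 ?exprn_ge0.
rewrite -EFinD lee_fin /tail3 /hw; case: ltnP => n3.
  by rewrite c3// cabs20 sqrtr0 !mul0r add0r mulr_ge0 ?exprn_ge0.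
set x := cabs2 _; set m := n.+1%:R : R.
have m0 : (0 < m)%R by rewrite ltr0n.
have x0 : (0 <= x)%R by exact: cabs2_ge0.
have xE : x = (Num.sqrt x ^+ 2)%R by rewrite sqr_sqrtr.
rewrite exprAC -[(m * _)%R](_ : m^-1 * (m * r ^+ n) ^+ 2 = _)%R; last by field; rewrite gt_eqF.
rewrite {2}xE -mulrDr ler_pdivlMl//.
set y := Num.sqrt x; have y0 : (0 <= y)%R by exact: sqrtr_ge0.
set z := (r ^+ n)%R; have z0 : (0 <= z)%R by exact: exprn_ge0.
have h := sqr_ge0 (y - m * z).
have : (0 <= m * (y * z))%R by rewrite !mulr_ge0// ltW.
by move: h; lra.
Qed.

Variable w : nat -> R.
Hypothesis w0 : forall n, (0 < n)%N -> (0 < w n)%R.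

(** The absolute value keeps this nonnegative at n = 0 as well, where [w] is unconstrained. *)
Definition iw n : R := `|w n|^-1.

Lemma iw_ge0 n : (0 <= iw n)%R. Proof. by rewrite invr_ge0. Qed.

Lemma iwE n : (0 < n)%N -> iw n = (w n)^-1%R.
Proof. by move=> n0; rewrite /iw gtr0_norm// w0. Qed.

Lemma normw2E c : normw2 w c = wnorm iw c.
Proof.
rewrite /normw2 eseries_from; apply: eq_eseriesr => n _.
rewrite /tail3; case: ltnP => n3; first by rewrite mul0r.
by rewrite iwE 1?mulrC//; exact: leq_trans n3.
Qed.

End holomorphy.

(** * The weight omega0 *)

Section omega0.
Context {R : realType}.
Local Open Scope ereal_scope.
Implicit Types c : nat -> R[i].

(** Meant for the two branches of the inverse Collatz map: [P] is the domain of a branch, and by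
    injectivity no term is counted twice. *)
Lemma nneseries_inj_le (P : pred nat) (e : nat -> nat) (u : nat -> \bar R) :
  (forall n, 0 <= u n) -> {in P &, injective e} ->
  \sum_(0 <= k <oo) (if P k then u (e k) else 0) <= \sum_(0 <= n <oo) u n.
Proof.
move=> u0 eI; pose t k j := if j == e k then (if P k then u j else 0) else 0.
have t0 k j : 0 <= t k j by rewrite /t; case: ifP => // _; case: ifP.
have -> : \sum_(0 <= k <oo) (if P k then u (e k) else 0) =
    \sum_(0 <= k <oo) \sum_(0 <= j <oo) t k j.
  apply: eq_eseriesr => k _.
  by rewrite (@nneseries_pick _ (e k) (fun j => if P k then u j else 0))//; case: ifP.
rewrite nneseries_interchange//; apply: lee_nneseries => [j _ _|j _].
  by apply: nneseries_ge0 => k _ _; exact: t0.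
have [[k0 Pk0 jk0]|no] := pselect (exists2 k, P k & j = e k).
  rewrite -[leRHS](@nneseries_pick _ k0 (fun=> u j))//.
  apply: lee_nneseries => [//|k _]; rewrite /t.
  case: (j =P e k) => [jk|_]; last by case: ifP.
  case: ifPn => [Pk|_]; last by case: ifP.
  rewrite (_ : k = k0) ?eqxx//; apply: eI => //; congruence.
rewrite eseries0// => k _ _; rewrite /t; case: eqP => // jk; case: ifPn => // Pk.
by exfalso; apply: no; exists k.
Qed.

Lemma omega0_gt0 n : (0 < omega0 n :> R)%R.
Proof. by rewrite divr_gt0 ?pi_gt0// ltr_wpDl. Qed.

Lemma wnorm_hw c : wnorm hw c = (pi^-1 : R)%:E * normw2 omega0 c.
Proof.
have w0 n : (0 < n)%N -> (0 < @omega0 R n)%R by move=> _; exact: omega0_gt0.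
rewrite normw2E// -nneseriesZl.
  apply: eq_eseriesr => n _; rewrite -EFinM mulrA; congr (_ * _)%:E.
  rewrite /tail3; case: ltnP => n3; rewrite ?mulr0// iwE//; last exact: leq_trans n3.
  by rewrite /omega0 invf_div natr1 mulrA mulVf ?mul1r// gt_eqF ?pi_gt0.
by move=> n _; rewrite lee_fin mulr_ge0 ?cabs2_ge0 ?tail3_ge0//; exact: iw_ge0.
Qed.

Lemma omega0_lower : exists2 d : R, (0 < d)%R & forall n, (0 < n)%N -> (d <= omega0 n)%R.
Proof.
exists (pi^-1)%R; first by rewrite invr_gt0 pi_gt0.
by move=> n _; rewrite /omega0 ler_pdivlMr ?pi_gt0// mulVf ?gt_eqF ?pi_gt0// lerDr.
Qed.

Lemma omega0_sum k : (3 <= k)%N ->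
  \sum_(0 <= n <oo) ((omega0 (k * 2 ^ n)%N)^-1 : R)%:E < +oo.
Proof.
move=> k3; apply: (@le_lt_trans _ _ (pi%:E * \sum_(0 <= n <oo) ((1 / (2 ^ (n + 1))%:R)%R%:E))).
  rewrite -nneseriesZl; last by move=> n _; rewrite lee_fin mul1r invr_ge0.
  apply: lee_nneseries => [n _ _|n _]; first by rewrite lee_fin invr_ge0 ltW ?omega0_gt0.
  rewrite -EFinM lee_fin /omega0 invf_div ler_wpM2l ?pi_ge0// mul1r.
  rewrite lef_pV2 ?posrE ?ltr_wpDl// ?ltr0n ?expn_gt0//.
  rewrite natr1 ler_nat addn1 expnS leqW// leq_mul2r; apply/orP; right; lia.
have /cvg_lim := @cvg_geometric_eseries_half R 1 0.
by rewrite /eseries/= => ->//; rewrite -EFinM ltry.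
Qed.

Lemma omega0_T_bounded : T_bounded (@omega0 R).
Proof.
pose w := @omega0 R; have w0 n : (0 < n)%N -> (0 < w n)%R by move=> _; exact: omega0_gt0.
have iwE' n : iw w n = (w n)^-1%R by rewrite /iw gtr0_norm// omega0_gt0.
(* 6 = 2 * 2 + 2 * 1: the factor 2 bounds the squared modulus of a sum of two terms, and the weight
   ratios along the branches 2 k and 2 (k / 3) + 1 are at most 2 and 1. *)
exists 6%R => x; set c := coef x; have [c3 _ cfin] := coefP x.
pose t n := (tail3 (iw w) n * cabs2 (c n))%R.
have t0 n : (0 <= t n)%R by rewrite mulr_ge0 ?cabs2_ge0 ?tail3_ge0//; exact: iw_ge0.
have bound : normw2 w (Tseq c) <= 6%:E * normw2 w c.
  rewrite !normw2E// (_ : 6%:E = 4%:E + 2%:E)//; last by rewrite -EFinD; congr EFin; ring.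
  have N0 : 0 <= wnorm (iw w) c by apply: nneseries_ge0 => n _ _; rewrite lee_fin t0.
  rewrite ge0_muleDl//.
  pose e1 k := if xpredT k then (t (2 * k)%N)%:E else 0.
  pose e2 k := if (k %% 3 == 2)%N then (t (2 * (k %/ 3)).+1)%:E else 0.
  apply: (@le_trans _ _ (4%:E * \sum_(0 <= k <oo) e1 k + 2%:E * \sum_(0 <= k <oo) e2 k)); last first.
    apply: leeD; apply: lee_wpmul2l => //.
    - by apply: (@nneseries_inj_le xpredT (fun k => 2 * k)%N (EFin \o t)) => // i j _ _; lia.
    - apply: (@nneseries_inj_le (fun k => k %% 3 == 2)%N (fun k => (2 * (k %/ 3)).+1) (EFin \o t)) => //.
      by move=> i j; rewrite !unfold_in => /eqP i3 /eqP j3; lia.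
  have e10 k : 0 <= e1 k by rewrite lee_fin t0.
  have e20 k : 0 <= e2 k by rewrite /e2; case: ifP => //; rewrite lee_fin t0.
  rewrite -!nneseriesZl// -nneseriesD; last 2 first.
  - by move=> n _ _; rewrite mule_ge0.
  - by move=> n _ _; rewrite mule_ge0.
  apply: lee_nneseries => [k _ _|k _].
    by rewrite lee_fin mulr_ge0 ?cabs2_ge0 ?tail3_ge0//; exact: iw_ge0.
  have [k3|k3] := ltnP k 3.
    by rewrite /tail3 k3 mul0r adde_ge0 ?mule_ge0.
  have iwle m a : (0 < a)%R -> (omega0 m <= a * omega0 k :> R)%R -> (iw w k <= a * iw w m)%R.
    move=> a0 h; rewrite !iwE' /w ler_pdivlMr ?omega0_gt0//.
    by rewrite ler_pdivrMl ?omega0_gt0// mulrC.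
  have om m : (m <= 2 * k)%N -> (omega0 m <= 2 * omega0 k :> R)%R.
    move=> mk; rewrite /omega0 mulrA ler_pM2r ?invr_gt0 ?pi_gt0//.
    have : (m%:R <= 2 * k%:R :> R)%R by rewrite -natrM ler_nat.
    lra.
  have t3 m : (3 <= m)%N -> tail3 (iw w) m = iw w m by move=> m3; rewrite /tail3 ltnNge m3.
  have h1 : (tail3 (iw w) k * (2 * cabs2 (c (2 * k)%N)) <= 4 * t (2 * k)%N)%R.
    have := iwle (2 * k)%N 2%R (ltr0Sn R 1) (om _ (leqnn _)).
    rewrite /t !t3//; last by lia.
    have := cabs2_ge0 (c (2 * k)%N); set A := cabs2 _ => A0 h.
    by have := ler_wpM2r A0 h; lra.
  have h2 : (k %% 3 == 2)%N -> (tail3 (iw w) k * (2 * cabs2 (c (2 * (k %/ 3)).+1)) <=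
      2 * t (2 * (k %/ 3)).+1)%R.
    move=> k32; have le1 : (omega0 (2 * (k %/ 3)).+1 <= 1 * omega0 k :> R)%R.
      rewrite mul1r /omega0 ler_pM2r ?invr_gt0 ?pi_gt0// lerD2r ler_nat; lia.
    have := iwle _ 1%R ltr01 le1.
    rewrite /t !t3//; last by lia.
    have := cabs2_ge0 (c (2 * (k %/ 3)).+1); set A := cabs2 _ => A0 h.
    by have := ler_wpM2r A0 h; lra.
  rewrite Tseq_val// /e1 /e2 /=; case: ifPn => k32.
    rewrite -!EFinM -EFinD lee_fin.
    apply: (le_trans (ler_wpM2l _ (cabs2D _ _))).
      by apply: tail3_ge0; exact: iw_ge0.
    by rewrite mulrDr lerD// h2.
  rewrite addr0 mule0 adde0 -EFinM lee_fin; apply: le_trans h1.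
  rewrite ler_wpM2l//; first by apply: tail3_ge0; exact: iw_ge0.
  by have := cabs2_ge0 (c (2 * k)%N); lra.
have Tfin : normw2 w (Tseq c) < +oo.
  apply: le_lt_trans bound _; rewrite lte_mul_pinfty//; exact: cfin.
split; last exact: bound.
have T3 n : (n < 3)%N -> Tseq c n = 0%R by move=> n3; rewrite /Tseq leqNgt n3.
split => //; apply: wnorm_holomorphic => //.
rewrite wnorm_hw.
by rewrite lte_mul_pinfty ?lee_fin ?invr_ge0 ?pi_ge0.
Qed.

(** Transfers the extra condition that guarantees holomorphy through the operator, whatever the
    weight [w] under study. *)
Lemma wnorm_hw_Tseq c : (forall n, (n < 3)%N -> c n = 0%R) ->
  wnorm hw c < +oo -> wnorm hw (Tseq c) < +oo.
Proof.
move=> c3 cfin; have pi0 := @pi_gt0 R.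
have cX : in_Xw (@omega0 R) c.
  split => //; first exact: wnorm_holomorphic.
  move: cfin; rewrite wnorm_hw; have [//|] := ltP (normw2 omega0 c) +oo.
  by rewrite leye_eq => /eqP ->; rewrite gt0_muley// lte_fin invr_gt0.
have [C /(_ (XW cX)) [/= [_ _ Tfin] _]] := omega0_T_bounded.
by rewrite wnorm_hw lte_mul_pinfty ?lee_fin ?invr_ge0 ?pi_ge0.
Qed.

Lemma hw_sum k : (3 <= k)%N -> \sum_(0 <= n <oo) (@hw R (k * 2 ^ n)%N)%:E < +oo.
Proof.
move=> k3; have pi0 := @pi_gt0 R.
rewrite (_ : \sum_(0 <= n <oo) _ = (pi^-1)%:E * \sum_(0 <= n <oo) ((omega0 (k * 2 ^ n)%N)^-1 : R)%:E).
  by rewrite lte_mul_pinfty ?lee_fin ?invr_ge0 ?pi_ge0// omega0_sum.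
rewrite -nneseriesZl; last by move=> n _; rewrite lee_fin invr_ge0 ltW ?omega0_gt0.
apply: eq_eseriesr => n _; rewrite -EFinM /omega0 invf_div natr1 mulrA mulVf ?mul1r//.
by rewrite gt_eqF.
Qed.

End omega0.

(** * The random series *)

Section random_series.
Context {R : realType}.
Local Open Scope ereal_scope.
Local Notation RR := (measurableTypeR R).
Local Notation Om := (coinT (nat * bool * nat)%type).
Local Notation Pr := (@Pr R).
Local Notation gam := (@gam R).

Definition rcoef (a : nat -> R) (n i : nat) : R := (a i.+1 * fcoef i.+1 n)%R.

Definition Yre a n : Om -> R := rsum (rcoef a n) (fun=> 0%R) n.
Definition Yim a n : Om -> R := isum (rcoef a n) (fun=> 0%R) n.

(** Every coefficient is a finite sum, so this is defined at every sample point; convergence of the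
    series becomes finiteness of a norm. *)
Definition Yseq (a : nat -> R) (u : Om) (n : nat) : R[i] :=
  if (n < 3)%N then 0%R else (Yre a n u +i* Yim a n u)%C.

Lemma Yseq_lt3 a u n : (n < 3)%N -> Yseq a u n = 0%R.
Proof. by rewrite /Yseq => ->. Qed.

Lemma measurable_Yre a n : measurable_fun setT (Yre a n : Om -> RR).
Proof. exact: measurable_rsum. Qed.

Lemma measurable_Yim a n : measurable_fun setT (Yim a n : Om -> RR).
Proof. exact: measurable_isum. Qed.

Lemma Yre_basis a n u : Yre a n u = basis_sum a (fun i => xi i.-1 false u) n.
Proof. by apply: eq_bigr => i _; rewrite mul0r addr0. Qed.

Lemma Yim_basis a n u : Yim a n u = basis_sum a (fun i => xi i.-1 true u) n.
Proof. by apply: eq_bigr => i _; rewrite mul0r subr0. Qed.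

(** An identity between coefficients, with no exceptional null set. *)
Lemma Tseq_Yseq a u n : (forall i, a (2 * i)%N = a i) ->
  Tseq (Yseq a u) n = Yseq a (shift u) n.
Proof.
move=> a2; have [n3|n3] := ltnP n 3; first by rewrite Yseq_lt3// /Tseq leqNgt n3.
rewrite Tseq_val//.
have n2 : (2 * n < 3)%N = false by lia.
have nn : (n < 3)%N = false by lia.
have e c : basis_sum a (fun i => xi i.-1 c (shift u)) n =
    basis_sum a (fun i => xi (2 * i).-1 c u) n.
  by apply: eq_bigr => i _; rewrite xi_shift; congr (_ * xi _ c u)%R; rewrite /=; lia.
rewrite /Yseq n2 nn !Yre_basis !Yim_basis !e.
rewrite -!(basis_sum_collatz a2 (fun i => xi i.-1 _ u) n3).
case: ifPn => n32; last by rewrite !addr0.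
by rewrite (_ : ((2 * (n %/ 3)).+1 < 3)%N = false)//; lia.
Qed.

Let kappa : \bar R := \int[gam]_x (x ^+ 2)%:E.

Lemma measurable_tail (rho : nat -> R) (X Y : nat -> Om -> RR) :
  (forall n, 0 <= rho n)%R ->
  (forall n, measurable_fun setT (X n)) -> (forall n, measurable_fun setT (Y n)) ->
  measurable_fun setT (fun u =>
    \sum_(0 <= n <oo) (tail3 rho n * (X n u ^+ 2 + Y n u ^+ 2))%:E).
Proof.
move=> rho0 mX mY; apply: ge0_emeasurable_sum => [n u _ _|n _].
  by rewrite lee_fin mulr_ge0 ?tail3_ge0// addr_ge0 ?sqr_ge0.
apply/measurable_EFinP; apply: measurable_funM => //.
by apply: measurable_funD; apply: measurable_funX; [exact: mX|exact: mY].
Qed.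

Lemma wnorm_YseqE rho a u : wnorm rho (Yseq a u) =
  \sum_(0 <= n <oo) (tail3 rho n * (Yre a n u ^+ 2 + Yim a n u ^+ 2))%:E.
Proof.
apply: eq_eseriesr => n _; rewrite /tail3 /Yseq.
by case: ifP => _; rewrite ?mul0r.
Qed.

Lemma measurable_wnorm_Yseq rho a : (forall n, 0 <= rho n)%R ->
  measurable_fun setT (fun u => wnorm rho (Yseq a u)).
Proof.
move=> rho0; rewrite (_ : (fun u => _) = (fun u =>
  \sum_(0 <= n <oo) (tail3 rho n * (Yre a n u ^+ 2 + Yim a n u ^+ 2))%:E)); last first.
  by apply/funext => u; exact: wnorm_YseqE.
by apply: (measurable_tail (X := Yre a) (Y := Yim a)) => // n; [exact: measurable_Yre|exact: measurable_Yim].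
Qed.

(** By Tonelli and the variance formula for finite sums; 2 [kappa] is the second moment of the
    modulus of a standard G_i, one [kappa] for each of its two parts. *)
Lemma expected_wnorm rho a : (forall n, 0 <= rho n)%R ->
  \int[Pr]_u wnorm rho (Yseq a u) <=
  (2%:E * kappa) * \sum_(0 <= i <oo) (a i.+1 ^+ 2 * bnorm rho i.+1)%:E.
Proof.
move=> rho0.
have k0 : 0 <= kappa by apply: integral_ge0 => x _; rewrite lee_fin sqr_ge0.
have kfin : kappa \is a fin_num by rewrite ge0_fin_numE//; exact: gam_sqr.
under eq_integral do rewrite wnorm_YseqE.
have mR n : measurable_fun setT (fun u => (Yre a n u ^+ 2)%:E).
  by apply/measurable_EFinP; apply: measurable_funX; exact: measurable_Yre.
have mI n : measurable_fun setT (fun u => (Yim a n u ^+ 2)%:E).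
  by apply/measurable_EFinP; apply: measurable_funX; exact: measurable_Yim.
rewrite integral_nneseries//; last 2 first.
- move=> n; apply/measurable_EFinP; apply: measurable_funM => //.
  by apply: measurable_funD; apply: measurable_funX; [exact: measurable_Yre|exact: measurable_Yim].
- by move=> n u _; rewrite lee_fin mulr_ge0 ?tail3_ge0// addr_ge0 ?sqr_ge0.
apply: (@le_trans _ _ (\sum_(0 <= n <oo)
    ((2%:E * kappa) * (tail3 rho n * \sum_(i < n) (a i.+1 * fcoef i.+1 n) ^+ 2)%:E))).
  apply: lee_nneseries => [n _ _|n _].
    by apply: integral_ge0 => u _; rewrite lee_fin mulr_ge0 ?tail3_ge0// addr_ge0 ?sqr_ge0.
  under eq_integral do rewrite EFinM EFinD.
  have p2 (X : Om -> R) u : setT u -> 0 <= (X u ^+ 2)%:E by rewrite lee_fin sqr_ge0.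
  rewrite ge0_integralZl ?lee_fin ?tail3_ge0//; last 2 first.
  - exact: emeasurable_funD.
  - by move=> u _; rewrite adde_ge0// lee_fin sqr_ge0.
  rewrite ge0_integralD//; [|exact: p2|exact: p2].
  rewrite rsum_sqr isum_sqr -/kappa -ge0_muleDl ?lee_fin ?vsum_ge0//.
  rewrite le_eqVlt; apply/orP; left; apply/eqP.
  have -> : vsum (rcoef a n) (fun=> 0%R) n = (\sum_(i < n) (a i.+1 * fcoef i.+1 n) ^+ 2)%R.
    by apply: eq_bigr => i _; rewrite expr0n addr0.
  rewrite -(fineK kfin) -!EFinD -!EFinM; congr EFin; ring.
rewrite -(fineK kfin) -EFinM nneseriesZl; last first.
  move=> n _; rewrite lee_fin mulr_ge0 ?tail3_ge0// sumr_ge0// => i _.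
  by rewrite sqr_ge0.
by apply: lee_wpmul2l; [rewrite lee_fin mulr_ge0 ?fine_ge0|exact: coef_norm_le].
Qed.

Lemma ae_finite (f : Om -> \bar R) : measurable_fun setT f -> (forall u, 0 <= f u) ->
  \int[Pr]_u f u < +oo -> Pr [set u | f u < +oo] = 1.
Proof.
move=> mf f0 fint.
have If : Pr.-integrable setT f.
  apply/integrableP; split => //.
  by under eq_integral do rewrite gee0_abs//.
have mF : measurable [set u | f u < +oo].
  by rewrite -[X in measurable X]setTI; exact: emeasurable_fun_infty_o.
have := integrable_ae measurableT If => -[N [mN N0 hN]].
have -> : [set u | f u < +oo] = ~` (~` [set u | f u < +oo]) by rewrite setCK.
rewrite probability_setC; last exact: measurableC.
rewrite (_ : Pr (~` _) = 0) ?sube0//; apply/eqP; rewrite eq_le measure_ge0 andbT -N0.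
apply: le_measure; rewrite ?inE//; first exact: measurableC.
move=> u /= nfu; apply: hN => /= /(_ I) fu; apply: nfu.
by rewrite -ge0_fin_numE.
Qed.


End random_series.

Section random_vector.
Context {R : realType}.
Local Open Scope ereal_scope.
Local Notation RR := (measurableTypeR R).
Local Notation Om := (coinT (nat * bool * nat)%type).
Local Notation Pr := (@Pr R).

Variables (w : nat -> R) (sg : nat -> R) (D : R).
Hypothesis w0 : forall n, (0 < n)%N -> (0 < w n)%R.
Hypothesis iwD : forall n, (3 <= n)%N -> (iw w n <= D)%R.
Hypothesis wT : T_bounded w.

(* Finiteness of the hw-part of the norm makes the series holomorphic on the
   disk, which the norm of X_w does not when w grows fast. *)
Definition rho (n : nat) : R := (iw w n + hw n)%R.

Hypothesis sg2 : forall i, sg (2 * i)%N = sg i.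
Hypothesis sgsum : \sum_(0 <= i <oo) (sg i.+1 ^+ 2 * bnorm rho i.+1)%:E < +oo.

Lemma rho_ge0 n : (0 <= rho n)%R.
Proof. by rewrite addr_ge0 ?iw_ge0 ?hw_ge0. Qed.

Lemma wnorm_rho c : wnorm rho c = wnorm (iw w) c + wnorm hw c.
Proof.
rewrite /wnorm -nneseriesD; last 2 first.
- by move=> n _ _; rewrite lee_fin mulr_ge0 ?cabs2_ge0// tail3_ge0//; exact: iw_ge0.
- by move=> n _ _; rewrite lee_fin mulr_ge0 ?cabs2_ge0// tail3_ge0//; exact: hw_ge0.
apply: eq_eseriesr => n _; rewrite -EFinD -mulrDl; congr (_ * _)%:E.
by rewrite /tail3; case: ifP; rewrite ?addr0.
Qed.

Lemma wnorm_rho_lty c : (wnorm rho c < +oo) <->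
  (wnorm (iw w) c < +oo /\ wnorm hw c < +oo).
Proof.
rewrite wnorm_rho; have i0 := wnorm_ge0 (@iw_ge0 R w) c.
have h0 := wnorm_ge0 (@hw_ge0 R) c.
split; last by move=> [? ?]; exact: lte_add_pinfty.
by move=> h; split; apply: le_lt_trans h; [exact: leeDl|exact: leeDr].
Qed.

Lemma in_Xw_rho c : (forall n, (n < 3)%N -> c n = 0%R) -> wnorm rho c < +oo -> in_Xw w c.
Proof.
move=> c3 /wnorm_rho_lty[ci ch]; split => //; first exact: wnorm_holomorphic.
by rewrite normw2E.
Qed.

Definition good : set Om := [set u | wnorm rho (Yseq sg u) < +oo].

Lemma measurable_good : measurable good.
Proof.
rewrite -[X in measurable X]setTI; apply: emeasurable_fun_infty_o => //.
by apply: measurable_wnorm_Yseq; exact: rho_ge0.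
Qed.

Lemma good1 : Pr good = 1.
Proof.
apply: ae_finite.
- by apply: measurable_wnorm_Yseq; exact: rho_ge0.
- by move=> u; apply: wnorm_ge0; exact: rho_ge0.
apply: le_lt_trans (expected_wnorm _ rho_ge0) _.
rewrite lte_mul_pinfty//.
- by rewrite mule_ge0// integral_ge0// => x _; rewrite lee_fin sqr_ge0.
- rewrite fin_numM// ge0_fin_numE ?gam_sqr//.
  by apply: integral_ge0 => x _; rewrite lee_fin sqr_ge0.
Qed.

Lemma good_in u : good u -> in_Xw w (Yseq sg u).
Proof. by move=> gu; apply: in_Xw_rho => // n; exact: Yseq_lt3. Qed.

(** The [iw] part of the norm is preserved by boundedness on X_w, the [hw] part by boundedness for
    [omega0]. *)
Lemma good_shift u : good u -> good (shift u).
Proof.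
move=> gu; have [C hC] := wT; have [[_ _ Ti] _] := hC (XW (good_in gu)).
have /wnorm_rho_lty[_ gh] := gu.
have -> : good (shift u) = (wnorm rho (Tseq (Yseq sg u)) < +oo).
  rewrite /good/=; congr (is_true (_ < _)); apply: eq_eseriesr => n _.
  by rewrite Tseq_Yseq.
apply/wnorm_rho_lty; split; first by rewrite -normw2E.
by apply: wnorm_hw_Tseq => // n; exact: Yseq_lt3.
Qed.

Definition Yx (u : Om) : Xw w :=
  match pselect (good u) with
  | left gu => XW (good_in gu)
  | right _ => XW (in_Xw0 w)
  end.

Lemma Yx_good u : good u -> coef (Yx u) = Yseq sg u.
Proof. by rewrite /Yx; case: pselect. Qed.

Lemma Yx_bad u : ~ good u -> Yx u = XW (in_Xw0 w).
Proof. by rewrite /Yx; case: pselect. Qed.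

Lemma coef_inj (x y : Xw w) : coef x = coef y -> x = y.
Proof.
case: x y => [c hc] [c' hc'] /= e; move: hc'; rewrite -e => hc'.
by congr XW; exact: Prop_irrelevance.
Qed.

Definition yre n (u : Om) : RR := complex.Re (coef (Yx u) n).
Definition yim n (u : Om) : RR := complex.Im (coef (Yx u) n).

Let mgood_restrict (X : Om -> RR) : measurable_fun setT X ->
  measurable_fun setT (fun u => (\1_good u * X u)%R : RR).
Proof.
by move=> mX; apply: measurable_funM => //; apply: measurable_indic; exact: measurable_good.
Qed.

Lemma yreE n : (3 <= n)%N -> yre n = (fun u => \1_good u * Yre sg n u)%R.
Proof.
move=> n3; apply/funext => u; rewrite /yre indicE; have [gu|gu] := pselect (good u).
  by rewrite (Yx_good gu) /Yseq ltnNge n3 mem_set// mul1r.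
by rewrite (Yx_bad gu) memNset// mul0r.
Qed.

Lemma yimE n : (3 <= n)%N -> yim n = (fun u => \1_good u * Yim sg n u)%R.
Proof.
move=> n3; apply/funext => u; rewrite /yim indicE; have [gu|gu] := pselect (good u).
  by rewrite (Yx_good gu) /Yseq ltnNge n3 mem_set// mul1r.
by rewrite (Yx_bad gu) memNset// mul0r.
Qed.

Lemma measurable_yre n : measurable_fun setT (yre n).
Proof.
have [n3|n3] := ltnP n 3; last by rewrite yreE//; apply: mgood_restrict; exact: measurable_Yre.
rewrite (_ : yre n = cst 0%R); first exact: measurable_cst.
by apply/funext => u; rewrite /yre; have [h _ _] := coefP (Yx u); rewrite h.
Qed.

Lemma measurable_yim n : measurable_fun setT (yim n).
Proof.
have [n3|n3] := ltnP n 3; last by rewrite yimE//; apply: mgood_restrict; exact: measurable_Yim.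
rewrite (_ : yim n = cst 0%R); first exact: measurable_cst.
by apply/funext => u; rewrite /yim; have [h _ _] := coefP (Yx u); rewrite h.
Qed.

Lemma measurable_dist_Yx (c : nat -> R[i]) :
  measurable_fun setT (fun u => normw2 w (fun n => coef (Yx u) n - c n)%R).
Proof.
rewrite (_ : (fun u => _) = (fun u => \sum_(0 <= n <oo)
    (tail3 (iw w) n * ((yre n u - complex.Re (c n)) ^+ 2 + (yim n u - complex.Im (c n)) ^+ 2))%:E)).
  apply: (measurable_tail (X := fun n u => (yre n u - complex.Re (c n))%R)
    (Y := fun n u => (yim n u - complex.Im (c n))%R)); first exact: iw_ge0.
  - by move=> n; apply: measurable_funB => //; exact: measurable_yre.
  - by move=> n; apply: measurable_funB => //; exact: measurable_yim.
apply/funext => u; rewrite normw2E//; apply: eq_eseriesr => n _.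
by congr (_ * _)%:E; rewrite /cabs2 /yre /yim; case: (coef (Yx u) n) (c n) => [a b] [a' b'].
Qed.

(* The open sets are countable unions of balls around the rational
   combinations of the f_i. *)
Lemma measurable_Yx : measurable_fun setT (Yx : Om -> XwB w).
Proof.
apply: (@measurability _ _ Om (XwB w) setT Yx (openXw (w := w))) => //.
move=> _ [U oU <-]; rewrite setTI.
pose ball (i : seq (nat * (rat * rat)) * nat) : set (Xw w) :=
  [set y | normw2 w (fun n => coef y n - comb i.1 n)%R < (i.2.+1%:R^-1)%:E].
pose B k : set Om := match unpickle k with
  | Some i => if `[< ball i `<=` U >] then Yx @^-1` ball i else set0
  | None => set0 end.
have -> : Yx @^-1` U = \bigcup_k B k.
  apply/seteqP; split => u /=; last first.
    move=> [k _]; rewrite /B; case: (unpickle k) => // i.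
    by case: asboolP => // iU; exact: iU.
  move=> Uu; have [e e0 eU] := oU _ Uu.
  (* Two points within [q] of one combination, in squared norm, are within 2 q + 2 q of each other;
     [m] is chosen to make 4 q < e. *)
  pose m := Num.truncn (4 / e)%R; pose q : R := (m.+1%:R^-1)%R.
  have q0 : (0 < q)%R by rewrite invr_gt0.
  have qe : (4 * q < e)%R.
    by rewrite /q -ltr_pdivlMr ?invr_gt0// invrK mulrC -ltr_pdivrMr// truncnS_gt.
  have cfin : wnorm (iw w) (coef (Yx u)) < +oo.
    by rewrite -normw2E//; have [_ _] := coefP (Yx u).
  have [s hs] := approx_all (@iw_ge0 R w) iwD cfin q0.
  exists (pickle (s, m)) => //; rewrite /B pickleK.
  have bu : ball (s, m) (Yx u) by rewrite /ball/= normw2E.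
  case: asboolP => // nU; exfalso; apply: nU => y; rewrite /ball/= => hy; apply: eU.
  rewrite normw2E//; apply: (wnorm_sub_lt (@iw_ge0 R w) (d := comb s) (r := q) (s := q)).
  - by rewrite -normw2E.
  - rewrite -(wnormN (iw w)); move: hs; congr (_ < _); apply: eq_eseriesr => n _.
    by rewrite opprB.
  - by move: qe; lra.
apply: bigcupT_measurable => k; rewrite /B; case: (unpickle k) => [i|]; last exact: measurable0.
case: ifP => _; last exact: measurable0.
rewrite -[X in measurable X]setTI; apply: emeasurable_fun_infty_o => //.
exact: measurable_dist_Yx.
Qed.

Definition muX : probability (XwB w) R := law Pr measurable_Yx.

Lemma muXE B : muX B = Pr (Yx @^-1` B). Proof. by []. Qed.

Lemma Tpre_good (B : set (Xw w)) u : good u -> Tpre B (Yx u) <-> B (Yx (shift u)).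
Proof.
move=> gu; have gsu := good_shift gu.
have e : coef (Yx (shift u)) = Tseq (coef (Yx u)).
  by rewrite !Yx_good//; apply/funext => n; rewrite Tseq_Yseq.
split; last by move=> Bu; exists (Yx (shift u)).
by move=> [y By yE]; rewrite (@coef_inj (Yx (shift u)) y)// yE.
Qed.

Lemma Pr_good_eq (A B : set Om) : measurable A -> measurable B ->
  (forall u, good u -> A u <-> B u) -> Pr A = Pr B.
Proof.
have GI X : measurable X -> Pr X = Pr (good `&` X).
  move=> mX; apply/eqP; rewrite eq_le; apply/andP; split; last first.
    by apply: le_measure; rewrite ?inE//; apply: measurableI => //; exact: measurable_good.
  have mg := measurable_good.
  have PGC : Pr (~` good) = 0 by rewrite probability_setC// good1 subee.
  rewrite -[leRHS]adde0 -PGC; apply: (le_trans _ (measureU2 _ _ _)); last 2 first.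
  - exact: measurableI.
  - exact: measurableC.
  apply: le_measure; rewrite ?inE//.
    by apply: measurableU; [exact: measurableI|exact: measurableC].
  by move=> u Xu; have [gu|gu] := pselect (good u); [left|right].
move=> mA mB AB; rewrite (GI A)// (GI B)//; congr (Pr _).
by apply/seteqP; split => u [gu] /AB h; split => //; exact: h.
Qed.

Lemma muX_invariant : T_invariant muX.
Proof.
move=> B mB; rewrite !muXE.
have mYB : measurable (Yx @^-1` B).
  exact: (measurable_preimage measurable_Yx mB).
have mS : measurable (shift @^-1` (Yx @^-1` B)).
  exact: (measurable_preimage measurable_shift_coin mYB).
have mg := measurable_good.
rewrite -(@shift_law R _ mYB); apply: Pr_good_eq => //; last first.
  by move=> u gu; exact: Tpre_good.
(* Off [good] the vector is constantly 0, so there the pullback is everything or nothing; on [good]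
   it is given by the shift. *)
rewrite (_ : _ @^-1` _ = (good `&` shift @^-1` (Yx @^-1` B)) `|`
    (if `[< Tpre B (XW (in_Xw0 w)) >] then ~` good else set0)).
  apply: measurableU; first exact: measurableI.
  by case: ifP => _; [exact: measurableC|exact: measurable0].
apply/seteqP; split => u /=.
  have [gu|gu] := pselect (good u).
    by move=> /(Tpre_good _ gu) h; left.
  by rewrite Yx_bad// => h; right; rewrite asboolT.
by case=> [[gu h]|]; [exact/Tpre_good|case: asboolP => // h gu; rewrite Yx_bad].
Qed.

Lemma muX_ergodic : T_ergodic muX.
Proof.
split; first exact: muX_invariant.
move=> B mB BT; rewrite !muXE.
apply: (@shift_ergodic R good (Yx @^-1` B)).
- exact: measurable_good.
- exact: good1.
- exact: (measurable_preimage measurable_Yx mB).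
- exact: good_shift.
- by move=> u gu /=; rewrite -[X in X (Yx u)]BT; exact: Tpre_good.
Qed.

End random_vector.

(** * Inner products and Gaussianity *)

Section inner_product.
Context {R : realType}.
Implicit Types (F : nat -> nat -> R) (L B : nat -> R).

(** Dominated convergence for the counting measure. *)
Lemma dominated_series F L B :
  (forall N i, 0 <= F N i <= B i) ->
  (\sum_(0 <= i <oo) (B i)%:E < +oo)%E ->
  (forall i, F N i @[N --> \oo] --> L i) ->
  (\sum_(0 <= i <oo) (F N i)%:E @[N --> \oo] --> \sum_(0 <= i <oo) (L i)%:E)%E.
Proof.
move=> FB Bfin FL.
have B0 i : 0 <= B i by have /andP[h1 h2] := FB 0%N i; exact: le_trans h2.
have F0 N i : 0 <= F N i by have /andP[] := FB N i.
have L0 i : 0 <= L i.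
  by apply: (@closed_cvg _ _ _ _ _ (fun x : R => 0 <= x) (@closed_ge _ 0) _ _ (FL i)); exact: nearW.
rewrite (_ : (fun N => _) = (fun N => \int[counting]_i (F N i)%:E)%E); last first.
  by apply/funext => N; rewrite ge0_integral_count// => i; rewrite lee_fin.
rewrite -(@ge0_integral_count _ (fun i => (L i)%:E)); last by move=> i; rewrite lee_fin.
apply: (dominated_cvg _ _ _ (g := EFin \o B)) => //.
- by move=> i _; apply: cvg_EFin; [exact: nearW|exact: FL].
- apply/integrableP; split => //.
  rewrite ge0_integral_count//; apply: le_lt_trans Bfin.
  by apply: lee_nneseries => [i _ _|i _]; rewrite /= ?lee_fin ?ger0_norm.
- by move=> N i _; rewrite lee_fin ger0_norm//; have /andP[] := FB N i.
Qed.

Variable w : nat -> R.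
Hypothesis w0 : forall n, (0 < n)%N -> 0 < w n.
Implicit Types x y : Xw w.

Lemma ReM_conj (z z' : R[i]) : complex.Re (z * z'^*) =
  complex.Re z * complex.Re z' + complex.Im z * complex.Im z'.
Proof. by case: z z' => [a b] [a' b'] /=; ring. Qed.

Lemma ImM_conj (z z' : R[i]) : complex.Im (z * z'^*) =
  complex.Im z * complex.Re z' - complex.Re z * complex.Im z'.
Proof. by case: z z' => [a b] [a' b'] /=; ring. Qed.

Lemma abs_summable_cvg (t : nat -> R) y x :
  (forall n, (3 <= n)%N -> `|t n| <= (cabs2 (coef y n) + cabs2 (coef x n)) / w n) ->
  \big[+%R/0]_(3 <= n < N) t n @[N --> \oo] --> \big[+%R/0]_(3 <= n <oo) t n.
Proof.
move=> tb; pose t' n := if (3 <= n)%N then t n else 0.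
have E N : \sum_(3 <= n < N) t n = series t' N.
  rewrite /series/= [LHS](@big_nat_widenl _ _ _ _ 0)//= big_mkcond.
  by apply: eq_bigr.
rewrite (_ : (fun N => \big[+%R/0]_(3 <= n < N) t n) = series t'); last exact/funext.
suff /normed_cvg : cvgn [normed series t'].
  by move=> /cvgP.
pose M := fine (normw2 w (coef y) + normw2 w (coef x)).
have [_ _ yfin] := coefP y; have [_ _ xfin] := coefP x.
have ge0w c : (forall n, (3 <= n)%N -> 0 <= (cabs2 (c n) / w n)%:E)%E.
  by move=> n n3; rewrite lee_fin divr_ge0 ?cabs2_ge0// ltW// w0//; exact: leq_trans n3.
have n0 c : (0 <= normw2 w c)%E by apply: nneseries_ge0 => n n3 _; exact: ge0w.
apply: nondecreasing_is_cvgn.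
  by apply: nondecreasing_series => n _ _; exact: normr_ge0.
exists M => _ [N _ <-].
rewrite -lee_fin /M fineK; last by rewrite ge0_fin_numE ?lte_add_pinfty// adde_ge0.
rewrite /normw2 -nneseriesD; [|by move=> n n3 _; exact: ge0w..].
apply: le_trans (nneseries_lim_ge N _); last by move=> n n3 _; rewrite adde_ge0 ?ge0w.
rewrite /series/= -sumEFin.
rewrite [leRHS](@big_nat_widenl _ _ _ _ 0)//= [leRHS]big_mkcond/=.
apply: lee_sum => n _; rewrite /t'; case: ifPn => n3; last by rewrite normr0.
by rewrite -EFinD -mulrDl lee_fin tb.
Qed.

Lemma two_mul_le (a b : R) : `|a * b| <= (a ^+ 2 + b ^+ 2) / 2.
Proof.
by rewrite ler_norml; have := sqr_ge0 (a - b); have := sqr_ge0 (a + b); lra.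
Qed.

Lemma ipRe_cvg y x : \big[+%R/0]_(3 <= n < N)
  (complex.Re (coef y n * (coef x n)^*) / w n) @[N --> \oo] --> ipRe y x.
Proof.
apply: (@abs_summable_cvg _ y x) => n n3; have wn : 0 < w n by apply: w0; exact: leq_trans n3.
rewrite normrM normfV (gtr0_norm wn) ler_pM2r ?invr_gt0// ReM_conj.
case: (coef y n) (coef x n) => [a b] [a' b']; rewrite /cabs2/=.
apply: le_trans (ler_normD _ _) _.
by have := two_mul_le a a'; have := two_mul_le b b'; have := sqr_ge0 a;
  have := sqr_ge0 b; have := sqr_ge0 a'; have := sqr_ge0 b'; lra.
Qed.

Lemma ipIm_cvg y x : \big[+%R/0]_(3 <= n < N)
  (complex.Im (coef y n * (coef x n)^*) / w n) @[N --> \oo] --> ipIm y x.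
Proof.
apply: (@abs_summable_cvg _ y x) => n n3; have wn : 0 < w n by apply: w0; exact: leq_trans n3.
rewrite normrM normfV (gtr0_norm wn) ler_pM2r ?invr_gt0// ImM_conj.
case: (coef y n) (coef x n) => [a b] [a' b']; rewrite /cabs2/=.
apply: le_trans (ler_normB _ _) _.
by have := two_mul_le a b'; have := two_mul_le b a'; have := sqr_ge0 a;
  have := sqr_ge0 b; have := sqr_ge0 a'; have := sqr_ge0 b'; lra.
Qed.

End inner_product.

Section gaussian.
Context {R : realType}.
Local Notation RR := (measurableTypeR R).
Local Notation Om := (coinT (nat * bool * nat)%type).
Local Notation Pr := (@Pr R).
Local Notation gam2 := (@gam2 R).

Variables (w : nat -> R) (sg : nat -> R).
Hypothesis w0 : forall n, (0 < n)%N -> 0 < w n.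
Hypothesis sgsum : (\sum_(0 <= i <oo) (sg i.+1 ^+ 2 * bnorm (rho w) i.+1)%:E < +oo)%E.

Variable x : Xw w.
Local Notation Yx := (@Yx R w sg w0).

Definition wRe n : R := complex.Re (coef x n) / w n.
Definition wIm n : R := complex.Im (coef x n) / w n.

(** For [U] equal to [wRe] and [wIm] this yields a and b such that a - ib is the coefficient of
    G_(i+1) in the inner product cut at N, matching [rsum] and [isum]. *)
Definition acoef (U : nat -> R) (N i : nat) : R :=
  \sum_(3 <= n < N) sg i.+1 * fcoef i.+1 n * U n.

Definition cut (U : nat -> R) (N m : nat) : R :=
  if (3 <= m < N)%N then U m else 0.

Lemma acoefE U N i : acoef U N i = sg i.+1 * (cut U N i.+1 - cut U N (nxt i.+1)).
Proof.
rewrite /acoef; under eq_bigr do rewrite -mulrA.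
rewrite -mulr_sumr; congr (_ * _).
under eq_bigr do rewrite /fcoef mulrBl; rewrite sumrB.
have pick m : \sum_(3 <= n < N) (n == m)%:R * U n = cut U N m.
  rewrite /cut; case: ifPn => mN.
    rewrite (bigD1_seq m)/= ?mem_index_iota ?iota_uniq// eqxx mul1r big1 ?addr0//.
    by move=> n /negbTE ->; rewrite mul0r.
  rewrite big1_seq// => n /=; rewrite mem_index_iota => nN.
  by rewrite (_ : (n == m) = false) ?mul0r//; apply/eqP => nm; rewrite -nm nN in mN.
by rewrite !pick.
Qed.

Lemma cut_sum N (c : bool) u (U : nat -> R) :
  \sum_(i < N) acoef U N i * xi i c u =
  \sum_(3 <= n < N) (\sum_(i < n) rcoef sg n i * xi i c u) * U n.
Proof.
under eq_bigr do rewrite /acoef mulr_suml.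
rewrite exchange_big/= big_nat_cond [RHS]big_nat_cond.
apply: eq_bigr => n /andP[/andP[n3 nN] _]; rewrite mulr_suml.
rewrite (big_ord_widen_cond N xpredT (fun i => rcoef sg n i * xi i c u * U n) (ltnW nN))/=.
rewrite [RHS]big_mkcond; apply: eq_bigr => i _.
case: ifPn => ni; first by rewrite /rcoef; ring.
by rewrite fcoef_gt// ?mulr0 ?mul0r// ltnS leqNgt.
Qed.

Lemma YreE n u : Yre sg n u = \sum_(i < n) rcoef sg n i * xi i false u.
Proof. by apply: eq_bigr => i _; rewrite mul0r addr0. Qed.

Lemma YimE n u : Yim sg n u = \sum_(i < n) rcoef sg n i * xi i true u.
Proof. by apply: eq_bigr => i _; rewrite mul0r subr0. Qed.

Lemma rsum_partial N u : good w sg u ->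
  \sum_(3 <= n < N) (complex.Re (coef (Yx u) n * (coef x n)^*) / w n) =
  rsum (acoef wRe N) (acoef wIm N) N u.
Proof.
move=> gu; rewrite /rsum big_split/= !cut_sum -big_split/= big_nat_cond [RHS]big_nat_cond.
apply: eq_bigr => n /andP[/andP[n3 nN] _].
rewrite ReM_conj -[complex.Re (coef (Yx u) n)]/(yre sg w0 n u).
rewrite -[complex.Im (coef (Yx u) n)]/(yim sg w0 n u) yreE// yimE// indicE mem_set// !mul1r.
by rewrite /wRe /wIm YreE YimE !mulrA -mulrDl.
Qed.

Lemma isum_partial N u : good w sg u ->
  \sum_(3 <= n < N) (complex.Im (coef (Yx u) n * (coef x n)^*) / w n) =
  isum (acoef wRe N) (acoef wIm N) N u.
Proof.
move=> gu; rewrite /isum sumrB !cut_sum -sumrB big_nat_cond [RHS]big_nat_cond.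
apply: eq_bigr => n /andP[/andP[n3 nN] _].
rewrite ImM_conj -[complex.Re (coef (Yx u) n)]/(yre sg w0 n u).
rewrite -[complex.Im (coef (Yx u) n)]/(yim sg w0 n u) yreE// yimE// indicE mem_set// !mul1r.
by rewrite /wRe /wIm YreE YimE !mulrA -mulrBl.
Qed.

Let X2 : R := fine (wnorm (iw w) (coef x)).

Lemma weight_le m : (3 <= m)%N -> wRe m ^+ 2 + wIm m ^+ 2 <= iw w m * X2.
Proof.
move=> m3; have wm : 0 < w m by apply: w0; exact: leq_trans m3.
have xfin : (wnorm (iw w) (coef x) < +oo)%E by rewrite -normw2E//; have [_ _] := coefP x.
have t0 n : (0 <= (tail3 (iw w) n * cabs2 (coef x n))%:E)%E.
  by rewrite lee_fin mulr_ge0 ?cabs2_ge0// tail3_ge0//; exact: iw_ge0.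
have le1 : tail3 (iw w) m * cabs2 (coef x m) <= X2.
  rewrite -lee_fin /X2 fineK; first exact: (nneseries_term m t0).
  by rewrite ge0_fin_numE// wnorm_ge0//; exact: iw_ge0.
apply: le_trans (ler_wpM2l (iw_ge0 w m) le1).
rewrite /tail3 ltnNge m3/= iwE//; last exact: leq_trans m3.
by rewrite le_eqVlt; apply/orP; left; apply/eqP; rewrite /wRe /wIm /cabs2; field; rewrite gt_eqF.
Qed.

(** Padding with 0 turns the variance of the N-th partial sum into a series over all i, to which
    dominated convergence applies. *)
Definition varterm N i : R :=
  if (i < N)%N then acoef wRe N i ^+ 2 + acoef wIm N i ^+ 2 else 0.

Lemma varterm_le N i : 0 <= varterm N i <=
  2 * X2 * (sg i.+1 ^+ 2 * bnorm (rho w) i.+1).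
Proof.
have X20 : 0 <= X2 by rewrite fine_ge0// wnorm_ge0//; exact: iw_ge0.
have B0 : 0 <= bnorm (rho w) i.+1 by apply: bnorm_ge0; exact: rho_ge0.
have rhs0 : 0 <= 2 * X2 * (sg i.+1 ^+ 2 * bnorm (rho w) i.+1).
  by apply: mulr_ge0; [exact: mulr_ge0|rewrite mulr_ge0 ?sqr_ge0].
rewrite /varterm; case: ifP => _; last by rewrite lexx.
rewrite addr_ge0 ?sqr_ge0//= !acoefE !exprMn -mulrDr.
rewrite [leRHS](_ : _ = sg i.+1 ^+ 2 * (2 * X2 * bnorm (rho w) i.+1)); last by ring.
rewrite ler_wpM2l ?sqr_ge0//.
have cutle m : cut wRe N m ^+ 2 + cut wIm N m ^+ 2 <= tail3 (rho w) m * X2.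
  rewrite /cut /tail3; case: (leqP 3 m) => m3 /=; last by rewrite expr0n/= addr0 mul0r.
  have h : iw w m * X2 <= rho w m * X2 by rewrite ler_wpM2r// lerDl hw_ge0.
  case: ifP => _; first exact: le_trans (weight_le m3) h.
  by rewrite expr0n/= addr0 mulr_ge0// rho_ge0.
have sq (a b : R) : (a - b) ^+ 2 <= 2 * a ^+ 2 + 2 * b ^+ 2.
  by have := sqr_ge0 (a + b); lra.
have := sq (cut wRe N i.+1) (cut wRe N (nxt i.+1)).
have := sq (cut wIm N i.+1) (cut wIm N (nxt i.+1)).
have := cutle i.+1; have := cutle (nxt i.+1); rewrite /bnorm; lra.
Qed.

Lemma vsum_cvg : exists2 s : R, 0 <= s &
  Num.sqrt (vsum (acoef wRe N) (acoef wIm N) N) @[N --> \oo] --> s.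
Proof.
pose B i := 2 * X2 * (sg i.+1 ^+ 2 * bnorm (rho w) i.+1).
have X20 : 0 <= X2 by rewrite fine_ge0// wnorm_ge0//; exact: iw_ge0.
have Bfin : (\sum_(0 <= i <oo) (B i)%:E < +oo)%E.
  rewrite /B; under eq_eseriesr do rewrite EFinM.
  rewrite nneseriesZl; last first.
    by move=> i _; rewrite lee_fin mulr_ge0 ?sqr_ge0// bnorm_ge0//; exact: rho_ge0.
  by rewrite lte_mul_pinfty// lee_fin mulr_ge0.
(* Once N reaches [N0 i], the cut no longer touches f_(i+1), and the i-th term is constant. *)
pose N0 i := (nxt i.+1).+1.
have cutN U i N m : (m < N0 i)%N -> (N0 i <= N)%N -> cut U N m = cut U (N0 i) m.
  by move=> mi iN; rewrite /cut mi (leq_trans mi iN).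
have Fcvg i : varterm N i @[N --> \oo] --> varterm (N0 i) i.
  apply: cvg_near_cst; near=> N.
  have iN : (N0 i <= N)%N by near: N; exact: nbhs_infty_ge.
  have i1 : (i.+1 < N0 i)%N by rewrite ltnS ltnW// nxt_gt.
  rewrite /varterm (ltnW i1) (leq_trans (ltnW i1) iN) !acoefE.
  by rewrite !(cutN _ _ _ _ i1 iN) !(cutN _ _ _ (nxt i.+1) (leqnn _) iN).
have vE N : (\sum_(0 <= i <oo) (varterm N i)%:E = (vsum (acoef wRe N) (acoef wIm N) N)%:E)%E.
  rewrite (nneseries_split _ N); last by move=> i _; rewrite lee_fin; have /andP[] := varterm_le N i.
  rewrite add0n [X in (_ + X)%E]eseries0 ?adde0; last first.
    by move=> i Ni _; rewrite /varterm ltnNge Ni.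
  rewrite big_mkord sumEFin; congr EFin; apply: eq_bigr => i _.
  by rewrite /varterm ltn_ord.
have := dominated_series varterm_le Bfin Fcvg.
rewrite (_ : (fun N => _) = (fun N => (vsum (acoef wRe N) (acoef wIm N) N)%:E)); last exact/funext.
set V := (\sum_(0 <= i <oo) _)%E => cV.
have V0 : (0 <= V)%E.
  by apply: nneseries_ge0 => i _ _; rewrite lee_fin; have /andP[] := varterm_le (N0 i) i.
have Vfin : V \is a fin_num.
  rewrite ge0_fin_numE//; apply: le_lt_trans Bfin; apply: lee_nneseries => [i _ _|i _].
    by rewrite lee_fin; have /andP[] := varterm_le (N0 i) i.
  by rewrite lee_fin; have /andP[] := varterm_le (N0 i) i.
exists (Num.sqrt (fine V)); first exact: sqrtr_ge0.
have cv : vsum (acoef wRe N) (acoef wIm N) N @[N --> \oo] --> fine V.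
  by move: cV; rewrite -(fineK Vfin) => /fine_cvgP[_].
exact: (continuous_cvg _ (@sqrt_continuous R (fine V)) cv).
Unshelve. all: by end_near. Qed.

(** The truncated inner products agree almost surely with finite Gaussian sums, so they have the
    joint law of [sN N] times a standard Gaussian of the plane. Both sides converge pointwise. *)
Lemma Yx_gaussian : exists2 s : R, 0 <= s &
  forall A B : set R, measurable A -> measurable B ->
    Pr [set u | A (ipRe (Yx u) x) /\ B (ipIm (Yx u) x)] = (gauss s A * gauss s B)%E.
Proof.
have [s s0 sE] := vsum_cvg; exists s => // A B mA mB.
pose XN N (u : Om) : RR := \sum_(3 <= n < N) (complex.Re (coef (Yx u) n * (coef x n)^*) / w n).
pose YN N (u : Om) : RR := \sum_(3 <= n < N) (complex.Im (coef (Yx u) n * (coef x n)^*) / w n).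
pose sN N := Num.sqrt (vsum (acoef wRe N) (acoef wIm N) N).
have mXN N : measurable_fun setT (XN N).
  apply: measurable_sum => n; rewrite (_ : (fun u => _) = (fun u : Om =>
    (yre sg w0 n u * complex.Re (coef x n) + yim sg w0 n u * complex.Im (coef x n)) * (w n)^-1 : R)).
    apply: measurable_funM => //; apply: measurable_funD; apply: measurable_funM => //.
      exact: measurable_yre.
    exact: measurable_yim.
  by apply/funext => u; rewrite ReM_conj.
have mYN N : measurable_fun setT (YN N).
  apply: measurable_sum => n; rewrite (_ : (fun u => _) = (fun u : Om =>
    (yim sg w0 n u * complex.Re (coef x n) - yre sg w0 n u * complex.Im (coef x n)) * (w n)^-1 : R)).
    apply: measurable_funM => //; apply: measurable_funB; apply: measurable_funM => //.
      exact: measurable_yim.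
    exact: measurable_yre.
  by apply/funext => u; rewrite ImM_conj.
have mz1 : measurable_fun setT (fun z : RR * RR => z.1) by exact: measurable_fst.
have mz2 : measurable_fun setT (fun z : RR * RR => z.2) by exact: measurable_snd.
have prodE t (C C' : set RR) : measurable C -> measurable C' ->
    gam2 [set z | C (t * z.1) /\ C' (t * z.2)] = (gaus t C * gaus t C')%E.
  move=> mC mC'; have mt := measurable_mul t.
  exact: (gam2_rect (measurable_preimage mt mC) (measurable_preimage mt mC')).
rewrite !gauss_gaus// -prodE//.
apply: (@pair_law_lim _ _ _ _ _ Pr gam2 XN YN
  (fun N z => sN N * z.1) (fun N z => sN N * z.2)
  (fun u => ipRe (Yx u) x) (fun u => ipIm (Yx u) x)
  (fun z => s * z.1) (fun z => s * z.2)) => //.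
- by move=> N; exact: (measurableT_comp (measurable_mul _) mz1).
- by move=> N; exact: (measurableT_comp (measurable_mul _) mz2).
- move=> N C C' mC mC'; rewrite prodE// -sum_law//.
  have mr := measurable_rsum (acoef wRe N) (acoef wIm N) N.
  have mi := measurable_isum (acoef wRe N) (acoef wIm N) N.
  apply: (Pr_good_eq sgsum).
  + exact: measurableI (measurable_preimage (mXN N) mC) (measurable_preimage (mYN N) mC').
  + exact: measurableI (measurable_preimage mr mC) (measurable_preimage mi mC').
  + by move=> u gu /=; rewrite /XN /YN rsum_partial// isum_partial.
- by move=> u; exact: ipRe_cvg.
- by move=> u; exact: ipIm_cvg.
- by move=> z; apply: cvgM => //; exact: cvg_cst.
- by move=> z; apply: cvgM => //; exact: cvg_cst.
Qed.

End gaussian.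

(** * Full support *)

Section support.
Context {R : realType}.
Local Notation RR := (measurableTypeR R).
Local Notation Om := (coinT (nat * bool * nat)%type).
Local Notation Pr := (@Pr R).
Local Notation gam := (@gam R).

(** Collects repeated indices into one coefficient each; the length M stays free so that it can also
    exceed the threshold for small tails. *)
Lemma comb_coord (s : seq (nat * (rat * rat))) : exists (al : nat -> R[i]) (K : nat),
  forall M, (K <= M)%N -> forall n, (3 <= n)%N ->
    comb s n = \sum_(i < M) al i * (fcoef i.+1 n)%:C%C.
Proof.
elim: s => [|e s [al [K h]]].
  exists (fun=> 0), 0%N => M _ n n3; rewrite comb_nil big1// => i _; exact: mul0r.
exists (fun i => (if i == e.1 then ratc e.2 else 0) + al i), (maxn K e.1.+1) => M.
rewrite geq_max => /andP[KM eM] n n3.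
under eq_bigr do rewrite mulrDl; rewrite big_split/= -(h M KM n n3).
rewrite -cat1s comb_cat; congr (_ + _).
rewrite /comb ltnNge n3/= big_seq1 (bigD1 (Ordinal eM))//= eqxx big1 ?addr0//.
by move=> i /negbTE; rewrite -val_eqE/= => ->; rewrite mul0r.
Qed.

Lemma small_comb (rho a : nat -> R) (M : nat) (e : R) : (forall n, 0 <= rho n) -> 0 < e ->
  exists2 d : R, 0 < d & forall x y : nat -> R,
    (forall i, (i < M)%N -> `|x i| < d /\ `|y i| < d) ->
    (wnorm rho (fun n => (\sum_(i < M) ((a i * x i) +i* (a i * y i))%C * (fcoef i.+1 n)%:C%C)%R) < e%:E)%E.
Proof.
move=> rho0; elim: M e => [|M ih] e e0.
  exists 1 => // x y _; rewrite /wnorm eseries0 ?lte_fin// => n _ _.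
  by rewrite big_ord0 cabs20 mulr0.
have [d d0 hd] := ih _ (ltac:(by rewrite divr_gt0) : 0 < e / 4).
pose B := bnorm rho M.+1; have B0 : 0 <= B by exact: bnorm_ge0.
pose C := 2 * a M ^+ 2 * B; have C0 : 0 <= C.
  by rewrite /C mulr_ge0// mulr_ge0// sqr_ge0.
(* Below 1 a square is at most its root, so a bound linear in e suffices; [C + 1] avoids division by
   0. *)
pose d1 := Num.min 1 (e / 4 / (C + 1)).
have q0 : 0 < e / 4 / (C + 1) by rewrite !divr_gt0// ltr_wpDl.
have d10 : 0 < d1 by rewrite /d1 lt_min ltr01.
exists (Num.min d d1) => [|x y xy]; first by rewrite lt_min d0.
have dx i : (i < M)%N -> `|x i| < d /\ `|y i| < d.
  by move=> iM; have := xy i (ltnW iM); rewrite !lt_min => -[/andP[-> _] /andP[-> _]].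
have := xy M (ltnSn M); rewrite !lt_min => -[/andP[_ /andP[x1 x2]] /andP[_ /andP[y1 y2]]].
rewrite (@eq_wnorm _ rho _ (fun n => \sum_(i < M) ((a i * x i) +i* (a i * y i))%C * (fcoef i.+1 n)%:C%C
   + ((a M * x M) +i* (a M * y M))%C * (fcoef M.+1 n)%:C%C)); last first.
  by move=> n _; rewrite big_ord_recr.
apply: le_lt_trans (wnormD rho0 _ _) _; rewrite wnorm_basis//.
apply: (@lt_le_trans _ _ (2%:E * (e / 4)%:E + 2%:E * (e / 4)%:E)%E); last first.
  by rewrite -!EFinM -EFinD lee_fin; lra.
apply: lteD; first by rewrite lte_pmul2l ?fin_numE//; exact: hd.
rewrite -!EFinM lte_fin ltr_pM2l//.
have sq (t : R) : `|t| < 1 -> `|t| < e / 4 / (C + 1) -> t ^+ 2 <= e / 4 / (C + 1).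
  move=> t1 t2; rewrite -real_normK ?num_real// expr2.
  by rewrite -[leRHS]mul1r ler_pM// ltW.
have xs := sq _ x1 x2; have ys := sq _ y1 y2.
rewrite -/B /cabs2/= !exprMn -mulrDr.
apply: (@le_lt_trans _ _ (a M ^+ 2 * (2 * (e / 4 / (C + 1))) * B)).
  by rewrite ler_wpM2r// ler_wpM2l ?sqr_ge0//; lra.
rewrite (_ : _ * B = e / 4 / (C + 1) * C); last by rewrite /C; ring.
rewrite mulrAC ltr_pdivrMr ?ltr_wpDl// ltr_pM2l ?divr_gt0//; lra.
Qed.

Definition box (x y : nat -> R) (d : R) (M : nat) : set Om :=
  [set u | forall i, (i < M)%N -> `|xi i false u - x i| < d /\ `|xi i true u - y i| < d].

Let box1 (x y : nat -> R) (d : R) M : set Om :=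
  [set u | `|xi M false u - x M| < d /\ `|xi M true u - y M| < d].

Lemma boxS x y d M : box x y d M.+1 = box x y d M `&` box1 x y d M.
Proof.
apply/seteqP; split => u /=.
  by move=> h; split; [move=> i iM; apply: h; exact: ltnW|exact: h].
move=> [h1 h2] i; rewrite ltnS leq_eqVlt => /orP[/eqP -> //|]; exact: h1.
Qed.

Let itvE (x d t : R) : (`|t - x| < d) = (t \in `]x - d, x + d[).
Proof. by rewrite in_itv/= ltr_distl. Qed.

Let box1E x y d M : box1 x y d M =
  [set u | (`]x M - d, x M + d[ `*` `]y M - d, y M + d[)%classic (xi M false u, xi M true u)].
Proof. by apply/seteqP; split => u; rewrite /box1/= -!itvE. Qed.

Let mrect (x y d : R) : measurable ((`]x - d, x + d[ `*` `]y - d, y + d[)%classic : set (RR * RR)).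
Proof. by apply: measurableX; exact: measurable_itv. Qed.

Lemma measurable_box x y d M : measurable (box x y d M).
Proof.
elim: M => [|M ih].
  by rewrite (_ : box _ _ _ _ = setT)//; apply/seteqP; split.
rewrite boxS; apply: measurableI => //; rewrite box1E.
have mp : measurable_fun setT (fun u : Om => (xi M false u, xi M true u) : RR * RR).
  by apply: measurable_fun_pair; exact: measurable_xi.
exact: (measurable_preimage mp (mrect _ _ _)).
Qed.

Lemma box_dep x y d M (u v : Om) : {in [pred i : nat * bool * nat | (i.1.1 < M)%N], u =1 v} ->
  box x y d M u -> box x y d M v.
Proof.
move=> uv h i iM; have e c : xi i c v = xi i c u :> R.
  by apply: xi_dep => k; rewrite uv.
by rewrite !e; exact: h.
Qed.

Lemma box_gt0 x y d M : 0 < d -> (0 < Pr (box x y d M))%E.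
Proof.
move=> d0; elim: M => [|M ih].
  by rewrite (_ : box _ _ _ _ = setT) ?probability_setT//; apply/seteqP; split.
rewrite boxS (fair_indep (@Pr_fair R) (D := [pred i : nat * bool * nat | (i.1.1 < M)%N])).
- rewrite mule_gt0// box1E xi_pair_law//.
  rewrite gam2_rect; [|exact: measurable_itv..].
  by rewrite mule_gt0//; apply: gam_itv_gt0; lra.
- exact: measurable_box.
- have mp : measurable_fun setT (fun u : Om => (xi M false u, xi M true u) : RR * RR).
    by apply: measurable_fun_pair; exact: measurable_xi.
  rewrite box1E; exact: (measurable_preimage mp (mrect _ _ _)).
- exact: box_dep.
- move=> u v uv; rewrite /box1/=.
  by rewrite !(@xi_dep _ _ _ v u)// => k; rewrite uv// inE/= ltnn.
Qed.

(** Zeroing the first weights makes the tail of the series another instance of [Yseq], with the same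
    moment bound. *)
Definition above (a : nat -> R) (M i : nat) : R := if (M < i)%N then a i else 0.

Lemma Yseq_split (a : nat -> R) M u n : (3 <= n)%N ->
  Yseq a u n = \sum_(i < M) ((a i.+1 * xi i false u) +i* (a i.+1 * xi i true u))%C * (fcoef i.+1 n)%:C%C
    + Yseq (above a M) u n.
Proof.
move=> n3; rewrite /Yseq ltnNge n3/=.
pose z i : R[i] := (xi i false u +i* xi i true u)%C.
have E b : (Yre b n u +i* Yim b n u)%C = \sum_(i < n) (rcoef b n i)%:C%C * z i.
  rewrite YreE YimE; elim/big_rec3: _ => [//|i p q r _ <-].
  by rewrite /z /real_complex_def; simpc.
rewrite !E.
pose N := maxn M n.
have W b : \sum_(i < n) (rcoef b n i)%:C%C * z i = \sum_(i < N) (rcoef b n i)%:C%C * z i.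
  rewrite (big_ord_widen N (fun i => (rcoef b n i)%:C%C * z i)) ?leq_maxr//.
  rewrite big_mkcond; apply: eq_bigr => i _; case: ltnP => // ni.
  by rewrite /rcoef fcoef_gt// mulr0 mul0r.
rewrite !W (big_ord_widen N (fun i => ((a i.+1 * xi i false u) +i* (a i.+1 * xi i true u))%C
   * (fcoef i.+1 n)%:C%C)) ?leq_maxl// [X in _ = X + _]big_mkcond -big_split/=.
apply: eq_bigr => i _; rewrite /rcoef /above ltnS.
case: (ltnP i M) => iM; last by rewrite add0r.
rewrite mul0r mul0r addr0 /z /real_complex_def; simpc.
by congr (_ +i* _)%C; ring.
Qed.

Lemma above_dep a M (u v : Om) : {in predC [pred i : nat * bool * nat | (i.1.1 < M)%N], u =1 v} ->
  Yseq (above a M) u = Yseq (above a M) v.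
Proof.
move=> uv; apply/funext => n; rewrite /Yseq; case: ifP => // _.
rewrite !YreE !YimE; congr (_ +i* _)%C; apply: eq_bigr => i _;
  rewrite /rcoef /above ltnS; case: leqP => Mi; rewrite ?mul0r//;
  by rewrite (@xi_dep _ _ _ u v)// => k; rewrite uv// inE/= -leqNgt.
Qed.

(** Markov's inequality: were the probability 0, the expected norm would be at least e, but it is
    bounded by a constant times the tail of a convergent series. *)
Lemma above_small (rho a : nat -> R) (e : R) : (forall n, 0 <= rho n) -> 0 < e ->
  (\sum_(0 <= i <oo) (a i.+1 ^+ 2 * bnorm rho i.+1)%:E < +oo)%E ->
  \forall M \near \oo, (0 < Pr [set u | wnorm rho (Yseq (above a M) u) < e%:E])%E.
Proof.
move=> rho0 e0 afin.
have t0 i : (0 <= (a i.+1 ^+ 2 * bnorm rho i.+1)%:E)%E.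
  by rewrite lee_fin mulr_ge0 ?sqr_ge0 ?bnorm_ge0.
have := nneseries_tail_cvg afin (fun i _ => t0 i).
pose kp := (\int[gam]_x (x ^+ 2)%:E)%E.
have kp0 : (0 <= kp)%E by apply: integral_ge0 => x _; rewrite lee_fin sqr_ge0.
have kpfin : kp \is a fin_num by rewrite ge0_fin_numE//; exact: gam_sqr.
have kq0 : 0 <= fine kp by rewrite fine_ge0.
(* Chosen so that 2 [kp] q < e, also when [kp] vanishes. *)
pose q := e / (4 * (fine kp + 1)).
have q0 : 0 < q by rewrite divr_gt0// mulr_gt0// ltr_wpDl.
move=> /fine_cvgP[h1 /cvgr_lt /(_ q q0) h2].
near=> M.
have T1 : ((\sum_(M <= i <oo) (a i.+1 ^+ 2 * bnorm rho i.+1)%:E) \is a fin_num)%E by near: M.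
have T2 : ((\sum_(M <= i <oo) (a i.+1 ^+ 2 * bnorm rho i.+1)%:E) < q%:E)%E.
  by rewrite -(fineK T1) lte_fin; near: M.
have TE : (\sum_(0 <= i <oo) (above a M i.+1 ^+ 2 * bnorm rho i.+1)%:E =
    \sum_(M <= i <oo) (a i.+1 ^+ 2 * bnorm rho i.+1)%:E)%E.
  rewrite [RHS]eseries_from; apply: eq_eseriesr => i _.
  by rewrite /above ltnS; case: leqP => // _; rewrite expr0n/= mul0r.
have mW := measurable_wnorm_Yseq (above a M) rho0.
have W0 u : (0 <= wnorm rho (Yseq (above a M) u))%E by exact: wnorm_ge0.
have mG : measurable [set u | (wnorm rho (Yseq (above a M) u) < e%:E)%E].
  by rewrite -[X in measurable X]setTI; apply: emeasurable_fun_infty_o.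
rewrite lt_neqAle measure_ge0 andbT eq_sym; apply/eqP => G0.
have := le_integral_abse Pr measurableT mW e0.
under eq_integral do rewrite gee0_abs//.
rewrite (_ : _ `&` _ = ~` [set u | (wnorm rho (Yseq (above a M) u) < e%:E)%E]); last first.
  rewrite setTI; apply/seteqP; split => u /=; rewrite gee0_abs// leNgt.
    by move/negP.
  by move=> ?; exact/negP.
move=> h.
have PC : Pr (~` [set u | (wnorm rho (Yseq (above a M) u) < e%:E)%E]) = 1%E.
  by rewrite probability_setC// G0 sube0.
have h' : (e%:E <= \int[Pr]_u wnorm rho (Yseq (above a M) u))%E.
  by rewrite -[leLHS]mule1 -PC; exact: h.
have := le_trans h' (expected_wnorm _ rho0); rewrite TE -/kp => h3.
have : (e%:E < e%:E)%E; last by rewrite ltxx.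
apply: le_lt_trans h3 _.
apply: (@le_lt_trans _ _ ((2%:E * kp) * q%:E)%E).
  by apply: lee_wpmul2l; [exact: mule_ge0|exact: ltW].
rewrite -(fineK kpfin) -!EFinM lte_fin /q.
rewrite mulrA ltr_pdivrMr ?mulr_gt0 ?ltr_wpDl//.
have := mulr_ge0 (ltW e0) kq0; lra.
Unshelve. all: by end_near. Qed.

Variables (w : nat -> R) (sg : nat -> R) (D : R).
Hypothesis w0 : forall n, (0 < n)%N -> 0 < w n.
Hypothesis iwD : forall n, (3 <= n)%N -> iw w n <= D.
Hypothesis sg0 : forall i, 0 < sg i.
Hypothesis sgsum : (\sum_(0 <= i <oo) (sg i.+1 ^+ 2 * bnorm (rho w) i.+1)%:E < +oo)%E.

Lemma muX_full_support : full_support (muX sg w0 iwD).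
Proof.
move=> U oU [x Ux]; rewrite muXE.
have [e e0 eU] := oU _ Ux.
have iw0 := @iw_ge0 R w.
have xfin : (wnorm (iw w) (coef x) < +oo)%E by rewrite -normw2E//; have [_ _] := coefP x.
(* The triangle inequality for squared norms costs a factor 2 on each term: head and tail at e/16
   each give e/4 to the combination, which together with its own e/4 to [x] gives e. *)
have e4 : 0 < e / 4 by rewrite divr_gt0.
have e16 : 0 < e / 16 by rewrite divr_gt0.
have [s hs] := approx_all iw0 iwD xfin e4.
have [al [K combE]] := comb_coord s.
have iwsum : (\sum_(0 <= i <oo) (sg i.+1 ^+ 2 * bnorm (iw w) i.+1)%:E < +oo)%E.
  apply: le_lt_trans sgsum; apply: lee_nneseries => [i _ _|i _].
    by rewrite lee_fin mulr_ge0 ?sqr_ge0 ?bnorm_ge0.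
  rewrite lee_fin ler_wpM2l ?sqr_ge0// /bnorm lerD// /tail3; case: ifP => // _;
  by rewrite lerDl hw_ge0.
have [M KM Mpos] : exists2 M, (K <= M)%N &
    (0 < Pr [set u | wnorm (iw w) (Yseq (above sg M) u) < (e / 16)%:E])%E.
  have [N _ hN] := above_small iw0 e16 iwsum.
  by exists (maxn K N); [exact: leq_maxl|apply: hN; exact: leq_maxr].
have [d d0 hd] := small_comb (fun i => sg i.+1) M iw0 e16.
(* The values of the Gaussian variables at which the head of the series is exactly the combination;
   positivity of [sg] allows the division. *)
pose a i := complex.Re (al i) / sg i.+1; pose b i := complex.Im (al i) / sg i.+1.
set G := [set u | _] in Mpos.
have mG : measurable G.
  by rewrite -[X in measurable X]setTI; apply: emeasurable_fun_infty_o => //; exact: measurable_wnorm_Yseq.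
have mB := measurable_box a b d M.
have mU : measurable U by exact: sub_gen_smallest.
have mgood := @measurable_good R w sg.
apply: (@lt_le_trans _ _ (Pr (good w sg `&` (box a b d M `&` G)))).
  rewrite -(@Pr_good_eq _ w sg sgsum (box a b d M `&` G)); last 3 first.
  - exact: measurableI.
  - apply: (measurableI _ _ mgood); exact: measurableI.
  - by move=> u gu; split => [h|[]].
  rewrite (fair_indep (@Pr_fair R) (D := [pred i : nat * bool * nat | (i.1.1 < M)%N]))//.
  - by rewrite mule_gt0// box_gt0.
  - exact: box_dep.
  - by move=> u v uv; rewrite /G/= (above_dep _ uv).
apply: le_measure; rewrite ?inE.
- by apply: measurableI => //; exact: measurableI.
- exact: (measurable_preimage (measurable_Yx sg w0 iwD) mU).
move=> u [gu [bu Gu]]; apply: eU; rewrite normw2E// (Yx_good w0 gu).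
apply: (wnorm_sub_lt iw0 (d := comb s) (r := e / 4) (s := e / 4)).
- rewrite (@eq_wnorm _ _ _ (fun n => \sum_(i < M)
      ((sg i.+1 * (xi i false u - a i)) +i* (sg i.+1 * (xi i true u - b i)))%C * (fcoef i.+1 n)%:C%C
      + Yseq (above sg M) u n)).
    apply: le_lt_trans (wnormD iw0 _ _) _.
    apply: (@lt_le_trans _ _ (2%:E * (e / 16)%:E + 2%:E * (e / 16)%:E)%E); last first.
      by rewrite -!EFinM -EFinD lee_fin; lra.
    apply: lteD; rewrite lte_pmul2l ?fin_numE//.
    exact: (hd (fun i => xi i false u - a i) (fun i => xi i true u - b i)).
  move=> n n3; rewrite (Yseq_split _ M)// (combE M KM)// addrAC -sumrB; congr (_ + _).
  apply: eq_bigr => i _; rewrite -mulrBl; congr (_ * _).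
  have sgn : sg i.+1 != 0 by rewrite gt_eqF.
  rewrite !mulrBr /a /b ![_ * (_ / _)]mulrC !divfK//.
  by case: (al i) => p q /=; simpc.
- rewrite -wnormN; move: hs; congr (_ < _)%E; apply: eq_eseriesr => n _.
  by rewrite opprB.
- lra.
Qed.

End support.

Lemma gaussian_ergodic_measure (R : realType) (w : nat -> R) :
  (forall n, (0 < n)%N -> 0 < w n) ->
  (exists2 d : R, 0 < d & forall n, (0 < n)%N -> d <= w n) ->
  (forall k, (3 <= k)%N ->
     (\sum_(0 <= n <oo) ((w (k * 2 ^ n)%N)^-1)%:E < +oo)%E) ->
  T_bounded w -> conclusion313 w.
Proof.
move=> w0 [d d0 dw] wsum wT.
have iwD n : (3 <= n)%N -> iw w n <= d^-1.
  move=> n3; have n0 : (0 < n)%N by exact: leq_trans n3.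
  by rewrite iwE// lef_pV2 ?posrE ?w0// dw.
have rsum k : (3 <= k)%N -> (\sum_(0 <= n <oo) (rho w (k * 2 ^ n))%:E < +oo)%E.
  move=> k3; have k0 : (0 < k)%N by exact: leq_trans k3.
  rewrite /rho; under eq_eseriesr do rewrite EFinD.
  rewrite nneseriesD; [|by move=> n _ _; rewrite lee_fin ?iw_ge0 ?hw_ge0..].
  apply: lte_add_pinfty; last exact: hw_sum.
  under eq_eseriesr do rewrite iwE ?muln_gt0 ?k0 ?expn_gt0//.
  exact: wsum.
have [sg [sg0 sg2 sgsum]] := sigma_exists (@rho_ge0 R w) rsum.
exists (muX sg w0 iwD); split.
- by move=> x; exact: Yx_gaussian.
- exact: muX_full_support.
- exact: muX_invariant.
- exact: muX_ergodic.
Qed.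

Theorem theorem3p13 (R : realType) :
  (forall w : nat -> R,
      (forall n, (0 < n)%N -> 0 < w n) ->
      (exists2 d : R, 0 < d & forall n, (0 < n)%N -> d <= w n) ->
      (forall k, (3 <= k)%N ->
         (\sum_(0 <= n <oo) ((w (k * 2 ^ n)%N)^-1)%:E < +oo)%E) ->
      T_bounded w ->
      conclusion313 w)
  /\ conclusion313 (@omega0 R).
Proof.
split; first exact: gaussian_ergodic_measure.
apply: gaussian_ergodic_measure.
- by move=> n _; exact: omega0_gt0.
- exact: omega0_lower.
- exact: omega0_sum.
- exact: omega0_T_bounded.
Qed.
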